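(* Let $\overline{\mathsf{es}}_{\mathbb{R}}:\mathbb{R}^{\mathbb{N}}\to\mathbb{R}$ be the restriction of the partial Markov kernel $\mathsf{es}_{\mathbb{R}}$ (defined in the context) to those sequences $(x_i)$ in the domain of $\mathsf{es}_{\mathbb{R}}$ for which additionally the sequence $\bigl(\frac1n\sum_{i=1}^n|x_i|\bigr)_n$ converges in $\mathbb{R}\cup\{\infty\}$ and satisfies $$\int_{\mathbb{R}}|y|\;\mathsf{es}_{\mathbb{R}}\bigl(dy\,|\,(x_i)\bigr)=\lim_{n\to\infty}\frac1n\sum_{i=1}^n|x_i|$$ (sequences for which both sides are infinite being included), and such that moreover, if both sides of this equation are finite, then the sequence $\bigl(\frac1n\sum_{i=1}^n x_i\bigr)_n$ converges and satisfies $$\int_{\mathbb{R}}y\;\mathsf{es}_{\mathbb{R}}\bigl(dy\,|\,(x_i)\bigr)=\lim_{n\to\infty}\frac1n\sum_{i=1}^n x_i.$$ Then $\overline{\mathsf{es}}_{\mathbb{R}}$ is an empirical sampling morphism for $\mathbb{R}$ in $\mathsf{Partial}(\mathsf{BorelStoch})$.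
   Context: $\mathbb{N}=\{1,2,3,\ldots\}$. $\mathsf{es}_{\mathbb{R}}$: a sequence $(x_i)\in\mathbb{R}^{\mathbb{N}}$ belongs to the domain of $\mathsf{es}_{\mathbb{R}}$ iff the limits $\lim_{n\to\infty}|\{i\le n\mid x_i\le t\}|/n$ exist uniformly in $t\in\mathbb{Q}$; in this case $\mathsf{es}_{\mathbb{R}}(\,\cdot\,|(x_i))$ is the unique probability measure on $\mathbb{R}$ (Borel $\sigma$-algebra) with $\mathsf{es}_{\mathbb{R}}(T|(x_i))=\lim_{n\to\infty}|\{i\le n\mid x_i\in T\}|/n$ for all intervals $T\subseteq\mathbb{R}$. $\mathsf{Partial}(\mathsf{BorelStoch})$ has standard Borel spaces as objects. A morphism $f:X\to Y$ is a partial Markov kernel: a measurable set $D_f\subseteq X$ (its domain) together with a Markov kernel $f(\cdot|x)$, $x\in D_f$, from $D_f$ to $Y$. The composite of $f:X\to Y$ and $g:Y\to Z$ has domain $D_{gf}=\{x\in D_f\mid f(D_g|x)=1\}$ and on it $(gf)(S|x)=\int_{D_g}g(S|y)\,f(dy|x)$. The tensor product of objects is the cartesian product with product $\sigma$-algebra; $f\otimes g$ for $f:A\to X$, $g:B\to Y$ has domain $D_f\times D_g$ and is given there by product measures. Two morphisms are equal iff they have the same domain and the same kernel on it. The Kolmogorov power $X^{\mathbb{N}}$ is the countable product with product $\sigma$-algebra. For a morphism $f:A\to X$, $f^{(\mathbb{N})}:A\to X^{\mathbb{N}}$ has domain $D_f$ and sends $a$ to the infinite product measure $f(\cdot|a)^{\otimes\mathbb{N}}$.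 For a finite permutation $\sigma$ of $\mathbb{N}$ (a bijection fixing all but finitely many elements), $X^\sigma:X^{\mathbb{N}}\to X^{\mathbb{N}}$ is the (everywhere defined) deterministic kernel given by $(x_i)\mapsto(x_{\sigma(i)})$. A morphism $f:A\to X^{\mathbb{N}}\otimes Y$ is exchangeable in the first factor if $(X^\sigma\otimes \mathrm{id}_Y)\,f=f$ for every finite permutation $\sigma$. An empirical sampling morphism for $X$ is a morphism $\mathsf{es}:X^{\mathbb{N}}\to X$ (so in particular its domain is measurable and it is a Markov kernel on it) such that: (i) (permutation invariance) $\mathsf{es}\,X^\sigma=\mathsf{es}$ for every finite permutation $\sigma$ of $\mathbb{N}$; (ii) (empirical adequacy) for all objects $A,Y$ and every morphism $f:A\to X^{\mathbb{N}}\otimes Y$ exchangeable in the first factor, $(\mathsf{es}^{(\mathbb{N})}\otimes \mathrm{id}_Y)\,f=f$. *)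

(* Defs.v *)
From HB Require Import structures.
From mathcomp Require Import all_boot all_order all_algebra.
From mathcomp Require Import all_classical all_reals all_analysis.
From mathcomp Require Import measurable_realfun.

Set Implicit Arguments.
Unset Strict Implicit.
Unset Printing Implicit Defensive.

Import Order.TTheory GRing.Theory Num.Theory.
Import numFieldNormedType.Exports.

Local Open Scope classical_set_scope.
Local Open Scope ring_scope.

(** Conventions.
    - Sequences are indexed from 0: the term [x_i] of a sequence [(x_i)_{i>=1}]
      is [x (i - 1)], so the first [n] terms are the [x i] with [i < n].
    - [measurableType] is pointed, so the empty standard Borel space is not
      represented.  The only morphism into or out of it is the one with empty
      domain, for which the equation of empirical adequacy holds trivially. *)

(** A measurable space isomorphic to a Polish space with its Borel sets.
    As [h] is bijective, every subset of [T] is some [h @^-1` B]. *)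
Definition standard_borel (R : realType) d (T : measurableType d) : Prop :=
  exists (P : metricType R) (h : T -> P),
    [/\ forall F : set_system P, ProperFilter F -> cauchy F ->
          exists p : P, F --> p,
        exists2 S : set P, countable S & dense S,
        bijective h
      & forall B : set P, <<s @open P >> B <-> measurable (h @^-1` B)].

Definition coordinate_preimages d (X : measurableType d) :
    set (set (nat -> X)) :=
  \bigcup_i preimage_set_system setT (fun x : nat -> X => x i) measurable.

Definition seqspace d (X : measurableType d) : Type :=
  g_sigma_algebraType (coordinate_preimages (X := X)).

(** Partial kernels are given by raw data, the values of [pker f] outside
    [pdom f] and on non-measurable sets being irrelevant;
    [partial_markov] singles out the morphisms of Partial(BorelStoch). *)
Record pkernel (R : realType) d d' (X : measurableType d)
    (Y : measurableType d') := PKernel {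
  pdom : set X ;
  pker : X -> set Y -> \bar R }.

Arguments PKernel R {d d' X Y}.

Section partial_kernels.
Context (R : realType).
Local Open Scope ereal_scope.

Definition partial_markov d d' (X : measurableType d) (Y : measurableType d')
    (f : pkernel R X Y) : Prop :=
  [/\ measurable (pdom f),
      forall x, pdom f x ->
        exists P : probability Y R, pker f x = P :> (set Y -> \bar R)
    & forall S, measurable S -> measurable_fun (pdom f) (pker f ^~ S)].

Definition pkeq d d' (X : measurableType d) (Y : measurableType d')
    (f g : pkernel R X Y) : Prop :=
  pdom f = pdom g /\
  forall x, pdom f x -> forall S, measurable S -> pker f x S = pker g x S.

Definition pkcomp d d' d'' (X : measurableType d) (Y : measurableType d')
    (Z : measurableType d'') (g : pkernel R Y Z) (f : pkernel R X Y) :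
    pkernel R X Z :=
  PKernel R [set x | pdom f x /\ pker f x (pdom g) = 1]
    (fun x S => \int[pker f x]_(y in pdom g) pker g y S).

Definition pktensor d1 d2 d3 d4 (A : measurableType d1) (X : measurableType d2)
    (B : measurableType d3) (Y : measurableType d4)
    (f : pkernel R A X) (g : pkernel R B Y) : pkernel R (A * B)%type (X * Y)%type :=
  PKernel R (pdom f `*` pdom g) (fun ab => pker f ab.1 \x pker g ab.2).

Definition pkdet d d' (X : measurableType d) (Y : measurableType d')
    (h : X -> Y) : pkernel R X Y :=
  PKernel R setT (fun x => \d_(h x)).

Definition pkid d (X : measurableType d) : pkernel R X X := pkdet idfun.

Definition is_infinite_product d (X : measurableType d) (P : set X -> \bar R)
    (mu : probability (seqspace X) R) : Prop :=
  forall (n : nat) (A : nat -> set X), (forall i, measurable (A i)) ->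
    mu [set x | forall i, (i < n)%N -> A i (x i)] = \prod_(i < n) P (A i).

(** The infinite product measure, selected by its characteristic property,
    which determines it on measurable sets when [P] is a probability measure. *)
Definition infinite_product d (X : measurableType d) (P : set X -> \bar R) :
    probability (seqspace X) R :=
  xget (\d_(point : seqspace X) : probability (seqspace X) R)
    [set mu | is_infinite_product P mu].

Definition pkpower d d' (A : measurableType d) (X : measurableType d')
    (f : pkernel R A X) : pkernel R A (seqspace X) :=
  PKernel R (pdom f) (fun a => infinite_product (pker f a)).

Definition finite_permutation (s : nat -> nat) : Prop :=
  bijective s /\ finite_set [set i | s i <> i].

Definition pkperm d (X : measurableType d) (s : nat -> nat) :
    pkernel R (seqspace X) (seqspace X) :=
  pkdet (fun x : seqspace X => (fun i => x (s i)) : seqspace X).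

Definition exchangeable_fst d d' d'' (A : measurableType d)
    (X : measurableType d') (Y : measurableType d'')
    (f : pkernel R A (seqspace X * Y)%type) : Prop :=
  forall s, finite_permutation s ->
    pkeq (pkcomp (pktensor (pkperm X s) (pkid Y)) f) f.

Definition permutation_invariant d (X : measurableType d)
    (es : pkernel R (seqspace X) X) : Prop :=
  forall s, finite_permutation s -> pkeq (pkcomp es (pkperm X s)) es.

Definition empirically_adequate d (X : measurableType d)
    (es : pkernel R (seqspace X) X) : Prop :=
  forall dA dY (A : measurableType dA) (Y : measurableType dY),
    standard_borel R A -> standard_borel R Y ->
  forall f : pkernel R A (seqspace X * Y)%type,
    partial_markov f -> exchangeable_fst f ->
    pkeq (pkcomp (pktensor (pkpower es) (pkid Y)) f) f.

Definition empirical_sampling_morphism d (X : measurableType d)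
    (es : pkernel R (seqspace X) X) : Prop :=
  [/\ standard_borel R X, partial_markov es,
      permutation_invariant es & empirically_adequate es].

End partial_kernels.

Section empirical_sampling_real.
Context (R : realType).

Definition freq (x : nat -> R) (T : set R) (n : nat) : R :=
  #|[pred i : 'I_n | x i \in T]|%:R / n%:R.

Definition es_dom : set (seqspace R) :=
  [set x | exists L : rat -> R,
    {uniform, (fun n (t : rat) => freq x [set y | y <= ratr t] n) @ \oo --> L}].

Definition is_empirical_measure (x : nat -> R) (P : probability R R) : Prop :=
  forall I : interval R, (freq x [set` I] n)%:E @[n --> \oo] --> P [set` I].

Definition es_measure (x : nat -> R) : probability R R :=
  xget (\d_(0 : R) : probability R R) [set P | is_empirical_measure x P].

Definition es_real : pkernel R (seqspace R) R :=
  PKernel R es_dom es_measure.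

Definition mean (x : nat -> R) (n : nat) : R := (\sum_(i < n) x i) / n%:R.

Definition abs_mean_condition (x : seqspace R) : Prop :=
  (mean (fun i => `|x i|) n)%:E @[n --> \oo]
    --> (\int[pker es_real x]_y `|y|%:E)%E.

Definition mean_condition (x : seqspace R) : Prop :=
  mean x n @[n --> \oo] --> (\int[pker es_real x]_y y)%R.

Definition es_real_bar : pkernel R (seqspace R) R :=
  PKernel R
    [set x | [/\ pdom es_real x, abs_mean_condition x
      & (\int[pker es_real x]_y `|y|%:E < +oo)%E -> mean_condition x]]
    (pker es_real).

End empirical_sampling_real.

(* Main.v *)
From HB Require Import structures.
Require Import Defs.
From mathcomp Require Import all_boot all_order all_algebra.
From mathcomp Require Import all_classical all_reals all_analysis.
From mathcomp Require Import measurable_realfun giry ring lra zify.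

Set Implicit Arguments.
Unset Strict Implicit.
Unset Printing Implicit Defensive.

Import Order.TTheory GRing.Theory Num.Theory.
Import numFieldNormedType.Exports.

Local Open Scope classical_set_scope.
Local Open Scope ring_scope.

(** Two classical theorems carry the proof: the strong law of large numbers
    puts independent samples into the domain of the restricted kernel, and
    de Finetti's theorem says that an exchangeable sequence is an independent
    sample from a random measure which the sequence itself determines.

    The random measure is [directing x]: the probability whose distribution
    function is the limit of the empirical distribution functions of [x], read
    off at rational points.  It depends measurably on [x] (measurable_directing)
    and is unchanged by finite permutations of [x].  On the domain of the
    empirical kernel it agrees with [es_measure x] (es_measure_directing), where
    uniform convergence at rational points gives the frequencies of all
    intervals: no term of a finite sample lies between a given real point and a
    rational point close enough to it.  This settles measurability and invariance.

    For empirical adequacy let [mu] be a law on pairs of a sequence and a point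
    of [Y], exchangeable in the sequence.  It is invariant under the shift, so
    by the pointwise ergodic theorem (birkhoff_cvg) all frequencies converge
    almost surely; their limits integrate to the distribution function of the
    first coordinate, which excludes a loss of mass at infinity, so the directing
    measure exists almost surely (exchangeable_directable).  If [Z] is fixed by
    exchanging the coordinate [m] with later ones, then the integral of
    [Z * 1_B(x_m)] equals that of [Z * 1_B(x_j)] for every [j >= m], hence in the
    limit that of [Z] times the frequency of [B]; approximation by rays turns the
    frequency into [directing x B] (replace_directing).  Replacing the coordinates
    of a cylinder one after the other gives de_finetti: [mu] is preserved when the
    sequence is replaced by an independent sample from its directing measure.

    It remains to see that the composite with the empirical kernel is defined
    almost everywhere.  By de_finetti this is a statement about independent
    samples: the law of large numbers for indicators makes the empirical
    distribution functions converge, uniformly by monotonicity (Glivenko and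
    Cantelli, uniform_of_quantiles), and the law of large numbers for the
    absolute value and for the positive and negative parts gives the two
    conditions on means (iid_es_real_bar).  The law of large numbers holds for
    nonnegative functions of possibly infinite integral and comes from the
    maximal ergodic lemma (maximal_ergodic), as an event invariant under the
    shift is independent of the first coordinate.

    Infinite product measures are selected by their characteristic property, so
    existence has to be proved (infinite_productP): the binary digits of a uniform
    variable are independent fair coins; the even tosses are turned into one real
    number of the prescribed law, the odd tosses are again independent fair coins,
    and the construction is iterated. *)

(** * Image measures and sequence spaces *)

Section image_probability.
Context d d' (T : measurableType d) (T' : measurableType d') (R : realType).
Variables (P : probability T R) (f : T -> T').
Hypothesis mf : measurable_fun setT f.

Definition image_prob_ : set T' -> \bar R := fun A => P (f @^-1` A).

Let image0 : image_prob_ set0 = 0%E.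
Proof. by rewrite /image_prob_ preimage_set0 measure0. Qed.

Let image_ge0 A : (0 <= image_prob_ A)%E.
Proof. exact: measure_ge0. Qed.

Let image_sigma_additive : semi_sigma_additive image_prob_.
Proof.
move=> F mF tF mUF; rewrite /image_prob_ preimage_bigcup.
apply: measure_semi_sigma_additive.
- by move=> n; rewrite -[X in measurable X]setTI; exact: mf.
- apply/trivIsetP => /= i j _ _ ij; rewrite -preimage_setI.
  by move/trivIsetP : tF => /(_ _ _ _ _ ij) ->//; rewrite preimage_set0.
- by rewrite -preimage_bigcup -[X in measurable X]setTI; exact: mf.
Qed.

HB.instance Definition _ := isMeasure.Build _ _ _ image_prob_
  image0 image_ge0 image_sigma_additive.

Let image_setT : image_prob_ setT = 1%E.
Proof. by rewrite /image_prob_ preimage_setT probability_setT. Qed.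

HB.instance Definition _ := Measure_isProbability.Build _ _ _ image_prob_
  image_setT.

Definition image_prob : probability T' R := image_prob_.

Lemma image_probE A : image_prob A = P (f @^-1` A).
Proof. by []. Qed.

Lemma ge0_integral_image (g : T' -> \bar R) : measurable_fun setT g ->
  (forall y, (0 <= g y)%E) ->
  (\int[image_prob]_y g y = \int[P]_x g (f x))%E.
Proof.
by move=> mg g0; rewrite -[RHS](ge0_integral_pushforward mf P measurableT mg).
Qed.

End image_probability.

Lemma probability_setI1 d (T : measurableType d) (R : realType)
    (P : probability T R) A I : measurable A -> measurable I -> P I = 1%E ->
  P (A `&` I) = P A.
Proof.
move=> mA mI PI; rewrite -[in RHS](setIT A) -(setvU I) setIUr measureU//.
- rewrite [X in (X + _)%E](_ : _ = 0%E) ?add0e//.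
  apply/eqP; rewrite -measure_le0.
  apply: (@le_trans _ _ (P (~` I))).
    apply: le_measure; rewrite ?inE; last exact: subIsetr.
    + by apply: measurableI => //; exact: measurableC.
    + exact: measurableC.
  by rewrite probability_setC// PI subee.
- by apply: measurableI => //; exact: measurableC.
- exact: measurableI.
- by rewrite setIACA setICl setI0.
Qed.

Lemma finite_measure_unique d (T : measurableType d) (R : realType)
    (G : set (set T)) (P Q : {finite_measure set T -> \bar R}) :
  measurable = <<s G >> -> setI_closed G -> P setT = Q setT ->
  (forall A, G A -> P A = Q A) ->
  forall A, measurable A -> P A = Q A.
Proof.
move=> mG GI PQT PQ; rewrite [in X in forall A, X A -> _]mG.
apply: (dynkin_induction mG GI) => //.
- move=> S mS PQS; rewrite -setTD !measureD// ?setTI.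
  + by congr (_ - _)%E; [exact: PQT|exact: PQS].
  + by rewrite -ge0_fin_numE// fin_num_measure.
  + by rewrite -ge0_fin_numE// fin_num_measure.
- move=> F mF tF PQF.
  by rewrite !measure_bigcup//; apply: eq_eseriesr => n _; exact: PQF.
Qed.

Section seqspace.
Context d (X : measurableType d).

Lemma measurable_coord (i : nat) :
  measurable_fun setT (fun x : seqspace X => x i : X).
Proof.
move=> _ A mA; rewrite setTI; apply: sub_sigma_algebra.
by exists i => //; exists A => //; rewrite setTI.
Qed.

Lemma measurable_seqspace d' (T : measurableType d') (f : T -> seqspace X) :
  (forall i, measurable_fun setT (fun t => f t i : X)) -> measurable_fun setT f.
Proof.
move=> mf; apply: (@measurability _ _ _ _ setT f (coordinate_preimages (X:=X))) => //.
move=> _ [_ [i _ [A mA <-]] <-]; rewrite !setTI.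
by have := mf i measurableT A mA; rewrite setTI.
Qed.

Definition cylinder (n : nat) (A : nat -> set X) : set (seqspace X) :=
  [set x | forall i, (i < n)%N -> A i (x i)].

Lemma measurable_cylinder n A : (forall i, measurable (A i)) ->
  measurable (cylinder n A).
Proof.
move=> mA; rewrite (_ : cylinder n A =
  \bigcap_(i in [set i | (i < n)%N]) (fun x : seqspace X => x i) @^-1` A i).
  apply: bigcap_measurableType => i _.
  by rewrite -[X in measurable X]setTI; exact: measurable_coord.
by apply/seteqP; split => x /= h i; exact: h.
Qed.

Definition cylinders : set (set (seqspace X)) :=
  [set S | exists n A, (forall i, measurable (A i)) /\ S = cylinder n A].

Lemma cylinders_setI : setI_closed cylinders.
Proof.
move=> _ _ [n [A [mA ->]]] [m [B [mB ->]]].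
exists (maxn n m).
exists (fun i => (if (i < n)%N then A i else setT) `&`
                 (if (i < m)%N then B i else setT)).
split; first by move=> i; apply: measurableI; case: ifP.
apply/seteqP; split => x.
- move=> [hA hB] i _; split; case: ifPn => // im; [exact: hA|exact: hB].
- move=> h; split => i ilt.
    by have := h i; rewrite leq_max ilt => /(_ isT)[].
  by have := h i; rewrite leq_max ilt orbT => /(_ isT)[].
Qed.

Lemma cylindersE : measurable = <<s cylinders >>.
Proof.
apply/seteqP; split; last first.
  apply: smallest_sub; first exact: sigma_algebra_measurable.
  by move=> _ [n [A [mA ->]]]; exact: measurable_cylinder.
apply: smallest_sub; first exact: smallest_sigma_algebra.
move=> _ [i _ [A mA <-]]; rewrite setTI; apply: sub_sigma_algebra.
exists i.+1, (fun j => if j == i then A else setT); split.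
  by move=> j; case: ifP.
apply/seteqP; split => x /=.
- by move=> Ax j _; case: ifPn => [/eqP ->|].
- by move=> /(_ i (ltnSn i)); rewrite eqxx.
Qed.

Lemma cylinder0 (A : nat -> set X) : cylinder 0 A = setT.
Proof. by apply/seteqP; split. Qed.

Lemma cylindersXE d' (Y : measurableType d') :
  @measurable _ (seqspace X * Y)%type =
  <<s [set S `*` C | S in cylinders & C in measurable] >>.
Proof.
apply/seteqP; split; last first.
  apply: smallest_sub; first exact: sigma_algebra_measurable.
  move=> _ [_ [n [A [mA ->]]] [C mC <-]].
  by apply: measurableX => //; exact: measurable_cylinder.
set G := [set S `*` C | S in cylinders & C in measurable].
rewrite measurable_prod_measurableType.
apply: smallest_sub; first exact: smallest_sigma_algebra.
move=> _ [S mS [C mC <-]].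
have cylT : cylinders setT.
  by exists 0%N, (fun=> setT); split => //; apply/seteqP; split.
have sG := smallest_sigma_algebra setT G.
move: S mS; rewrite cylindersE; apply: smallest_sub => //.
  split.
  - by rewrite set0X; case: sG.
  - move=> S /= GS; rewrite setTD.
    have -> : ~` S `*` C = (~` (S `*` C)) `&` (setT `*` C).
      apply/seteqP; split => -[a b]/=.
        by move=> [? ?]; split => // -[].
      by move=> [h [_ ?]]; split => // ?; apply: h.
    apply: (@measurableI _ (g_sigma_algebraType G)).
      exact: (@measurableC _ (g_sigma_algebraType G)).
    by apply: sub_sigma_algebra; exists setT => //; exists C.
  - by move=> F GF; rewrite setX_bigcupl; case: sG => _ _; apply.
by move=> S cS; apply: sub_sigma_algebra; exists S => //; exists C.
Qed.

Lemma seqspaceX_unique (R : realType) d' (Y : measurableType d')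
    (P Q : {finite_measure set (seqspace X * Y)%type -> \bar R}) :
  (forall n A C, (forall i, measurable (A i)) -> measurable C ->
     P (cylinder n A `*` C) = Q (cylinder n A `*` C)) ->
  forall S, measurable S -> P S = Q S.
Proof.
move=> PQ; apply: (finite_measure_unique (cylindersXE Y)).
- move=> _ _ [S cS [C mC <-]] [S' cS' [C' mC' <-]].
  exists (S `&` S'); first exact: cylinders_setI.
  by exists (C `&` C'); [exact: measurableI|rewrite setXI].
- by rewrite -setXTT -(cylinder0 (fun=> setT)); exact: PQ.
- by move=> _ [_ [n [A [mA ->]]] [C mC <-]]; exact: PQ.
Qed.

End seqspace.

Section rays.
Context (R : realType).

Let rays : set (set R) := range (fun t : R => `]-oo, t]%classic).

Lemma real_rays_generate : @measurable _ R = <<s rays >>.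
Proof.
apply/seteqP; split; last first.
  by apply: smallest_sub => [|_ [t _ <-]]; [exact: sigma_algebra_measurable|].
rewrite [X in X `<=` _]RGenOInfty.measurableE.
apply: smallest_sub; first exact: smallest_sigma_algebra.
move=> _ [x ->]; rewrite -setCitvl -setTD; apply: sigma_algebraCD.
by apply: sub_sigma_algebra; exists x.
Qed.

Lemma real_rays_setI : setI_closed rays.
Proof.
move=> _ _ [s _ <-] [t _ <-]; exists (Num.min s t) => //.
apply/seteqP; split => x /=; rewrite !in_itv/= le_min.
  by move=> /andP[].
by move=> [-> ->].
Qed.

Lemma real_probability_unique (P Q : probability R R) :
  (forall t, P `]-oo, t]%classic = Q `]-oo, t]%classic) ->
  forall A, measurable A -> P A = Q A.
Proof.
move=> PQ; apply: (finite_measure_unique real_rays_generate real_rays_setI).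
  exact: (etrans (probability_setT P) (esym (probability_setT Q))).
by move=> _ [t _ <-]; exact: PQ.
Qed.

End rays.

(** * Averages along a measure-preserving map *)

Section ergodic.
Context d (T : measurableType d) (R : realType) (mu : probability T R).
Variable th : T -> T.
Hypothesis mth : measurable_fun setT th.
Hypothesis th_mu : forall S, measurable S -> mu (th @^-1` S) = mu S.

Definition birkhoff_sum (f : T -> R) n x : R := \sum_(i < n) f (iter i th x).

Lemma birkhoff_sumS f n x :
  birkhoff_sum f n.+1 x = f x + birkhoff_sum f n (th x).
Proof.
rewrite /birkhoff_sum big_ord_recl /=; congr (_ + _).
by apply: eq_bigr => i _; rewrite /bump/= -iterSr.
Qed.

Lemma measurable_iter n : measurable_fun setT (iter n th).
Proof.
by elim: n => [|n IH]; [exact: measurable_id|exact: measurableT_comp].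
Qed.

Lemma measurable_birkhoff_sum (f : T -> R) n : measurable_fun setT f ->
  measurable_fun setT (birkhoff_sum f n).
Proof.
move=> mf; rewrite /birkhoff_sum; apply: measurable_sum => i.
by apply: measurableT_comp => //; exact: measurable_iter.
Qed.

Lemma ge0_integral_preserving (g : T -> \bar R) : measurable_fun setT g ->
  (forall x, 0 <= g x)%E -> (\int[mu]_x g (th x) = \int[mu]_x g x)%E.
Proof.
move=> mg g0; rewrite -(ge0_integral_image mu mth mg g0).
by apply: eq_measure_integral => A mA _; exact: th_mu.
Qed.

Lemma ge0_integral_preserving_in (g : T -> \bar R) E : measurable E ->
  (forall x, E (th x) <-> E x) -> measurable_fun setT g ->
  (forall x, 0 <= g x)%E ->
  (\int[mu]_(x in E) g (th x) = \int[mu]_(x in E) g x)%E.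
Proof.
move=> mE thE mg g0; rewrite integral_mkcond [RHS]integral_mkcond.
rewrite -[RHS]ge0_integral_preserving; last 2 first.
- by apply/(measurable_restrictT _ mE); exact: measurable_funTS.
- by move=> x; rewrite patchE; case: ifP.
apply: eq_integral => x _; rewrite !patchE.
by rewrite (_ : (th x \in E) = (x \in E))//; apply/idP/idP; rewrite !inE => /thE.
Qed.

(** [excess f b n x] is the largest of the numbers [birkhoff_sum f k x - b * k] for
    [k <= n]. *)
Fixpoint excess (f : T -> R) (b : R) n x : R :=
  if n is n'.+1 then Num.max 0 (f x - b + excess f b n' (th x)) else 0.

Lemma excess_ge0 f b n x : 0 <= excess f b n x.
Proof. by case: n => [|n] //=; rewrite le_max lexx. Qed.

Lemma excess_le f b n x : excess f b n x <= excess f b n.+1 x.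
Proof.
elim: n x => [|n IH] x; first exact: excess_ge0.
rewrite [in leLHS]/= [in leRHS]/=; rewrite ge_max le_max lexx /=.
by rewrite le_max lerD2l IH orbT.
Qed.

Lemma birkhoff_sum_le_excess f b n x :
  birkhoff_sum f n x - b * n%:R <= excess f b n x.
Proof.
elim: n x => [|n IH] x.
  by rewrite /birkhoff_sum big_ord0 mulr0 subr0.
rewrite birkhoff_sumS /= le_max; apply/orP; right.
have := IH (th x); rewrite -natr1 mulrDr mulr1; lra.
Qed.

Lemma measurable_excess (f : T -> R) b n : measurable_fun setT f ->
  measurable_fun setT (excess f b n).
Proof.
move=> mf; elim: n => [|n IH]; first exact: measurable_cst.
apply: measurable_maxr => //; apply: measurable_funD.
  exact: measurable_funB.
exact: measurableT_comp.
Qed.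

Lemma integral_excess_lty (f : T -> R) b n : measurable_fun setT f ->
  (forall x, 0 <= f x) -> 0 <= b -> (\int[mu]_x (f x)%:E < +oo)%E ->
  (\int[mu]_x (excess f b n x)%:E < +oo)%E.
Proof.
move=> mf f0 b0 foo; elim: n => [|n IH]; first by rewrite integral0.
have mex := measurable_excess b n mf.
apply: (@le_lt_trans _ _ (\int[mu]_x ((f x)%:E + (excess f b n (th x))%:E))%E).
  apply: ge0_le_integral => //.
  - by move=> x _; rewrite lee_fin excess_ge0.
  - exact/measurable_EFinP/measurable_excess.
  - apply: emeasurable_funD; apply/measurable_EFinP => //.
    exact: measurableT_comp.
  move=> x _; rewrite -EFinD lee_fin /= ge_max.
  rewrite addr_ge0 ?excess_ge0//= lerD2r; lra.
rewrite ge0_integralD//.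
- rewrite (@ge0_integral_preserving (fun x => (excess f b n x)%:E)).
  + exact: lte_add_pinfty.
  + exact/measurable_EFinP.
  + by move=> x; rewrite lee_fin excess_ge0.
- by move=> x _; rewrite lee_fin.
- exact/measurable_EFinP.
- by move=> x _; rewrite lee_fin excess_ge0.
- by apply/measurable_EFinP; exact: measurableT_comp.
Qed.

(** Maximal ergodic lemma.  Where [M = excess f b n] is positive,
    [f + M \o th >= M + b]; integrating over the invariant set [E], the two
    integrals of [M] cancel because [th] preserves [mu]. *)
Lemma maximal_ergodic (f : T -> R) (b : R) E : measurable_fun setT f ->
  (forall x, 0 <= f x) -> (\int[mu]_x (f x)%:E < +oo)%E -> 0 <= b ->
  measurable E -> (forall x, E (th x) <-> E x) ->
  (forall x, E x -> exists n, b * n%:R < birkhoff_sum f n x) ->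
  (b%:E * mu E <= \int[mu]_(x in E) (f x)%:E)%E.
Proof.
move=> mf f0 foo b0 mE thE Eb.
pose F n := E `&` [set x | 0 < excess f b n x].
have mF n : measurable (F n).
  apply: measurableI => //.
  rewrite -[X in measurable X]setTI; apply: measurable_fun_ltr => //.
  exact: measurable_excess.
have mex n := measurable_excess b n mf.
have FE n : F n `<=` E by move=> x [].
have step n : (b%:E * mu (F n) <= \int[mu]_(x in E) (f x)%:E)%E.
  have MF : (\int[mu]_(x in F n) (excess f b n x)%:E =
             \int[mu]_(x in E) (excess f b n x)%:E)%E.
    rewrite integral_mkcond [RHS]integral_mkcond; apply: eq_integral => x _.
    rewrite !patchE; case: ifPn => [|xF]; first by rewrite inE => /FE /mem_set ->.
    case: ifPn => // xE; congr EFin; apply/esym/eqP.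
    rewrite eq_le excess_ge0 andbT leNgt; apply: contra xF => xM.
    by apply/mem_set; split => //; exact/set_mem.
  have Mfin : (\int[mu]_(x in E) (excess f b n x)%:E)%E \is a fin_num.
    rewrite ge0_fin_numE; last by apply: integral_ge0 => x _; rewrite lee_fin excess_ge0.
    apply: le_lt_trans (integral_excess_lty n mf f0 b0 foo).
    apply: ge0_subset_integral => //; first exact/measurable_EFinP.
    by move=> x _; rewrite lee_fin excess_ge0.
  have ex0 k x : (0 <= (excess f b k x)%:E)%E by rewrite lee_fin excess_ge0.
  rewrite -(leeD2rE _ _ Mfin).
  rewrite -[X in (_ <= _ + X)%E](@ge0_integral_preserving_in _ E mE thE
     (proj2 (measurable_EFinP _ _) (mex n)) (ex0 n)).
  rewrite -MF -integral_cst//.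
  rewrite -ge0_integralD//; last by exact/measurable_EFinP/measurable_funTS.
  have -> : (\int[mu]_(x in E) (f x)%:E +
      \int[mu]_(x in E) (EFin \o excess f b n) (th x) =
      \int[mu]_(x in E) ((f x)%:E + (excess f b n (th x))%:E))%E.
    rewrite ge0_integralD//.
    - by move=> x _; rewrite lee_fin.
    - exact/measurable_EFinP/measurable_funTS.
    - by apply/measurable_EFinP/measurable_funTS; exact: measurableT_comp.
  apply: (@le_trans _ _ (\int[mu]_(x in F n)
      ((f x)%:E + (excess f b n (th x))%:E))%E).
    apply: ge0_le_integral => //.
    - by move=> x _; rewrite adde_ge0// lee_fin.
    - by apply: emeasurable_funD => //; exact/measurable_EFinP/measurable_funTS.
    - apply: emeasurable_funD; apply/measurable_EFinP/measurable_funTS => //.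
      exact: measurableT_comp.
    move=> x [_ /= Mx]; rewrite -!EFinD lee_fin.
    case: n Mx {mex MF Mfin ex0} => [|n]; first by rewrite /= ltxx.
    have := excess_le f b n (th x) => /=.
    move: (excess f b n.+1 (th x)) => /= M' le'.
    rewrite lt_max ltxx /= => /ltW Mx; rewrite max_r//; lra.
  apply: ge0_subset_integral => //.
    apply: emeasurable_funD; apply/measurable_EFinP/measurable_funTS => //.
    exact: measurableT_comp.
  by move=> x _; rewrite adde_ge0// lee_fin.
have cvgF : mu (F n) @[n --> \oo] --> mu (\bigcup_n F n).
  apply: nondecreasing_cvg_mu => //; first exact: bigcup_measurable.
  apply/nondecreasing_seqP => n; apply/subsetPset => x [Ex /= Mx]; split => //=.
  exact: lt_le_trans Mx (excess_le _ _ _ _).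
have FU : \bigcup_n F n = E.
  apply/seteqP; split => [x [n _ /FE//]|x Ex].
  have [n bn] := Eb _ Ex; exists n => //; split => //=.
  by apply: lt_le_trans (birkhoff_sum_le_excess _ _ _ _); rewrite subr_gt0.
rewrite -FU; apply: (@cvge_le _ \oo _ _ (fun n => b%:E * mu (F n))%E).
- by rewrite FU; apply: nearW => n; exact: step.
- by apply: cvgeZl => //.
Qed.

End ergodic.

Lemma ae_forall_countable (I : countType) d (T : measurableType d)
    (R : realType) (mu : {measure set T -> \bar R}) (P : I -> T -> Prop) :
  (forall i, {ae mu, forall x, P i x}) -> {ae mu, forall x, forall i, P i x}.
Proof.
move=> aeP.
have : {ae mu, forall x, forall n, forall i, unpickle n = Some i -> P i x}.
  apply: ae_foralln => n; case: (unpickle n) => [j|]; last exact: aeW.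
  by apply: filterS (aeP j) => x Px i [<-].
by apply: filterS => x h i; apply: (h (pickle i)); rewrite pickleK.
Qed.

Section ergodic_limits.
Context d (T : measurableType d) (R : realType) (mu : probability T R).
Variable th : T -> T.
Hypothesis mth : measurable_fun setT th.
Hypothesis th_mu : forall S, measurable S -> mu (th @^-1` S) = mu S.

Local Notation S := (birkhoff_sum th).

(** The set where the upper limit of the averages of [f] is larger than [b]. *)
Definition exceeds (f : T -> R) (b : R) : set T :=
  [set x | exists k, forall N, exists n,
     (N <= n)%N /\ (b + k.+1%:R^-1) * n%:R < S f n x].

Lemma exceeds_gt (f : T -> R) b c x : b < c ->
  (forall N, exists n, (N <= n)%N /\ c * n%:R < S f n x) -> exceeds f b x.
Proof.
move=> /ltr_add_invr[k bk] h; exists k => N.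
have [n [Nn cn]] := h N; exists n; split => //.
by apply: le_lt_trans cn; rewrite ler_wpM2r// ltW.
Qed.

Lemma measurable_exceeds (f : T -> R) b : measurable_fun setT f ->
  measurable (exceeds f b).
Proof.
move=> mf; rewrite (_ : exceeds f b = \bigcup_k \bigcap_N \bigcup_n
   (if (N <= n)%N then [set x | (b + k.+1%:R^-1) * n%:R < S f n x] else set0)).
  apply: bigcupT_measurable => k; apply: bigcapT_measurable => N.
  apply: bigcupT_measurable => n; case: ifP => _ //.
  rewrite -[X in measurable X]setTI; apply: measurable_fun_ltr => //.
  exact: measurable_birkhoff_sum.
apply/seteqP; split => x /=.
  move=> [k h]; exists k => // N _; have [n [Nn hn]] := h N.
  by exists n => //; rewrite Nn.
move=> [k _ h]; exists k => N; have [n _] := h N I.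
by case: ifP => // Nn hn; exists n.
Qed.

(** Shifting the orbit by one step changes the sums by one term, which is
    negligible against half of the margin [k.+1^-1] for large [n]. *)
Lemma exceeds_invariant (f : T -> R) b x : 0 <= b ->
  exceeds f b (th x) <-> exceeds f b x.
Proof.
move=> b0; split => -[k h].
  have [e] : exists e : R, e = k.+1%:R^-1 / 2 by eexists.
  have k0 : 0 < k.+1%:R^-1 :> R by rewrite invr_gt0.
  move=> eE; have e0 : 0 < e by rewrite eE divr_gt0.
  apply: (@exceeds_gt _ _ (b + e)); first by rewrite ltrDl.
  move=> N; pose M := Num.truncn (((b + e) + `|f x|) / e).
  have [n [Nn hn]] := h (maxn N M.+1).
  move: Nn; rewrite geq_max => /andP[Nn Mn].
  exists n.+1; split; first by rewrite (leq_trans Nn).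
  rewrite birkhoff_sumS -natr1.
  have : ((b + e) + `|f x|) / e < n%:R.
    apply: lt_le_trans (_ : M.+1%:R <= _); last by rewrite ler_nat.
    by rewrite truncnS_gt.
  rewrite ltr_pdivrMr// => hM.
  have : - f x <= `|f x| by rewrite -normrN ler_norm.
  have ke : k.+1%:R^-1 = e + e by rewrite eE -splitr.
  rewrite ke in hn.
  move: hn hM; rewrite !mulrDl !mulrDr !mulr1 [n%:R * e]mulrC. lra.
have [e] : exists e : R, e = k.+1%:R^-1 / 2 by eexists.
have k0 : 0 < k.+1%:R^-1 :> R by rewrite invr_gt0.
move=> eE; have e0 : 0 < e by rewrite eE divr_gt0.
apply: (@exceeds_gt _ _ (b + e)); first by lra.
move=> N; pose M := Num.truncn (`|f x| / e).
have [n [Nn hn]] := h (maxn N.+1 M.+1).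
move: Nn; rewrite geq_max => /andP[Nn Mn].
case: n Nn Mn hn => // n Nn Mn hn; exists n; split => //.
move: hn; rewrite birkhoff_sumS => hn.
have : (`|f x|) / e < n.+1%:R.
  apply: lt_le_trans (_ : M.+1%:R <= _); last by rewrite ler_nat.
  by rewrite truncnS_gt.
rewrite ltr_pdivrMr// => hM.
have : f x <= `|f x| by exact: ler_norm.
have ke : k.+1%:R^-1 = e + e by rewrite eE -splitr.
rewrite ke in hn.
move: hn hM; rewrite -natr1 !mulrDl !mulrDr !mulr1 [n%:R * e]mulrC; lra.
Qed.

Lemma maximal_exceeds (f : T -> R) (b : R) E : measurable_fun setT f ->
  (forall x, 0 <= f x) -> (\int[mu]_x (f x)%:E < +oo)%E -> 0 <= b ->
  measurable E -> (forall x, E (th x) <-> E x) -> E `<=` exceeds f b ->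
  (b%:E * mu E <= \int[mu]_(x in E) (f x)%:E)%E.
Proof.
move=> mf f0 foo b0 mE thE Eb; apply: (maximal_ergodic mth th_mu) => //.
move=> x /Eb[k /(_ 0%N)[n [_ hn]]]; exists n; apply: le_lt_trans hn.
by rewrite mulrDl lerDl mulr_ge0.
Qed.

Lemma integral_le1_lty (f : T -> R) : measurable_fun setT f ->
  (forall x, 0 <= f x <= 1) -> (\int[mu]_x (f x)%:E < +oo)%E.
Proof.
move=> mf f01; apply: (@le_lt_trans _ _ (\int[mu]_x (cst 1%E x)))%E.
  apply: ge0_le_integral => //.
  - by move=> x _; rewrite lee_fin; case/andP: (f01 x).
  - exact/measurable_EFinP.
  - by move=> x _; rewrite lee_fin; case/andP: (f01 x).
by rewrite integral_cst//= probability_setT mul1e ltry.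
Qed.

(** Pointwise ergodic theorem for bounded observables: on the invariant set
    where the upper limit is above [b] and the lower one below [a], the maximal
    lemma for [f] and for [1 - f] bounds the integral of [1] below by [1 + b - a],
    so the set is null. *)
Lemma birkhoff_cvg (f : T -> R) : measurable_fun setT f ->
  (forall x, 0 <= f x <= 1) ->
  {ae mu, forall x, cvg ((S f n x / n%:R) @[n --> \oo])}.
Proof.
move=> mf f01; pose g x := 1 - f x.
have mg : measurable_fun setT g by exact: measurable_funB.
have f0 x : 0 <= f x by case/andP: (f01 x).
have g0 x : 0 <= g x by rewrite subr_ge0; case/andP: (f01 x).
have g01 x : 0 <= g x <= 1 by rewrite g0 /g; have := f0 x; lra.
have fi := integral_le1_lty mf f01.
have gi := integral_le1_lty mg g01.
have Sg n x : S g n x = n%:R - S f n x.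
  by rewrite /birkhoff_sum sumrB sumr_const card_ord.
have null (a b : R) : 0 <= b -> a <= 1 -> a < b ->
    mu (exceeds f b `&` exceeds g (1 - a)) = 0%E.
  move=> b0 a1 ab; set E := _ `&` _.
  have mE : measurable E by apply: measurableI; exact: measurable_exceeds.
  have a0 : 0 <= 1 - a by lra.
  have thE x : E (th x) <-> E x.
    have := exceeds_invariant f x b0; have := exceeds_invariant g x a0.
    rewrite /E /=; tauto.
  have fE := maximal_exceeds mf f0 fi b0 mE thE (@subIsetl _ _ _).
  have gE := maximal_exceeds mg g0 gi a0 mE thE (@subIsetr _ _ _).
  have : (b%:E * mu E + (1 - a)%:E * mu E <= mu E)%E.
    apply: (le_trans (leeD fE gE)); rewrite -ge0_integralD//; last 4 first.
    - by move=> x _; rewrite lee_fin.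
    - exact/measurable_EFinP/measurable_funTS.
    - by move=> x _; rewrite lee_fin.
    - exact/measurable_EFinP/measurable_funTS.
    rewrite (eq_integral (cst 1%E)) ?integral_cst//= ?mul1e//.
    by move=> x _; rewrite -EFinD /g; congr EFin; lra.
  have : (0 <= mu E)%E by [].
  have : mu E \is a fin_num by exact: fin_num_measure.
  case: (mu E) => // m _; rewrite lee_fin => m0.
  rewrite -!EFinM -EFinD !lee_fin -mulrDl => h.
  congr EFin; apply/eqP; move: m0; rewrite le_eqVlt => /orP[/eqP<-//|m0].
  by exfalso; move: h; rewrite -subr_le0 -{2}[m]mul1r -mulrBl pmulr_lle0//; lra.
have : {ae mu, forall x (p : rat * rat), 0 <= ratr p.2 :> R ->
    ratr p.1 <= 1 :> R -> ratr p.1 < ratr p.2 :> R ->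
    ~ (exceeds f (ratr p.2) x /\ exceeds g (1 - ratr p.1) x)}.
  apply: ae_forall_countable => -[a b] /=.
  have [b0|] := boolP (0 <= ratr b :> R); last by move=> _; exact: aeW.
  have [a1|] := boolP (ratr a <= 1 :> R); last by move=> _; exact: aeW.
  have [ab|] := boolP (ratr a < ratr b :> R); last by move=> _; exact: aeW.
  exists (exceeds f (ratr b) `&` exceeds g (1 - ratr a)); split.
  - by apply: measurableI; exact: measurable_exceeds.
  - exact: null.
  - move=> x /= h; apply: contrapT => nE; exact: (h (fun _ _ _ => nE)).
apply: filterS => x hx.
pose u n := S f n x / n%:R.
have S_le n : 0 <= S f n x <= n%:R.
  rewrite /birkhoff_sum sumr_ge0//=.
  apply: (@le_trans _ _ (\sum_(i < n) 1)).
    by apply: ler_sum => i _; case/andP: (f01 (iter i th x)).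
  by rewrite sumr_const card_ord.
have u01 n : 0 <= u n <= 1.
  case: n => [|n]; first by rewrite /u invr0 mulr0 lexx ler01.
  have /andP[S0 Sn] := S_le n.+1.
  by rewrite /u divr_ge0//= ler_pdivrMr// mul1r.
pose B := [set b : R | \forall n \near \oo, u n <= b].
have B1 : B 1 by apply: nearW => n; case/andP: (u01 n).
have B0 b : B b -> 0 <= b.
  move=> [N _ /(_ N (leqnn N)) /= h]; apply: le_trans h.
  by case/andP: (u01 N).
have hB : has_inf B by split; [exists 1|exists 0 => b /B0].
pose l := inf B.
have l0 : 0 <= l by apply: lb_le_inf; [exists 1|move=> b /B0].
have l1 : l <= 1 by apply: ge_inf => //; exists 0 => b /B0.
apply/cvg_ex; exists l; apply/cvgrPdist_le => e e0.
have up : \forall n \near \oo, u n <= l + e.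
  have [b Bb bl] : exists2 b, B b & b < l + e.
    by apply: inf_lt; [exists 1|rewrite ltrDl].
  by apply: filterS Bb => n un; rewrite (le_trans un)// ltW.
have lo : \forall n \near \oo, l - e <= u n.
  (* otherwise [l] is the upper limit, the lower limit is at most [l - e], and
     two rational points in between contradict the almost sure property [hx] *)
  apply: contrapT => nlo.
  have fr N : exists n, (N <= n)%N /\ (0 < n)%N /\ u n < l - e.
    apply: contrapT => hN; apply: nlo; exists (maxn N 1) => // n /=.
    rewrite geq_max => /andP[Nn n0]; rewrite leNgt; apply/negP => un.
    by apply: hN; exists n.
  have le0 : 0 < l - e.
    by have [n [_ [_]]] := fr 0%N; apply: le_lt_trans; case/andP: (u01 n).
  have [a] := @rat_in_itvoo R (l - e) l ltac:(lra).
  rewrite in_itv/= => /andP[a1 al].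
  have [b] := rat_in_itvoo al; rewrite in_itv/= => /andP[ab bl].
  have b0 : 0 <= ratr b :> R by lra.
  have a01 : ratr a <= 1 :> R by lra.
  apply: (hx (a, b)) => //=; split.
    have [c] := rat_in_itvoo bl; rewrite in_itv/= => /andP[bc cl].
    apply: (exceeds_gt bc) => N.
    apply: contrapT => hN.
    have : l <= ratr c.
      apply: ge_inf; first by exists 0 => ? /B0.
      exists (maxn N 1) => // n /=; rewrite geq_max => /andP[Nn n0].
      rewrite leNgt; apply/negP => cu; apply: hN; exists n; split => //.
      by rewrite -ltr_pdivlMr ?ltr0n.
    lra.
  apply: (@exceeds_gt _ _ (1 - (l - e))); first by lra.
  move=> N; have [n [Nn [n0 un]]] := fr N; exists n; split => //.
  rewrite Sg; move: un; rewrite /u ltr_pdivrMr ?ltr0n//; lra.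
near=> n; rewrite -/(u n) ler_norml; apply/andP; split.
  have : u n <= l + e by near: n.
  lra.
have : l - e <= u n by near: n.
lra.
Unshelve. all: by end_near. Qed.

(** If [f] is independent of the invariant sets, the maximal lemma on the
    invariant set where the averages exceed [b] reads [b * m <= (\int f) * m]
    with [m] the measure of this set, so [m = 0] as soon as [b > \int f]. *)
Lemma birkhoff_sum_le_mean (f : T -> R) : measurable_fun setT f ->
  (forall x, 0 <= f x) ->
  (forall E, measurable E -> (forall x, E (th x) <-> E x) ->
     (\int[mu]_(x in E) (f x)%:E = mu E * \int[mu]_x (f x)%:E)%E) ->
  {ae mu, forall x (b : R), (\int[mu]_x (f x)%:E < b%:E)%E ->
     \forall n \near \oo, S f n x <= b * n%:R}.
Proof.
move=> mf f0 indep.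
have : {ae mu, forall x (q : rat), (\int[mu]_x (f x)%:E < (ratr q : R)%:E)%E ->
    ~ exceeds f (ratr q) x}.
  apply: ae_forall_countable => q.
  have [fq|] := boolP (\int[mu]_x (f x)%:E < (ratr q : R)%:E)%E; last first.
    by move=> _; exact: aeW.
  exists (exceeds f (ratr q)); split; first exact: measurable_exceeds.
  - set E := exceeds _ _.
    have mE : measurable E by exact: measurable_exceeds.
    have if0 : (0 <= \int[mu]_x (f x)%:E)%E.
      by apply: integral_ge0 => x _; rewrite lee_fin.
    have q0 : 0 <= ratr q :> R.
      by rewrite -lee_fin; apply: (le_trans _ (ltW fq)).
    have thE x : E (th x) <-> E x by exact: exceeds_invariant.
    have foo : (\int[mu]_x (f x)%:E < +oo)%E by rewrite (lt_trans fq)// ltry.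
    suff muE0 : mu E = 0%E by exact: muE0.
    have := maximal_exceeds mf f0 foo q0 mE thE (@subset_refl _ _).
    rewrite indep//; move: fq if0 foo.
    have : (0 <= mu E)%E by [].
    have : mu E \is a fin_num by exact: fin_num_measure.
    case: (mu E) => // m _; rewrite lee_fin => m0.
    case: (\int[mu]_x (f x)%:E)%E => // c cq c0 _.
    rewrite -!EFinM lee_fin => h.
    congr EFin; apply/eqP; move: m0; rewrite le_eqVlt => /orP[/eqP<-//|m0].
    by move: h; rewrite [leRHS]mulrC ler_pM2r// leNgt -lte_fin cq.
  - by move=> x /= h; apply: contrapT => nE; exact: (h (fun _ => nE)).
apply: filterS => x hx b fb.
have [c fc cb] : exists2 c : R, (\int[mu]_x (f x)%:E < c%:E)%E & c < b.
  have if0 : (0 <= \int[mu]_x (f x)%:E)%E.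
    by apply: integral_ge0 => y _; rewrite lee_fin.
  move: fb if0; case: (\int[mu]_x (f x)%:E)%E => // r; rewrite lte_fin => rb _.
  by exists ((r + b) / 2); rewrite ?lte_fin; lra.
have [q] := rat_in_itvoo cb; rewrite in_itv/= => /andP[cq qb].
apply: contrapT => nb; apply: (hx q).
  by rewrite (lt_trans fc)// lte_fin.
apply: (exceeds_gt qb) => N; apply: contrapT => hN; apply: nb.
exists N => // n /= Nn; rewrite leNgt; apply/negP => h; apply: hN.
by exists n.
Qed.

End ergodic_limits.

(** * Existence of infinite products of a probability measure on the line *)

(** The event [C] is fixed, and both sides are measures in [B]. *)
Lemma independent_unique d d' (T : measurableType d) (X : measurableType d')
    (R : realType) (P : probability T R) (Q : probability X R) (th : T -> X)
    (C : set T) (G : set (set X)) :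
  measurable_fun setT th -> measurable C ->
  measurable = <<s G >> -> setI_closed G ->
  (forall B, G B -> P (C `&` th @^-1` B) = (P C * Q B)%E) ->
  forall B, measurable B -> P (C `&` th @^-1` B) = (P C * Q B)%E.
Proof.
move=> mth mC mG GI PQ; rewrite [in X in forall A, X A -> _]mG.
have mpre B : measurable B -> measurable (th @^-1` B).
  by move=> mB; rewrite -[X in measurable X]setTI; exact: mth.
apply: (dynkin_induction mG GI) => //.
- by rewrite preimage_setT setIT probability_setT mule1.
- move=> B mB PB; rewrite preimage_setC -setDE measureD//; last 2 first.
  + exact: mpre.
  + by rewrite -ge0_fin_numE// fin_num_measure.
  rewrite setIC in PB; rewrite [X in (_ - P X)%E]setIC PB probability_setC//.
  by rewrite muleBr ?mule1// ?fin_num_measure// fin_num_adde_defr.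
- move=> F mF tF PF; rewrite preimage_bigcup setI_bigcupr.
  rewrite !measure_bigcup//; last 2 first.
  + by move=> n _; apply: measurableI => //; exact: mpre.
  + apply/trivIsetP => i j _ _ ij; rewrite setIACA setIid -preimage_setI.
    by move/trivIsetP : tF => -> //; rewrite preimage_set0 setI0.
  have PCE : P C = (fine (P C))%:E by rewrite fineK ?fin_num_measure.
  rewrite [in RHS]PCE -nneseriesZl//.
  by apply: eq_eseriesr => n _; rewrite -PCE; exact: PF.
Qed.

(** Iterating a splitting of [T] into one coordinate [phi] and a fresh copy
    [psi] of [T] unrolls [T] into infinitely many independent coordinates. *)
Lemma infinite_product_iterate d d' (T : measurableType d)
    (X : measurableType d') (R : realType) (mu : probability T R)
    (Q : set X -> \bar R) (phi : T -> X) (psi : T -> T)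
    (mF : measurable_fun setT (fun w => (fun i => phi (iter i psi w)) : seqspace X)) :
  (forall A B, measurable A -> measurable B ->
     mu (phi @^-1` A `&` psi @^-1` B) = (Q A * mu B)%E) ->
  measurable_fun setT phi -> measurable_fun setT psi ->
  is_infinite_product Q (image_prob mu mF).
Proof.
move=> split_mu mphi mpsi n; elim: n => [|n IH] A mA.
  rewrite big_ord0 -(probability_setT mu) image_probE.
  by congr (mu _); apply/seteqP; split.
rewrite big_ord_recl -(IH (fun i => A i.+1))// -split_mu//; last first.
  rewrite -[X in measurable X]setTI.
  exact: (mF measurableT _ (measurable_cylinder n (fun i => mA i.+1))).
rewrite image_probE; congr (mu _); apply/seteqP; split => w /=.
  move=> h; split; first exact: (h 0%N).
  by move=> i im; rewrite -iterSr; exact: h.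
by move=> [h0 h] [|i] //= im; rewrite -iterS iterSr; exact: h.
Qed.

Section coin_tossing.
Context (R : realType).

Lemma measurable_to_real :
  measurable_fun setT (idfun : measurableTypeR R -> R).
Proof. by move=> _ A mA; rewrite setTI. Qed.

(** [uniform_prob] is a measure on the alias [measurableTypeR R]; it is transported
    to [R] along the identity. *)
Definition unif : probability R R :=
  image_prob (uniform_prob (@ltr01 R)) measurable_to_real.

Lemma unifE A : measurable A -> unif A = lebesgue_measure (A `&` `[0, 1]%classic).
Proof.
move=> mA; rewrite /unif image_probE preimage_id /= /uniform_prob integral_uniform_pdf.
rewrite -[RHS]mul1e -integral_cst//; last exact: measurableI.
apply: eq_integral => x; rewrite inE => -[_ /=]; rewrite in_itv/= => x01.
by rewrite /uniform_pdf x01 subr0 invr1.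
Qed.

Definition bit (u : R) : bool := 2^-1 <= u.
Definition doubling (u : R) : R := 2 * u - (bit u)%:R.

Lemma measurable_bit : measurable_fun setT bit.
Proof. exact: measurable_fun_ler. Qed.

Lemma measurable_doubling : measurable_fun setT doubling.
Proof.
rewrite (_ : doubling = fun u => if bit u then 2 * u - 1 else 2 * u); last first.
  by apply/funext => u; rewrite /doubling; case: bit => //; rewrite subr0.
apply: measurable_fun_ifT => //; first exact: measurable_bit.
by apply: measurable_funB => //; exact: measurable_funM.
Qed.

Lemma unif_ray t : unif `]-oo, t]%classic = (Num.max 0 (Num.min t 1))%:E.
Proof.
rewrite unifE//.
have -> : `]-oo, t]%classic `&` `[0, 1]%classic = `[0, Num.min t 1]%classic :> set R.
  apply/seteqP; split => u /=; rewrite !in_itv/= le_min.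
    by move=> [-> /andP[-> ->]].
  by move=> /andP[-> /andP[-> ->]].
rewrite lebesgue_measure_itv/= lte_fin; case: ltP => m0; last by [].
by rewrite -EFinB subr0.
Qed.

(** The first binary digit of a uniform variable is independent of the remaining
    ones, and these form again a uniform variable. *)
Lemma unif_bit_doubling (c : bool) B : measurable B ->
  unif (bit @^-1` [set c] `&` doubling @^-1` B) =
  (unif (bit @^-1` [set c]) * unif B)%E.
Proof.
pose G : set (set R) := range (fun t : R => `]-oo, t]%classic).
have mbit c' : measurable (bit @^-1` [set c']).
  by rewrite -[X in measurable X]setTI; exact: measurable_bit.
have mray t : measurable (doubling @^-1` `]-oo, t]%classic).
  by rewrite -[X in measurable X]setTI; exact: measurable_doubling.
have half c' : unif (bit @^-1` [set c']) = (2^-1)%:E.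
  rewrite unifE//; case: c'.
    have -> : bit @^-1` [set true] `&` `[0, 1]%classic = `[2^-1, 1]%classic.
      apply/seteqP; split => u /=; rewrite /bit !in_itv/=.
        by move=> [-> /andP[_ ->]].
      by move=> /andP[h ->]; rewrite h; split => //; rewrite andbT; lra.
    rewrite lebesgue_measure_itv/= lte_fin ifT; last lra.
    by rewrite -EFinB; congr EFin; lra.
  have -> : bit @^-1` [set false] `&` `[0, 1]%classic = `[0, 2^-1[%classic.
    apply/seteqP; split => u /=; rewrite /bit !in_itv/=.
      by rewrite leNgt => -[/negbFE -> /andP[->]].
    move=> /andP[-> h]; rewrite leNgt h; split => //=; lra.
  rewrite lebesgue_measure_itv/= lte_fin ifT; last lra.
  by rewrite -EFinB subr0.
apply: (@independent_unique _ _ _ _ _ _ _ doubling _ G) => //.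
- exact: measurable_doubling.
- exact: real_rays_generate.
- exact: real_rays_setI.
- move=> _ [t _ <-]; rewrite half unif_ray unifE; last exact: measurableI.
  case: c.
    have -> : (bit @^-1` [set true] `&` doubling @^-1` `]-oo, t]%classic)
        `&` `[0, 1]%classic = `[2^-1, (1 + Num.min t 1) / 2]%classic.
      apply/seteqP; split => u /=; rewrite /doubling /bit !in_itv/=.
        move=> [[h]]; rewrite h /= => ut /andP[u0 u1].
        rewrite ler_pdivlMr// -lerBlDl le_min; apply/andP; split; lra.
      move=> /andP[h]; rewrite h /= ler_pdivlMr// -lerBlDl le_min => /andP[ut u1].
      by split; [split=> //; lra|apply/andP; split; lra].
    rewrite lebesgue_measure_itv/= lte_fin.
    case: ltP => hm; case: leP => hm'; rewrite -?EFinB -EFinM; congr EFin; lra.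
  have [t1|t1] := ltP t 1.
    have -> : (bit @^-1` [set false] `&` doubling @^-1` `]-oo, t]%classic)
        `&` `[0, 1]%classic = `[0, t / 2]%classic.
      apply/seteqP; split => u /=; rewrite /doubling /bit !in_itv/=.
        by move=> [[h]]; rewrite h /= subr0 => ut /andP[-> u1]/=; lra.
      move=> /andP[u0 ut]; have -> : (2^-1 <= u) = false.
        by apply/negbTE; rewrite -ltNge; lra.
      by rewrite u0 subr0; split; [split=> //; lra|rewrite /=; lra].
    rewrite lebesgue_measure_itv/= lte_fin.
    by case: ltP => hm; case: leP => hm'; rewrite -?EFinB -EFinM; congr EFin; lra.
  have -> : (bit @^-1` [set false] `&` doubling @^-1` `]-oo, t]%classic)
      `&` `[0, 1]%classic = `[0, 2^-1[%classic.
    apply/seteqP; split => u /=; rewrite /doubling /bit !in_itv/=.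
      by move=> [[h _] /andP[-> _]]; rewrite ltNge h.
    move=> /andP[u0]; rewrite ltNge => /negbTE h; rewrite h u0 subr0 /=.
    by have := negbT h; rewrite -ltNge => h'; split; [split=> //; lra|lra].
  rewrite lebesgue_measure_itv/= lte_fin ifT; last lra.
  by rewrite -EFinB -EFinM; congr EFin; rewrite max_r ?ler01//; lra.
Qed.

End coin_tossing.

Section fair_coins.
Context (R : realType).

Definition bits (u : R) : seqspace bool := fun i => bit (iter i (@doubling R) u).

Lemma measurable_bits : measurable_fun setT bits.
Proof.
apply: measurable_seqspace => i; apply: measurableT_comp.
  exact: measurable_bit.
exact: (measurable_iter (@measurable_doubling R)).
Qed.

(** The law of infinitely many tosses of a fair coin. *)
Definition coins : probability (seqspace bool) R :=
  image_prob (unif R) measurable_bits.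

Definition coin : set bool -> \bar R := fun A => unif R (@bit R @^-1` A).

Lemma coins_product : is_infinite_product coin coins.
Proof.
apply: infinite_product_iterate; last 2 first.
- exact: measurable_bit.
- exact: measurable_doubling.
move=> A B _ mB.
have mD : measurable (@doubling R @^-1` B).
  by rewrite -[X in measurable X]setTI; exact: measurable_doubling.
have mbit c : measurable (@bit R @^-1` [set c]).
  by rewrite -[X in measurable X]setTI; exact: measurable_bit.
rewrite /coin; have [] := set_bool A; move=> /eqP ->.
- exact: unif_bit_doubling.
- exact: unif_bit_doubling.
- by rewrite preimage_set0 set0I !measure0 mul0e.
have dis (S : set R) : (@bit R @^-1` [set true] `&` S) `&`
    (@bit R @^-1` [set false] `&` S) = set0.
  by apply/seteqP; split => // u [] /= [-> _] [].
rewrite setT_bool preimage_setU setIUl !measureU ?unif_bit_doubling//.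
- by rewrite ge0_muleDl// -!unif_bit_doubling.
- by have := dis setT; rewrite !setIT.
- exact: measurableI.
- exact: measurableI.
Qed.

Lemma coins_cylinder n A : coins (cylinder n A) = (\prod_(i < n) coin (A i))%E.
Proof. exact: coins_product. Qed.

Definition evens (w : seqspace bool) : seqspace bool := fun i => w (i.*2).
Definition odds (w : seqspace bool) : seqspace bool := fun i => w (i.*2.+1).

Lemma measurable_evens : measurable_fun setT evens.
Proof. by apply: measurable_seqspace => i; exact: measurable_coord. Qed.

Lemma measurable_odds : measurable_fun setT odds.
Proof. by apply: measurable_seqspace => i; exact: measurable_coord. Qed.

Lemma cylinder_extend n N (A : nat -> set bool) : (n <= N)%N ->
  cylinder n A = cylinder N (fun i => if (i < n)%N then A i else setT).
Proof.
move=> nN; apply/seteqP; split => w h i im.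
  by case: ifPn => // /h.
by have := h i (leq_trans im nN); rewrite im.
Qed.

Lemma coins_interleave N (A B : nat -> set bool) :
  coins (evens @^-1` cylinder N A `&` odds @^-1` cylinder N B) =
  (\prod_(i < N) coin (A i) * \prod_(i < N) coin (B i))%E.
Proof.
pose C i := if odd i then B i./2 else A i./2.
have -> : evens @^-1` cylinder N A `&` odds @^-1` cylinder N B =
    cylinder N.*2 C.
  apply/seteqP; split => w.
    move=> [hA hB] i im; rewrite /C -[in w i](odd_double_half i).
    have iN : (i./2 < N)%N by rewrite -divn2; lia.
    by case: (odd i); rewrite ?add0n ?add1n; [exact: hB|exact: hA].
  move=> h; split => i im.
    have := h i.*2; rewrite /C odd_double doubleK; apply.
    by rewrite ltn_double.
  have := h i.*2.+1; rewrite /C /= odd_double /= uphalf_double; apply.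
  by rewrite -doubleS leq_double.
rewrite coins_cylinder; elim: N => [|N IH]; first by rewrite !big_ord0 mule1.
rewrite doubleS !big_ord_recr /= IH.
rewrite /C /= odd_double /= doubleK uphalf_double -!muleA; congr (_ * _)%E.
by rewrite muleCA.
Qed.

(** The even and the odd tosses are two independent sequences of fair tosses;
    cylinders of a common length reduce this to the interleaved cylinder. *)
Lemma coins_split A B : measurable A -> measurable B ->
  coins (evens @^-1` A `&` odds @^-1` B) = (coins A * coins B)%E.
Proof.
have cyl (n m : nat) (U V : nat -> set bool) :
    coins (evens @^-1` cylinder n U `&` odds @^-1` cylinder m V) =
    (coins (cylinder n U) * coins (cylinder m V))%E.
  rewrite (cylinder_extend U (leq_maxl n m)) (cylinder_extend V (leq_maxr n m)).
  by rewrite coins_interleave !coins_cylinder.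
have cylT : cylinder 0 (fun=> setT) = setT :> set (seqspace bool).
  by apply/seteqP; split.
have mev S : measurable S -> measurable (evens @^-1` S).
  by move=> mS; rewrite -[X in measurable X]setTI; exact: measurable_evens.
have modd S : measurable S -> measurable (odds @^-1` S).
  by move=> mS; rewrite -[X in measurable X]setTI; exact: measurable_odds.
have evE n U : coins (evens @^-1` cylinder n U) = coins (cylinder n U).
  by have := cyl n 0%N U (fun=> setT); rewrite cylT preimage_setT setIT probability_setT mule1.
have oddE n U : coins (odds @^-1` cylinder n U) = coins (cylinder n U).
  by have := cyl 0%N n (fun=> setT) U; rewrite cylT preimage_setT setTI probability_setT mul1e.
move=> mA mB.
have half n V : coins (odds @^-1` cylinder n V `&` evens @^-1` A) =
    (coins (odds @^-1` cylinder n V) * coins A)%E.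
  apply: (independent_unique measurable_evens _ (cylindersE bool)
    (@cylinders_setI _ bool)) => //.
    by apply: modd; apply: measurable_cylinder.
  move=> _ [m [U [_ ->]]].
  by rewrite setIC cyl oddE muleC.
have -> : coins A = coins (evens @^-1` A).
  have := half 0%N (fun=> setT).
  by rewrite cylT preimage_setT setTI probability_setT mul1e.
apply: (independent_unique measurable_odds _ (cylindersE bool)
    (@cylinders_setI _ bool)) => //; first exact: mev.
move=> _ [m [U [_ ->]]].
rewrite setIC half oddE muleC; congr (_ * _)%E.
have := half 0%N (fun=> setT).
by rewrite cylT preimage_setT setTI probability_setT mul1e.
Qed.

Definition binary_sum (n : nat) (w : seqspace bool) : R :=
  \sum_(i < n) (w i)%:R * (2^-1) ^+ i.+1.

Definition binary_expansion (w : seqspace bool) : R :=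
  limn (fun n => binary_sum n w).

Lemma measurable_binary_sum n : measurable_fun setT (binary_sum n).
Proof.
apply: measurable_sum => i; apply: measurable_funM => //.
rewrite (_ : (fun x : seqspace bool => (x i)%:R) =
  (fun x : seqspace bool => if x i then 1 else 0)); last first.
  by apply/funext => x; case: (x i).
by apply: measurable_fun_ifT => //; exact: measurable_coord.
Qed.

Lemma binary_sum_nondecreasing w : nondecreasing_seq (binary_sum ^~ w).
Proof.
apply/nondecreasing_seqP => n.
by rewrite /binary_sum big_ord_recr /= lerDl mulr_ge0// exprn_ge0.
Qed.

Lemma binary_sum_le1 n w : binary_sum n w <= 1 - (2^-1) ^+ n.
Proof.
elim: n => [|n IH]; first by rewrite /binary_sum big_ord0 expr0 subrr.
rewrite /binary_sum big_ord_recr /= -/(binary_sum n w).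
have : (w n)%:R * (2^-1) ^+ n.+1 <= (2^-1) ^+ n.+1 :> R.
  by rewrite -[leRHS]mul1r ler_wpM2r ?exprn_ge0//; case: (w n).
by rewrite exprS; lra.
Qed.

Lemma cvg_binary_sum w : cvgn (binary_sum ^~ w).
Proof.
apply: nondecreasing_is_cvgn; first exact: binary_sum_nondecreasing.
exists 1 => _ [n _ <-]; apply: (le_trans (binary_sum_le1 _ _)).
by rewrite gerBl exprn_ge0.
Qed.

Lemma measurable_binary_expansion : measurable_fun setT binary_expansion.
Proof.
apply: (measurable_fun_cvg measurable_binary_sum) => w _.
exact: cvg_binary_sum.
Qed.

Lemma binary_expansion_bits (u : R) : 0 <= u <= 1 -> binary_expansion (bits u) = u.
Proof.
move=> u01.
have D01 n : 0 <= iter n (@doubling R) u <= 1.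
  elim: n => // n; rewrite /= /doubling /bit; move: (iter _ _ _) => v v01.
  by case: (leP 2^-1 v) => h /=; rewrite ?subr0; apply/andP; split; lra.
have E n : u = binary_sum n (bits u) + 2^-1 ^+ n * iter n (@doubling R) u.
  elim: n => [|n IH]; first by rewrite /binary_sum big_ord0 add0r mul1r.
  rewrite /binary_sum big_ord_recr /= -/(binary_sum n (bits u)) [LHS]IH.
  rewrite /bits /doubling exprS; move: (_ ^+ n) (bit _)%:R => e b.
  by rewrite -addrA; congr (_ + _); field.
apply: cvg_lim => //.
rewrite -[X in _ --> X]subr0.
rewrite (_ : binary_sum^~ (bits u) =
   (fun n => u - 2^-1 ^+ n * iter n (@doubling R) u)); last first.
  by apply/funext => n; rewrite {2}(E n) addrK.
apply: cvgB; first exact: cvg_cst.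
apply: (@squeeze_cvgr _ _ _ _ (fun=> 0) (fun n => 2^-1 ^+ n)).
- apply: nearW => n; have /andP[d0 d1] := D01 n.
  by rewrite mulr_ge0 ?exprn_ge0//= -[leRHS]mulr1 ler_wpM2l// exprn_ge0.
- exact: cvg_cst.
- by apply: cvg_expr; rewrite ger0_norm; lra.
Qed.

End fair_coins.

Section quantile.
Context (R : realType) (P : probability R R).

Definition quantile (u : R) : R :=
  if 0 < u < 1 then inf [set t | (u%:E <= P `]-oo, t]%classic)%E] else 0.

Lemma cdf_le (s t : R) : s <= t -> (P `]-oo, s]%classic <= P `]-oo, t]%classic)%E.
Proof.
move=> st; apply: le_measure; rewrite ?inE//.
exact: subset_itvl.
Qed.

Lemma cvg_cdf_right (t : R) :
  P `]-oo, t + n.+1%:R^-1]%classic @[n --> \oo] --> P `]-oo, t]%classic.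
Proof.
have -> : `]-oo, t]%classic = \bigcap_n `]-oo, t + n.+1%:R^-1]%classic :> set R.
  apply/seteqP; split => x /=.
    move=> xt n _ /=; move: xt; rewrite !in_itv/= => /le_trans; apply.
    by rewrite lerDl invr_ge0.
  move=> h; rewrite in_itv/= leNgt; apply/negP => /ltr_add_invr[k].
  by have := h k I; rewrite /= in_itv/= leNgt => /negbTE ->.
apply: nonincreasing_cvg_mu => //.
- by rewrite -ge0_fin_numE// fin_num_measure.
- exact: bigcapT_measurable.
- move=> m n mn; apply/subsetPset; apply: subset_itvl.
  by rewrite bnd_simp lerD2l lef_pV2 ?posrE// ler_nat.
Qed.

Lemma cvg_cdf_pinfty : P `]-oo, n%:R]%classic @[n --> \oo] --> 1%E.
Proof.
rewrite -(probability_setT P).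
have -> : [set: R] = \bigcup_n `]-oo, n%:R]%classic.
  apply/seteqP; split => // x _; exists (Num.truncn x).+1 => //=.
  by rewrite in_itv/= ltW// truncnS_gt.
apply: nondecreasing_cvg_mu => //; first exact: bigcupT_measurable.
by move=> m n mn; apply/subsetPset; apply: subset_itvl; rewrite bnd_simp ler_nat.
Qed.

Lemma cvg_cdf_ninfty : P `]-oo, - n%:R]%classic @[n --> \oo] --> 0%E.
Proof.
rewrite -(measure0 P).
have -> : set0 = \bigcap_n `]-oo, - n%:R]%classic :> set R.
  apply/esym/seteqP; split => // x h.
  have := h (Num.truncn (- x)).+1 I; rewrite /= in_itv/= leNgt => /negP; apply.
  by rewrite ltrNl truncnS_gt.
apply: nonincreasing_cvg_mu => //.
- by rewrite -ge0_fin_numE// fin_num_measure.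
- exact: bigcapT_measurable.
- by move=> m n mn; apply/subsetPset; apply: subset_itvl; rewrite bnd_simp lerN2 ler_nat.
Qed.

Lemma quantile_le (u t : R) : 0 < u < 1 ->
  (quantile u <= t) = (u%:E <= P `]-oo, t]%classic)%E.
Proof.
move=> u01; rewrite /quantile u01; set S := [set t | _].
have /andP[u0 u1] := u01.
have Sne : S !=set0.
  apply: contrapT => S0; have := u1; rewrite -lte_fin ltNge => /negP; apply.
  apply: (cvge_le _ cvg_cdf_pinfty); apply: nearW => n.
  by rewrite leNgt; apply/negP => /ltW un; apply: S0; exists n%:R.
have Slb : has_lbound S.
  apply: contrapT => S0; have := u0; rewrite -lte_fin ltNge => /negP; apply.
  apply: (cvge_ge _ cvg_cdf_ninfty); apply: nearW => n.
  rewrite leNgt; apply/negP => un; apply: S0; exists (- n%:R) => s Ss.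
  rewrite leNgt; apply/negP => /ltW sn; move: un.
  by rewrite ltNge (le_trans Ss)// cdf_le.
apply/idP/idP.
  move=> qt; apply: (cvge_ge _ (@cvg_cdf_right t)); apply: nearW => n.
  have [s Ss st] : exists2 s, S s & s < t + n.+1%:R^-1.
    by apply: inf_lt => //; apply: le_lt_trans qt _; rewrite ltrDl invr_gt0.
  by apply: le_trans Ss _; apply: cdf_le; exact: ltW.
by move=> ut; exact: ge_inf.
Qed.

Lemma measurable_quantile : measurable_fun setT quantile.
Proof.
apply: (measurability _ (@real_rays_generate R)) => _ [_ [t _ <-] <-].
rewrite setTI.
have [F FE] : exists F : R, P `]-oo, t]%classic = F%:E.
  by exists (fine (P `]-oo, t]%classic)); rewrite fineK// fin_num_measure.
have -> : quantile @^-1` `]-oo, t]%classic =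
    (`]0, 1[%classic `&` `]-oo, F]%classic) `|`
    (~` `]0, 1[%classic `&` [set _ : R | 0 <= t]).
  apply/seteqP; split => u /=; rewrite !in_itv/=.
    have [u01|/negP u01] := boolP (0 < u < 1).
      by rewrite quantile_le// FE lee_fin; left.
    rewrite {1}/quantile; case: ifP => // _ t0; right.
    by split=> //; apply/negP.
  move=> [[u01 uF]|[/negP/negbTE u01 t0]]; last by rewrite /quantile u01.
  by rewrite quantile_le// FE lee_fin.
apply: measurableU; apply: measurableI => //; first exact: measurableC.
by case: (0 <= t); [rewrite (_ : [set _ | _] = setT)//|
  rewrite (_ : [set _ | _] = set0)//]; apply/seteqP; split.
Qed.

(** Inverse transform sampling. *)
Lemma unif_quantile A : measurable A -> unif R (quantile @^-1` A) = P A.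
Proof.
rewrite -(image_probE _ measurable_quantile).
apply: real_probability_unique => t; rewrite image_probE.
have [F FE] : exists F : R, P `]-oo, t]%classic = F%:E.
  by exists (fine (P `]-oo, t]%classic)); rewrite fineK// fin_num_measure.
have F0 : 0 <= F by rewrite -lee_fin -FE.
have F1 : F <= 1 by rewrite -lee_fin -FE probability_le1.
have mq : measurable (quantile @^-1` `]-oo, t]%classic).
  by rewrite -[X in measurable X]setTI; exact: measurable_quantile.
have unif01 : unif R `]0, 1[%classic = 1%E.
  rewrite unifE// setIidl; last exact: subset_itv_oo_cc.
  by rewrite lebesgue_measure_itv/= lte_fin ltr01 -EFinB subr0.
rewrite -(probability_setI1 mq _ unif01)//.
transitivity (unif R (`]-oo, F]%classic `&` `]0, 1[%classic)).
  congr (unif R _); apply/seteqP; split => u /=; rewrite !in_itv/=.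
    by move=> [qt u01]; move: qt; rewrite quantile_le// FE lee_fin.
  by move=> [uF u01]; rewrite quantile_le// FE lee_fin.
rewrite probability_setI1// unif_ray FE; congr EFin.
by rewrite min_l// max_r.
Qed.

End quantile.

Section infinite_product_real.
Context (R : realType) (P : probability R R).

Let draw (w : seqspace bool) : R := quantile P (binary_expansion R (evens w)).

Let measurable_draw : measurable_fun setT draw.
Proof.
apply: measurableT_comp; first exact: measurable_quantile.
apply: measurableT_comp; first exact: measurable_binary_expansion.
exact: measurable_evens.
Qed.

Let measurable_draws :
  measurable_fun setT (fun w => (fun i => draw (iter i odds w)) : seqspace R).
Proof.
apply: measurable_seqspace => i; apply: measurableT_comp.
  exact: measurable_draw.
exact: (measurable_iter measurable_odds).
Qed.

(** The even tosses yield a uniform variable, hence by its quantile a variable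
    of law [P], and the odd tosses are a fresh copy of all the tosses. *)
Lemma infinite_productP : is_infinite_product P (infinite_product P).
Proof.
apply: (xgetPex (\d_(point : seqspace R) : probability (seqspace R) R)).
exists (image_prob (coins R) measurable_draws).
apply: infinite_product_iterate.
- move=> A B mA mB.
  have mQ : measurable (quantile P @^-1` A).
    by rewrite -[X in measurable X]setTI; exact: measurable_quantile.
  have mg : measurable (@binary_expansion R @^-1` (quantile P @^-1` A)).
    by rewrite -[X in measurable X]setTI; exact: measurable_binary_expansion.
  have -> : draw @^-1` A = @evens @^-1` (@binary_expansion R @^-1` (quantile P @^-1` A)).
    by [].
  apply: (etrans (coins_split R mg mB)); congr (_ * _)%E.
  have unif01 : unif R `[0, 1]%classic = 1%E.
    by rewrite unifE// setIid lebesgue_measure_itv/= lte_fin ltr01 -EFinB subr0.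
  have mbg : measurable (@bits R @^-1` (@binary_expansion R @^-1` (quantile P @^-1` A))).
    by rewrite -[X in measurable X]setTI; exact: measurable_bits.
  have mI : measurable (`[0, 1]%classic : set R) by [].
  apply: (etrans _ (unif_quantile P mA)).
  apply: (etrans (esym (probability_setI1 mbg mI unif01))).
  apply: (etrans _ (probability_setI1 mQ mI unif01)).
  congr (unif R _); apply/seteqP; split => u [/= + u01]; rewrite in_itv/= in u01.
    by rewrite binary_expansion_bits.
  by split => //=; rewrite binary_expansion_bits.
- exact: measurable_draw.
- exact: measurable_odds.
Qed.

End infinite_product_real.

(** * Strong law of large numbers *)

Section shift.
Context d (X : measurableType d).

Definition shift (x : seqspace X) : seqspace X := fun i => x i.+1.

Lemma measurable_shift : measurable_fun setT shift.
Proof. by apply: measurable_seqspace => i; exact: measurable_coord. Qed.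

Lemma iter_shift n x i : iter n shift x i = x (n + i)%N.
Proof. by elim: n i => //= n IH i; rewrite /shift IH addnS addSn. Qed.

Lemma birkhoff_sum_shift (R : realType) (h : X -> R) n (x : seqspace X) :
  birkhoff_sum shift (fun y => h (y 0%N)) n x = \sum_(i < n) h (x i).
Proof. by apply: eq_bigr => i _; rewrite iter_shift addn0. Qed.

End shift.

Lemma freqE (R : realType) (x : nat -> R) A n :
  freq x A n = mean (fun i => \1_A (x i)) n.
Proof.
rewrite /freq /mean -sum1_card natr_sum big_mkcond /=; congr (_ / _).
by apply: eq_bigr => i _; rewrite indicE unfold_in; case: (_ \in _).
Qed.

Section strong_law.
Context d (X : measurableType d) (R : realType) (P : probability X R).
Variable m : probability (seqspace X) R.
Hypothesis mP : is_infinite_product P m.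

Let mcylinder n A : (forall i, measurable (A i)) ->
  m (cylinder n A) = (\prod_(i < n) P (A i))%E.
Proof. exact: mP. Qed.

Lemma product_coord_shift B S : measurable B -> measurable S ->
  m ((fun x : seqspace X => x 0%N) @^-1` B `&` @shift _ X @^-1` S) =
  (P B * m S)%E.
Proof.
move=> mB.
pose c A (B' : set X) i := if i is i'.+1 then A i' else B' : set X.
have mc A B' : (forall i, measurable (A i)) -> measurable B' ->
  forall i, measurable (c A B' i).
  by move=> mA mB' [|i] /=; [exact: mB'|exact: mA].
have cE n A B' : (fun x : seqspace X => x 0%N) @^-1` B' `&`
    @shift _ X @^-1` cylinder n A = cylinder n.+1 (c A B').
  apply/seteqP; split => x.
    by move=> [x0 h] [|i] //= im; exact: h.
  by move=> h; split; [exact: (h 0%N)|move=> i im; exact: (h i.+1)].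
have PB : m ((fun x : seqspace X => x 0%N) @^-1` B) = P B.
  have := cE 0%N (fun=> setT) B.
  rewrite cylinder0.
  rewrite preimage_setT setIT => ->.
  by rewrite mcylinder ?big_ord1//; exact: mc.
have mB0 : measurable ((fun x : seqspace X => x 0%N) @^-1` B).
  by rewrite -[X in measurable X]setTI; exact: measurable_coord.
move=> mS; rewrite -PB.
apply: (independent_unique (@measurable_shift _ X) _ (cylindersE X)
  (@cylinders_setI _ X)) => //.
move=> _ [n [A [mA ->]]]; rewrite cE PB !mcylinder//; last exact: mc.
by rewrite big_ord_recl.
Qed.

Lemma product_shift S : measurable S -> m (@shift _ X @^-1` S) = m S.
Proof.
move=> mS; have := product_coord_shift measurableT mS.
by rewrite preimage_setT setTI probability_setT mul1e.
Qed.

Lemma product_coord B : measurable B ->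
  m ((fun x : seqspace X => x 0%N) @^-1` B) = P B.
Proof.
move=> mB; have := product_coord_shift mB measurableT.
by rewrite preimage_setT setIT probability_setT mule1.
Qed.

Lemma product_integral_coord (h : X -> R) : measurable_fun setT h ->
  (forall a, 0 <= h a) ->
  (\int[m]_x (h (x 0%N))%:E = \int[P]_a (h a)%:E)%E.
Proof.
move=> mh h0.
rewrite -(@ge0_integral_image _ _ _ _ _ m _ (measurable_coord 0) (EFin \o h)).
- by apply: eq_measure_integral => B mB _; exact: product_coord.
- exact/measurable_EFinP.
- by move=> a; rewrite lee_fin.
Qed.

(** An invariant event depends on the coordinates after the first one only. *)
Lemma product_integral_invariant (h : X -> R) E : measurable_fun setT h ->
  (forall a, 0 <= h a) -> measurable E -> (forall x, E (shift x) <-> E x) ->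
  (\int[m]_(x in E) (h (x 0%N))%:E = m E * \int[m]_x (h (x 0%N))%:E)%E.
Proof.
move=> mh h0 mE shE; rewrite product_integral_coord//.
have mcs : measurable_fun setT (fun x : seqspace X => (x 0%N, shift x)).
  by apply: measurable_fun_pair; [exact: measurable_coord|exact: measurable_shift].
pose g (p : X * seqspace X) := ((h p.1)%:E * (\1_E p.2)%:E)%E.
have g0 p : (0 <= g p)%E by rewrite /g -EFinM lee_fin mulr_ge0.
have mg : measurable_fun setT g.
  apply: emeasurable_funM; apply/measurable_EFinP.
    exact: measurableT_comp.
  exact: measurableT_comp.
transitivity (\int[m]_x g (x 0%N, shift x))%E.
  rewrite integral_mkcond; apply: eq_integral => x _; rewrite patchE /g/= indicE.
  have -> : (shift x \in E) = (x \in E).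
    by apply/idP/idP; rewrite !inE; have [] := shE x.
  by case: ifP => _; rewrite ?mule1 ?mule0.
rewrite -(ge0_integral_image m mcs)//.
rewrite (eq_measure_integral (P \x m)%E); last first.
  move=> S mS _; apply/esym/product_measure_unique => // A B mA mB.
  exact: product_coord_shift.
rewrite fubini_tonelli1// /fubini_F/=.
under eq_integral.
  move=> a _; rewrite /g/= ge0_integralZl//; last 2 first.
  - exact/measurable_EFinP.
  - by rewrite lee_fin.
  rewrite integral_indic// setIT.
  over.
rewrite /= ge0_integralZr//.
- by rewrite muleC.
- exact/measurable_EFinP.
- by move=> a _; rewrite lee_fin.
Qed.

Let sums_le (h : X -> R) : measurable_fun setT h -> (forall a, 0 <= h a) ->
  {ae m, forall (x : seqspace X), forall (b : R), (\int[P]_a (h a)%:E < b%:E)%E ->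
    \forall n \near \oo, \sum_(i < n) h (x i) <= b * n%:R}.
Proof.
move=> mh h0.
have mh0 : measurable_fun setT (fun x : seqspace X => h (x 0%N)).
  by apply: measurableT_comp => //; exact: measurable_coord.
have := @birkhoff_sum_le_mean _ _ _ m _ (@measurable_shift _ X) product_shift
  (fun x => h (x 0%N)) mh0 (fun x => h0 (x 0%N)).
move=> /(_ _)/= H; have := H (fun E mE shE => product_integral_invariant mh h0 mE shE).
apply: filterS => x hx b hb; have := hx b; rewrite product_integral_coord//.
by move=> /(_ hb); apply: filterS => n; rewrite birkhoff_sum_shift.
Qed.

(** For the lower bound, [K - h] truncated below at [0] is again nonnegative,
    so the upper bound applies to it; then [K] tends to infinity. *)
Lemma strong_law (h : X -> R) : measurable_fun setT h -> (forall a, 0 <= h a) ->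
  {ae m, forall (x : seqspace X), (mean (fun i => h (x i)) n)%:E @[n --> \oo] -->
                   (\int[P]_a (h a)%:E)%E}.
Proof.
move=> mh h0.
pose t (K : nat) a := Num.min (h a) K%:R.
have mt K : measurable_fun setT (t K) by exact: measurable_minr.
have t0 K a : 0 <= t K a by rewrite /t le_min h0 ler0n.
have tK K a : t K a <= K%:R by rewrite /t ge_min lexx orbT.
have th K a : t K a <= h a by rewrite /t ge_min lexx.
have lower : {ae m, forall (x : seqspace X), forall (K : nat) (b : R),
    (\int[P]_a (K%:R - t K a)%:E < b%:E)%E ->
    \forall n \near \oo, \sum_(i < n) (K%:R - t K (x i)) <= b * n%:R}.
  apply: ae_foralln => K; apply: sums_le; first exact: measurable_funB.
  by move=> a; rewrite subr_ge0.
have It K : (\int[P]_a (K%:R - t K a)%:E = K%:R%:E - \int[P]_a (t K a)%:E)%E.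
  have tfin : (\int[P]_a (t K a)%:E)%E \is a fin_num.
    rewrite ge0_fin_numE; last by apply: integral_ge0 => a _; rewrite lee_fin.
    apply: (@le_lt_trans _ _ (\int[P]_a (cst K%:R%:E a))%E).
      by apply: ge0_le_integral => // [a _||a _]; rewrite ?lee_fin//; exact/measurable_EFinP.
    by rewrite integral_cst//= probability_setT mule1 ltry.
  suff tot : (\int[P]_a (K%:R - t K a)%:E + \int[P]_a (t K a)%:E = K%:R%:E)%E.
    by rewrite -tot addeK.
  rewrite -ge0_integralD//.
  - under eq_integral do rewrite -EFinD subrK.
    by rewrite integral_cst//= probability_setT mule1.
  - by move=> a _; rewrite lee_fin subr_ge0.
  - by apply/measurable_EFinP; exact: measurable_funB.
  - by move=> a _; rewrite lee_fin.
  - exact/measurable_EFinP.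
have cvgt : (\int[P]_a (t K a)%:E)%E @[K --> \oo] --> (\int[P]_a (h a)%:E)%E.
  rewrite (_ : (\int[P]_a (h a)%:E)%E = (\int[P]_a limn (fun K => (t K a)%:E))%E).
    apply: cvg_monotone_convergence => //.
    - by move=> K; exact/measurable_EFinP.
    - by move=> K a _; rewrite lee_fin.
    - move=> a _ K K' KK'; rewrite lee_fin /t le_min !ge_min lexx/=.
      by rewrite ler_nat KK' orbT.
  apply: eq_integral => a _; apply/esym/cvg_lim => //.
  apply: cvg_near_cst; exists (Num.truncn (h a)).+1 => // K /= hK.
  rewrite /t min_l// ltW// (lt_le_trans (truncnS_gt _))// ler_nat.
  exact: hK.
have := sums_le mh h0; move: lower; apply: filterS2 => x xlow xup.
have low (c : R) : (c%:E < \int[P]_a (h a)%:E)%E ->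
    \forall n \near \oo, c <= mean (fun i => h (x i)) n.
  move=> ch.
  have [K cK] : exists K, (c%:E < \int[P]_a (t K a)%:E)%E.
    apply: contrapT => nK; move: ch; rewrite ltNge => /negP; apply.
    apply: (cvge_le _ cvgt); apply: nearW => K.
    by rewrite leNgt; apply/negP => h'; apply: nK; exists K.
  have Kc : (\int[P]_a (K%:R - t K a)%:E < (K%:R - c)%:E)%E.
    move: cK; rewrite It; case: (\int[P]_a _)%E => [r| |]//=.
      by rewrite -EFinB !lte_fin; lra.
    by rewrite addeNy ltNyr.
  near=> n; have n0 : 0 < n%:R :> R.
    by rewrite ltr0n; near: n; exists 1%N.
  rewrite /mean ler_pdivlMr//.
  apply: (@le_trans _ _ (\sum_(i < n) t K (x i))); last exact: ler_sum.
  have : \sum_(i < n) (K%:R - t K (x i)) <= (K%:R - c) * n%:R.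
    by near: n; exact: xlow.
  rewrite sumrB sumr_const card_ord -mulr_natr; lra.
have up (c : R) : (\int[P]_a (h a)%:E < c%:E)%E ->
    \forall n \near \oo, mean (fun i => h (x i)) n <= c.
  move=> hc; near=> n; have n0 : 0 < n%:R :> R.
    by rewrite ltr0n; near: n; exists 1%N.
  by rewrite /mean ler_pdivrMr//; near: n; exact: xup.
have Ih0 : (0 <= \int[P]_a (h a)%:E)%E by apply: integral_ge0 => a _; rewrite lee_fin.
move: low up Ih0; case: (\int[P]_a (h a)%:E)%E => [l| |]//= low up _.
- apply: cvg_EFin; first exact: nearW.
  apply/cvgrPdist_le => e e0; near=> n.
  rewrite ler_norml; apply/andP; split.
    have : mean (fun i => h (x i)) n <= l + e.
      by near: n; apply: up; rewrite lte_fin ltrDl.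
    by rewrite /=; lra.
  have : l - e <= mean (fun i => h (x i)) n.
    by near: n; apply: low; rewrite lte_fin ltrBlDr ltrDl.
  by rewrite /=; lra.
- apply/cvgeyPge => A; have := low A (ltry _); apply: filterS => n.
  by rewrite lee_fin.
Unshelve. all: by end_near. Qed.

End strong_law.

(** * Directing measures *)

Section probability_of_rational_cdf.
Context (R : realType) (F : rat -> R).
Hypothesis F_nd : forall p q : rat, p <= q -> F p <= F q.
Hypothesis F01 : forall q, 0 <= F q <= 1.
Hypothesis F1 : forall e, 0 < e -> exists q, 1 - e < F q.
Hypothesis F0 : forall e, 0 < e -> exists q, F q < e.

Let upper (t : R) : set R := [set F q | q in [set q : rat | t < ratr q]].

(** [F] may fail to be right-continuous at its jumps; its limits from the right
    are right-continuous. *)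
Definition right_limit_cdf (t : R) : R := inf (upper t).

Let upper_nonempty t : upper t !=set0.
Proof.
have [q] := @rat_in_itvoo R t (t + 1) ltac:(by rewrite ltrDl).
by rewrite in_itv/= => /andP[tq _]; exists (F q), q.
Qed.

Let upper_lbound t : has_lbound (upper t).
Proof. by exists 0 => _ [q _ <-]; case/andP: (F01 q). Qed.

Lemma right_limit_cdf_le t q : t < ratr q -> right_limit_cdf t <= F q.
Proof. by move=> tq; apply: ge_inf => //; exists q. Qed.

Lemma right_limit_cdf_ge (q : rat) t : ratr q <= t -> F q <= right_limit_cdf t.
Proof.
move=> qt; apply: lb_le_inf => // _ [p tp <-]; apply: F_nd.
by rewrite -(ler_rat R) (le_trans qt)// ltW.
Qed.

Let nd : nondecreasing right_limit_cdf.
Proof.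
move=> s t st; apply: lb_le_inf => // _ [q tq <-].
by apply: right_limit_cdf_le; exact: le_lt_trans tq.
Qed.

Let rc : right_continuous right_limit_cdf.
Proof.
move=> t; apply/cvgrPdist_le => e e0.
have [_ [q tq <-] qe] : exists2 y, upper t y & y < right_limit_cdf t + e.
  by apply: inf_lt => //; rewrite ltrDl.
near=> s.
have ts : t <= s by near: s; exact: nbhs_right_ge.
have sq : s < ratr q by near: s; exact: nbhs_right_lt.
rewrite distrC ger0_norm ?subr_ge0; last exact: nd.
by rewrite lerBlDl ltW// (le_lt_trans _ qe)// right_limit_cdf_le.
Unshelve. all: by end_near. Qed.

Let r01 t : 0 <= right_limit_cdf t <= 1.
Proof.
apply/andP; split; first by apply: lb_le_inf => // _ [q _ <-]; case/andP: (F01 q).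
have [_ [q tq _]] := upper_nonempty t.
by rewrite (le_trans (right_limit_cdf_le tq))//; case/andP: (F01 q).
Qed.

Let cNy : right_limit_cdf @ -oo --> (0 : R).
Proof.
apply/cvgrPdist_le => e e0; have [q qe] := F0 e0; near=> s.
have /andP[s0 _] := r01 s.
rewrite sub0r normrN ger0_norm// ltW// (le_lt_trans _ qe)// right_limit_cdf_le//.
by near: s; apply: nbhs_ninfty_lt; exact: num_real.
Unshelve. all: by end_near. Qed.

Let cy : right_limit_cdf @ +oo --> (1 : R).
Proof.
apply/cvgrPdist_le => e e0; have [q qe] := F1 e0; near=> s.
have /andP[_ s1] := r01 s.
rewrite ger0_norm ?subr_ge0// lerBlDl -lerBlDr ltW// (lt_le_trans qe)//.
by apply: right_limit_cdf_ge; near: s; apply: nbhs_pinfty_ge; exact: num_real.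
Unshelve. all: by end_near. Qed.

HB.instance Definition _ :=
  isCumulative.Build R _ R right_limit_cdf nd rc.
HB.instance Definition _ :=
  isCumulativeBounded.Build R 0 1 right_limit_cdf cNy cy.

Lemma exists_probability_of_rational_cdf : exists P : probability R R,
  forall t, P `]-oo, t]%classic = (right_limit_cdf t)%:E.
Proof.
exists (image_prob (lebesgue_stieltjes_measure right_limit_cdf)
  (@measurable_to_real R)).
by move=> t; rewrite image_probE -cdf_lebesgue_stieltjes_id.
Qed.

End probability_of_rational_cdf.

Lemma cvg_cdf_left (R : realType) (P : probability R R) (t : R) :
  P `]-oo, t - n.+1%:R^-1]%classic @[n --> \oo] --> P `]-oo, t[%classic.
Proof.
have -> : `]-oo, t[%classic = \bigcup_n `]-oo, t - n.+1%:R^-1]%classic :> set R.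
  apply/seteqP; split => x /=.
    rewrite in_itv/= => /ltr_add_invr[k xk]; exists k => //=.
    by rewrite in_itv/= lerBrDr ltW.
  by move=> [k _ /=]; rewrite !in_itv/= => /le_lt_trans; apply; rewrite ltrBlDr ltrDl invr_gt0.
apply: nondecreasing_cvg_mu => //; first exact: bigcupT_measurable.
move=> m n mn; apply/subsetPset; apply: subset_itvl.
by rewrite bnd_simp lerB// lef_pV2 ?posrE// ler_nat.
Qed.

Section directing_measure.
Context (R : realType).
Implicit Types (x : seqspace R) (P : probability R R).

Local Notation ray t := (`]-oo, t]%classic : set R).
Local Notation oray t := (`]-oo, t[%classic : set R).

Lemma freq_ge0 x A n : 0 <= freq x A n.
Proof. by rewrite /freq divr_ge0. Qed.

Lemma freq_le1 x A n : freq x A n <= 1.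
Proof.
rewrite /freq; case: n => [|n]; first by rewrite invr0 mulr0 ler01.
rewrite ler_pdivrMr ?ltr0n// mul1r ler_nat.
by rewrite (leq_trans (max_card _))// card_ord.
Qed.

Lemma freq_subset x (A B : set R) n : A `<=` B -> freq x A n <= freq x B n.
Proof.
move=> AB; rewrite !freqE /mean ler_wpM2r// ?invr_ge0//; apply: ler_sum => i _.
rewrite !indicE; have [xA|//] := boolP (x i \in A); rewrite ?ler0n//.
by rewrite (_ : x i \in B)//; apply/mem_set/AB/set_mem.
Qed.

(** Weak convergence of the empirical measures of [x] to [P], read off at the
    rational points: at an atom of [P] the frequency may fall short. *)
Definition directs x P : Prop := forall q : rat, exists l : R,
  [/\ freq x (ray (ratr q)) n @[n --> \oo] --> l,
      (P (oray (ratr q)) <= l%:E)%E & (l%:E <= P (ray (ratr q)))%E].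

(** Unlike [es_measure], this measure is determined by countably many limits:
    it depends measurably on all of [x], and its existence for an exchangeable
    sequence requires no uniformity. *)
Definition directing x : probability R R :=
  xget (\d_(0 : R) : probability R R) [set P | directs x P].

(** The distribution functions of two such measures are interlaced along the
    rational points, and they are right-continuous. *)
Lemma directs_unique x P Q : directs x P -> directs x Q ->
  forall A, measurable A -> P A = Q A.
Proof.
suff le P' Q' : directs x P' -> directs x Q' -> forall t, (P' (ray t) <= Q' (ray t))%E.
  move=> xP xQ; apply: real_probability_unique => t.
  by apply/eqP; rewrite eq_le !le.
move=> xP xQ t; apply: (cvge_ge _ (@cvg_cdf_right _ Q' t)); apply: nearW => n.
have [q] := @rat_in_itvoo R t (t + n.+1%:R^-1) ltac:(by rewrite ltrDl invr_gt0).
rewrite in_itv/= => /andP[tq qn].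
have [l [xl Pl _]] := xP q; have [l' [xl' _ Ql]] := xQ q.
have ll' : l = l' by exact: cvg_unique xl xl'.
apply: (@le_trans _ _ (P' (oray (ratr q)))).
  apply: le_measure; rewrite ?inE//.
  by move=> y /=; rewrite !in_itv/= => /le_lt_trans; exact.
by rewrite (le_trans Pl)// ll' (le_trans Ql)// cdf_le// ltW.
Qed.

(** The measure is the Stieltjes measure of the right limits of [F]; monotonicity
    places [F q] between its masses of the open and the closed ray ending at [q]. *)
Lemma directs_exists x (F : rat -> R) :
  (forall q, freq x (ray (ratr q)) n @[n --> \oo] --> F q) ->
  (forall e, 0 < e -> exists q, 1 - e < F q) ->
  (forall e, 0 < e -> exists q, F q < e) ->
  exists P, directs x P.
Proof.
move=> xF F1 F0.
have F01 q : 0 <= F q <= 1.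
  apply/andP; split.
    by apply: (cvgr_to_ge (xF q)); apply: nearW => n; exact: freq_ge0.
  by apply: (cvgr_to_le (xF q)); apply: nearW => n; exact: freq_le1.
have F_nd (p q : rat) : p <= q -> F p <= F q.
  move=> pq; apply: (ler_cvg_to (xF p) (xF q)).
  apply: nearW => n; apply: freq_subset.
  by apply: subset_itvl; rewrite bnd_simp ler_rat.
have [P PE] := exists_probability_of_rational_cdf F_nd F01 F1 F0.
exists P => q; exists (F q); split; first exact: xF.
  apply: (cvge_le _ (@cvg_cdf_left _ P (ratr q))); apply: nearW => n.
  by rewrite PE lee_fin right_limit_cdf_le// ltrBlDr ltrDl invr_gt0.
by rewrite PE lee_fin right_limit_cdf_ge.
Qed.

End directing_measure.

Lemma uniform_cvgP (T : choiceType) (R : realType) (u : nat -> T -> R) (L : T -> R) :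
  {uniform, u @ \oo --> L} <->
  forall e, 0 < e -> \forall n \near \oo, forall t, `|L t - u n t| < e.
Proof.
split => [uL e e0|uL].
  apply: (uL [set h : {uniform T -> R} | forall t, `|L t - h t| < e]).
  apply/uniform_nbhs; exists [set xy | ball xy.1 e xy.2]; split.
    by rewrite -entourage_ballE; exists e.
  by move=> h hL /= t; have := hL t I; rewrite /ball/=.
move=> A /uniform_nbhs[E []]; rewrite -entourage_ballE => -[e /= e0 eE] EA.
have := uL e e0; apply: filterS => n hn; apply: EA => t _; apply: eE.
exact: hn.
Qed.

Lemma bigcapT_measurable_rat d (T : measurableType d) (F : rat -> set T) :
  (forall q, measurable (F q)) -> measurable (\bigcap_q F q).
Proof.
move=> mF; rewrite -[X in measurable X]setCK setC_bigcap; apply: measurableC.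
by apply: bigcupT_measurable_rat => q; exact: measurableC.
Qed.

Section empirical_measures.
Context (R : realType).
Implicit Types (x : seqspace R) (P : probability R R).

Local Notation ray t := (`]-oo, t]%classic : set R).
Local Notation oray t := (`]-oo, t[%classic : set R).

(** An upper limit, to be defined and measurable everywhere. *)
Definition cdf_limit (q : rat) x : R :=
  fine (limn_esup (fun n => (freq x (ray (ratr q)) n)%:E)).

Lemma cdf_limitE q x (l : R) : freq x (ray (ratr q)) n @[n --> \oo] --> l ->
  cdf_limit q x = l.
Proof.
move=> xl; rewrite /cdf_limit.
have : (freq x (ray (ratr q)) n)%:E @[n --> \oo] --> l%:E.
  by apply: cvg_EFin => //; exact: nearW.
by move=> /cvg_limn_einf_sup[_ ->].
Qed.

Lemma measurable_mean (h : R -> R) n : measurable_fun setT h ->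
  measurable_fun setT (fun x : seqspace R => mean (fun i => h (x i)) n).
Proof.
move=> mh; apply: measurable_funM => //; apply: measurable_sum => i.
by apply: measurableT_comp => //; exact: measurable_coord.
Qed.

Lemma measurable_freq A n : measurable A ->
  measurable_fun setT (fun x : seqspace R => freq x A n).
Proof.
move=> mA; rewrite (_ : (fun x : seqspace R => freq x A n) =
  (fun x : seqspace R => mean (fun i => \1_A (x i)) n)).
  exact: measurable_mean.
by apply/funext => x; rewrite freqE.
Qed.

Lemma measurable_cdf_limit q : measurable_fun setT (cdf_limit q).
Proof.
apply: measurableT_comp; first exact: fine_measurable.
apply: measurable_fun_limn_esup => n.
by apply/measurable_EFinP; exact: measurable_freq.
Qed.

(** The uniform limit is eliminated, and what remains is a countable condition
    on measurable functions of [x]. *)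
Lemma es_domP x : es_dom x <-> forall k, exists N, forall n, (N <= n)%N ->
  forall q : rat, `|cdf_limit q x - freq x (ray (ratr q)) n| <= k.+1%:R^-1.
Proof.
have rayE (t : R) : [set y : R | y <= t] = ray t.
  by apply/seteqP; split => y /=; rewrite in_itv.
split.
  move=> [L /uniform_cvgP xL] k.
  have L_lim q : cdf_limit q x = L q.
    apply: cdf_limitE; apply/cvgrPdist_lt => e /xL; apply: filterS => n /(_ q).
    by rewrite rayE.
  have [N _ hN] := xL k.+1%:R^-1 ltac:(by rewrite invr_gt0).
  exists N => n Nn q; rewrite L_lim ltW//.
  by have := hN n Nn q; rewrite rayE.
move=> h; exists (cdf_limit ^~ x); apply/uniform_cvgP => e e0.
have [k ke] : exists k, k.+1%:R^-1 < e.
  by have := ltr_add_invr e0; under eq_exists do rewrite add0r.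
have [N hN] := h k; exists N => // n /= Nn q.
by rewrite rayE (le_lt_trans _ ke)//; exact: hN.
Qed.

Lemma measurable_es_dom : measurable (@es_dom R).
Proof.
rewrite (_ : @es_dom R = \bigcap_k \bigcup_N \bigcap_n \bigcap_(q : rat)
   (if (N <= n)%N then [set x : seqspace R |
      `|cdf_limit q x - freq x (ray (ratr q)) n| <= k.+1%:R^-1] else setT)).
  apply: bigcapT_measurable => k; apply: bigcupT_measurable => N.
  apply: bigcapT_measurable => n; apply: bigcapT_measurable_rat => q.
  case: ifP => _ //; rewrite -[X in measurable X]setTI.
  apply: measurable_fun_ler => //; apply: measurableT_comp => //.
  apply: measurable_funB; first exact: measurable_cdf_limit.
  exact: measurable_freq.
apply/seteqP; split => x.
  move=> /es_domP h k _; have [N hN] := h k; exists N => // n _ q _.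
  by case: ifPn => // Nn; exact: hN.
move=> h; apply/es_domP => k; have [N _ hN] := h k I; exists N => n Nn q.
by have := hN n I q I; rewrite Nn.
Qed.

(** Distinct points of a finite sample are separated, so that near [t] some
    rational point sees the same terms. *)
Lemma freq_ray_right x (t s : R) n : t < s -> exists2 q : rat, t < ratr q < s &
  freq x (ray (ratr q)) n = freq x (ray t) n.
Proof.
move=> ts.
(* no term of the sample lies strictly between [t] and [u] *)
have [u tu xu] : exists2 u, t < u <= s & forall i, (i < n)%N -> t < x i -> u <= x i.
  elim: n => [|n [u /andP[tu us] hu]]; first by exists s; rewrite ?ts ?lexx.
  have [tx|xt] := ltP t (x n).
    exists (Num.min u (x n)).
      by rewrite lt_min tu tx/= ge_min us.
    move=> i; rewrite ltnS leq_eqVlt ge_min => /orP[/eqP -> _|im txi].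
      by rewrite lexx orbT.
    by rewrite hu.
  exists u; rewrite ?tu// => i; rewrite ltnS leq_eqVlt => /orP[/eqP ->|]; last exact: hu.
  by rewrite ltNge xt.
move: tu => /andP[tu us].
have [q] := rat_in_itvoo tu; rewrite in_itv/= => /andP[tq qu].
exists q; first by rewrite tq (lt_le_trans qu).
rewrite !freqE /mean; congr (_ / _); apply: eq_bigr => i _; rewrite !indicE.
congr (_%:R); congr nat_of_bool; apply/idP/idP; rewrite !inE/= !in_itv/= => h.
  rewrite leNgt; apply/negP => /(xu i (ltn_ord i)) ux.
  by move: (le_lt_trans ux (le_lt_trans h qu)); rewrite ltxx.
by rewrite (le_trans h)// ltW.
Qed.

Lemma freq_cdf_left x (t s : R) n : s < t -> exists2 q : rat, s < ratr q < t &
  freq x (ray (ratr q)) n = freq x (oray t) n.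
Proof.
move=> st.
(* no term of the sample lies strictly between [u] and [t] *)
have [u tu xu] : exists2 u, s <= u < t & forall i, (i < n)%N -> x i < t -> x i <= u.
  elim: n => [|n [u /andP[su ut] hu]]; first by exists s; rewrite ?st ?lexx.
  have [xt|tx] := ltP (x n) t.
    exists (Num.max u (x n)).
      by rewrite gt_max ut xt/= le_max su.
    move=> i; rewrite ltnS leq_eqVlt le_max => /orP[/eqP -> _|im txi].
      by rewrite lexx orbT.
    by rewrite hu.
  exists u; rewrite ?su// => i; rewrite ltnS leq_eqVlt => /orP[/eqP ->|]; last exact: hu.
  by rewrite ltNge tx.
move: tu => /andP[su ut].
have [q] := rat_in_itvoo ut; rewrite in_itv/= => /andP[uq qt].
exists q; first by rewrite qt (le_lt_trans su).
rewrite !freqE /mean; congr (_ / _); apply: eq_bigr => i _; rewrite !indicE.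
congr (_%:R); congr nat_of_bool; apply/idP/idP; rewrite !inE/= !in_itv/= => h.
  by rewrite (le_lt_trans h).
by rewrite (le_trans (xu i (ltn_ord i) h))// ltW.
Qed.

(** Tightness: one sufficiently long initial segment approximates the limit
    uniformly, and it is bounded. *)
Lemma es_dom_directs x : es_dom x -> exists P, directs x P.
Proof.
move=> /es_domP xu.
have n_large (e : R) : 0 < e -> exists2 n, (0 < n)%N &
    forall q : rat, `|cdf_limit q x - freq x (ray (ratr q)) n| < e.
  move=> e0; have [k ke] : exists k, k.+1%:R^-1 < e.
    by have := ltr_add_invr e0; under eq_exists do rewrite add0r.
  have [N hN] := xu k; exists N.+1 => // q.
  by rewrite (le_lt_trans _ ke)//; exact/hN/leqnSn.
apply: (@directs_exists _ _ (cdf_limit ^~ x)).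
- move=> q; apply/cvgrPdist_le => e e0.
  have [k ke] : exists k, k.+1%:R^-1 < e.
    by have := ltr_add_invr e0; under eq_exists do rewrite add0r.
  have [N hN] := xu k; exists N => // n /= Nn.
  by rewrite (le_trans _ (ltW ke))//; exact: hN.
- move=> e e0; have [n n0 hn] := n_large e e0.
  have [u xu'] : exists u : R, forall i, (i < n)%N -> x i <= u.
    elim: (n) => [|m [u hu]]; first by exists 0.
    exists (Num.max u (x m)) => i; rewrite ltnS leq_eqVlt le_max.
    by move=> /orP[/eqP ->|/hu ->//]; rewrite lexx orbT.
  have [q] := @rat_in_itvoo R u (u + 1) ltac:(by rewrite ltrDl).
  rewrite in_itv/= => /andP[uq _]; exists q.
  have := hn q; suff -> : freq x (ray (ratr q)) n = 1.
    by rewrite distrC ltr_norml => /andP[_]; lra.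
  rewrite freqE /mean (eq_bigr (fun=> 1)).
    by rewrite sumr_const card_ord divff// pnatr_eq0 -lt0n.
  move=> i _; rewrite indicE mem_set//= in_itv/= (le_trans (xu' i _))// ltW//.
- move=> e e0; have [n n0 hn] := n_large e e0.
  have [u xu'] : exists u : R, forall i, (i < n)%N -> u <= x i.
    elim: (n) => [|m [u hu]]; first by exists 0.
    exists (Num.min u (x m)) => i; rewrite ltnS leq_eqVlt ge_min.
    by move=> /orP[/eqP ->|/hu ->//]; rewrite lexx orbT.
  have [q] := @rat_in_itvoo R (u - 1) u ltac:(by rewrite ltrBlDr ltrDl).
  rewrite in_itv/= => /andP[_ qu]; exists q.
  have := hn q; suff -> : freq x (ray (ratr q)) n = 0.
    by rewrite subr0 ltr_norml => /andP[].
  rewrite freqE /mean big1 ?mul0r// => i _; rewrite indicE memNset//= in_itv/=.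
  by apply/negP; rewrite -ltNge (lt_le_trans qu)// xu'.
Qed.

Lemma directs_cdf_limit x P q : directs x P ->
  [/\ freq x (ray (ratr q)) n @[n --> \oo] --> cdf_limit q x,
      (P (oray (ratr q)) <= (cdf_limit q x)%:E)%E
    & ((cdf_limit q x)%:E <= P (ray (ratr q)))%E].
Proof. by move=> /(_ q)[l [xl]]; rewrite (cdf_limitE xl). Qed.

(** The rational point that replaces [t] depends on the length of the sample;
    the limit is controlled there because the convergence is uniform. *)
Lemma es_dom_cvg_ray x P t : es_dom x -> directs x P ->
  (freq x (ray t) n)%:E @[n --> \oo] --> P (ray t).
Proof.
move=> /es_domP xu xP.
rewrite -[P _]fineK ?fin_num_measure//; apply: cvg_EFin; first exact: nearW.
apply/cvgrPdist_le => e e0; have e2 : 0 < e / 2 by rewrite divr_gt0.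
have [k ke] : exists k, k.+1%:R^-1 < e / 2.
  by have := ltr_add_invr e2; under eq_exists do rewrite add0r.
have [N hN] := xu k.
have [s ts Ps] : exists2 s, t < s & fine (P (ray s)) < fine (P (ray t)) + e / 2.
  have /fine_cvg/cvgrPdist_lt/(_ _ e2) : P (ray (t + n.+1%:R^-1)) @[n --> \oo] -->
      (fine (P (ray t)))%:E.
    by rewrite fineK ?fin_num_measure//; exact: cvg_cdf_right.
  move=> [M _ /(_ M (leqnn M))/=]; rewrite distrC ltr_norml => /andP[_ h].
  by exists (t + M.+1%:R^-1); [rewrite ltrDl invr_gt0|rewrite -ltrBlDl].
exists N => // n /= Nn.
have [q /andP[tq qs] <-] := freq_ray_right x n ts.
have [_ Pq qP] := directs_cdf_limit q xP.
have := le_trans (hN n Nn q) (ltW ke).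
have fP A : measurable A -> P A = (fine (P A))%:E.
  by move=> mA; rewrite fineK ?fin_num_measure.
have h1 : fine (P (ray t)) <= cdf_limit q x.
  rewrite -lee_fin -fP//; apply: (le_trans _ Pq); apply: le_measure; rewrite ?inE//.
  by move=> y /=; rewrite !in_itv/= => /le_lt_trans; exact.
have h2 : cdf_limit q x <= fine (P (ray s)).
  by rewrite -lee_fin -fP// (le_trans qP)// cdf_le// ltW.
rewrite !ler_norml => /andP[h3 h4]; clear ke; apply/andP; split; lra.
Qed.

Lemma es_dom_cvg_oray x P t : es_dom x -> directs x P ->
  (freq x (oray t) n)%:E @[n --> \oo] --> P (oray t).
Proof.
move=> /es_domP xu xP.
rewrite -[P _]fineK ?fin_num_measure//; apply: cvg_EFin; first exact: nearW.
apply/cvgrPdist_le => e e0; have e2 : 0 < e / 2 by rewrite divr_gt0.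
have [k ke] : exists k, k.+1%:R^-1 < e / 2.
  by have := ltr_add_invr e2; under eq_exists do rewrite add0r.
have [N hN] := xu k.
have [s ts Ps] : exists2 s, s < t & fine (P (oray t)) - e / 2 < fine (P (ray s)).
  have /fine_cvg/cvgrPdist_lt/(_ _ e2) : P (ray (t - n.+1%:R^-1)) @[n --> \oo] -->
      (fine (P (oray t)))%:E.
    by rewrite fineK ?fin_num_measure//; exact: cvg_cdf_left.
  move=> [M _ /(_ M (leqnn M))/=]; rewrite ltr_norml => /andP[_ h].
  exists (t - M.+1%:R^-1); first by rewrite ltrBlDr ltrDl invr_gt0.
  by rewrite ltrBlDr -ltrBlDl.
exists N => // n /= Nn.
have [q /andP[sq qt] <-] := freq_cdf_left x n ts.
have [_ Pq qP] := directs_cdf_limit q xP.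
have := le_trans (hN n Nn q) (ltW ke).
have fP A : measurable A -> P A = (fine (P A))%:E.
  by move=> mA; rewrite fineK ?fin_num_measure.
have h1 : cdf_limit q x <= fine (P (oray t)).
  rewrite -lee_fin -fP//; apply: (le_trans qP); apply: le_measure; rewrite ?inE//.
  by move=> y /=; rewrite !in_itv/= => /le_lt_trans; exact.
have h2 : fine (P (ray s)) <= cdf_limit q x.
  rewrite -lee_fin -fP//; apply: (le_trans _ Pq); apply: le_measure; rewrite ?inE//.
  by move=> y /=; rewrite !in_itv/= => /le_lt_trans; exact.
rewrite !ler_norml => /andP[h3 h4]; clear ke; apply/andP; split; lra.
Qed.

(** An interval is a difference of two rays. *)
Lemma es_dom_empirical x P : es_dom x -> directs x P -> is_empirical_measure x P.
Proof.
move=> xdom xP.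
pose L (b : itv_bound R) : set R := [set` Interval -oo%O b].
have cvgL b : (freq x (L b) n)%:E @[n --> \oo] --> P (L b).
  case: b => [[] t|[]].
  - exact: es_dom_cvg_oray.
  - exact: es_dom_cvg_ray.
  - have -> : L -oo%O = set0 by rewrite /L set_itv_ge.
    rewrite measure0; apply: cvg_near_cst; apply: nearW => n.
    by rewrite freqE /mean big1 ?mul0r// => i _; rewrite indicE in_set0.
  - have -> : L +oo%O = setT by rewrite /L set_itvNyy.
    rewrite probability_setT; apply: cvg_near_cst; exists 1%N => // n /= n0.
    rewrite freqE /mean (eq_bigr (fun=> 1)).
      by rewrite sumr_const card_ord divff// pnatr_eq0 -lt0n.
    by move=> i _; rewrite indicE in_setT.
move=> [a b].
have [ab|ba] := leP a b; last first.
  rewrite set_itv_ge; last by rewrite -leNgt ltW.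
  rewrite measure0; apply: cvg_near_cst; apply: nearW => n.
  by rewrite freqE /mean big1 ?mul0r// => i _; rewrite indicE in_set0.
have Lab : L a `<=` L b by apply: subset_itvl.
have IE : [set` Interval a b] = L b `\` L a.
  apply/seteqP; split => y /=; rewrite !itv_boundlr /= => h.
    case/andP: h => ay yb; split=> //; apply/negP.
    by rewrite -ltNge ltBRight_leBLeft.
  case: h; rewrite /L /= !itv_boundlr /= => -> /negP.
  by rewrite -ltNge ltBRight_leBLeft andbT.
have freqI n : freq x [set` Interval a b] n = freq x (L b) n - freq x (L a) n.
  rewrite IE !freqE /mean -mulrBl -sumrB; congr (_ / _); apply: eq_bigr => i _.
  rewrite !indicE in_setD.
  have [xa|xa] := boolP (x i \in L a); last by rewrite andbT subr0.
  by rewrite (_ : x i \in L b) ?subrr//; apply/mem_set/Lab/set_mem.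
under eq_fun do rewrite freqI EFinB.
have mL c : measurable (L c) by exact: measurable_itv.
rewrite IE measureD//; last by rewrite -ge0_fin_numE// fin_num_measure.
rewrite setIidr//; apply: cvgeB => //.
by rewrite fin_num_adde_defr// fin_num_measure.
Qed.

Lemma empirical_directs x P : is_empirical_measure x P -> directs x P.
Proof.
move=> xP q; have [r rE] : exists r : R, P (ray (ratr q)) = r%:E.
  by exists (fine (P (ray (ratr q)))); rewrite fineK ?fin_num_measure.
exists r; rewrite -rE; split => //.
  by have := xP `]-oo, ratr q]; rewrite rE => /fine_cvg.
by apply: le_measure; rewrite ?inE//; apply: subset_itvl; rewrite bnd_simp.
Qed.

Lemma directing_directs x : (exists P, directs x P) -> directs x (directing x).
Proof. exact: xgetPex. Qed.

Lemma es_measureP x : es_dom x -> is_empirical_measure x (es_measure x).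
Proof.
move=> xdom; apply: xgetPex; have [P xP] := es_dom_directs xdom.
by exists P; exact: es_dom_empirical.
Qed.

Lemma es_measure_directing x : es_dom x ->
  forall A, measurable A -> es_measure x A = directing x A.
Proof.
move=> xdom; apply: (@directs_unique _ x).
  exact/empirical_directs/es_measureP.
exact/directing_directs/es_dom_directs.
Qed.

End empirical_measures.

(** Convergence to [g x] means that the upper and lower limits both equal [g x]. *)
Lemma measurable_cvg_to d (T : measurableType d) (R : realType)
    (u : nat -> T -> \bar R) (g : T -> \bar R) :
  (forall n, measurable_fun setT (u n)) -> measurable_fun setT g ->
  measurable [set x | u n x @[n --> \oo] --> g x].
Proof.
move=> mu mg.
rewrite (_ : [set x | _] = [set x | limn_esup (u ^~ x) = g x] `&`
                           [set x | limn_einf (u ^~ x) = g x]); last first.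
  apply/seteqP; split => x /=.
    by move=> /cvg_limn_einf_sup[-> ->].
  move=> [su si].
  apply: (@squeeze_cvge _ _ _ _ (einfs (u ^~ x)) _ (esups (u ^~ x))).
  - apply: nearW => n; apply/andP; split.
      by apply: ereal_inf_lbound; exists n => /=.
    by apply: ereal_sup_ubound; exists n => /=.
  - by rewrite -si limn_einf_lim; exact: is_cvg_einfs.
  - by rewrite -su limn_esup_lim; exact: is_cvg_esups.
have msup : measurable_fun setT (fun x => limn_esup (u ^~ x)).
  exact: measurable_fun_limn_esup.
have minf : measurable_fun setT (fun x => limn_einf (u ^~ x)).
  apply: measurableT_comp; first exact: oppe_measurable.
  by apply: measurable_fun_limn_esup => n; apply: measurableT_comp.
apply: measurableI; rewrite -[X in measurable X]setTI.
- exact: measurable_eqe.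
- exact: measurable_eqe.
Qed.

Lemma near_eq_seq (T : Type) (f g : nat -> T) :
  (\forall n \near \oo, f n = g n) -> f @ \oo = g @ \oo.
Proof.
move=> fg; apply/seteqP; split => A fA.
  change (\forall n \near \oo, A (g n)).
  by apply: filterS2 fg fA => n /= <-.
change (\forall n \near \oo, A (f n)).
by apply: filterS2 fg fA => n /= ->.
Qed.

Section directing_kernel.
Context (R : realType).
Implicit Types (x : seqspace R) (P : probability R R).

Local Notation ray t := (`]-oo, t]%classic : set R).

Definition directable : set (seqspace R) := [set x | exists P, directs x P].

(** The existence of a directing measure as a countable condition, from which it
    is measurable. *)
Lemma directableP x : directable x <->
  [/\ forall q : rat, (freq x (ray (ratr q)) n)%:E @[n --> \oo] --> (cdf_limit q x)%:E,
      (cdf_limit k%:R x)%:E @[k --> \oo] --> 1%E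
    & (cdf_limit (- k%:R) x)%:E @[k --> \oo] --> 0%E].
Proof.
split.
  move=> [P xP]; split => [q| |].
  - have [xq _ _] := directs_cdf_limit q xP.
    by apply: cvg_EFin => //; exact: nearW.
  - have c1 := @cvg_cdf_pinfty _ P.
    suff : [sequence (cdf_limit k.+1%:R x)%:E]_k @ \oo --> 1%E.
      by rewrite (@cvg_shiftS _ (fun k => (cdf_limit k%:R x)%:E)).
    apply: (@squeeze_cvge _ _ _ _ (fun k => P (ray k%:R)) _ (fun=> 1%E)) => //.
    + apply: nearW => k; have [_ Pk kP] := directs_cdf_limit k.+1%:R xP.
      rewrite (le_trans kP (probability_le1 _ _))// andbT.
      apply: (le_trans _ Pk); apply: le_measure; rewrite ?inE//.
      move=> y /=; rewrite !in_itv/= => /le_lt_trans; apply.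
      by rewrite ratr_nat ltr_nat.
    + exact: cvg_cst.
  - have c0 := @cvg_cdf_ninfty _ P.
    apply: (@squeeze_cvge _ _ _ _ (fun=> 0%E) _ (fun k => P (ray (- k%:R)))) => //.
    + apply: nearW => k; have [_ Pk kP] := directs_cdf_limit (- k%:R) xP.
      rewrite (le_trans _ Pk)//=.
      by move: kP; rewrite rmorphN /= ratr_nat.
    + exact: cvg_cst.
move=> [xq x1 x0].
have h1 (q : rat) : freq x (ray (ratr q)) n @[n --> \oo] --> cdf_limit q x.
  by have /fine_cvg := xq q.
have h2 e : 0 < e -> exists q, 1 - e < cdf_limit q x.
  move=> e0; have /fine_cvg/cvgrPdist_lt/(_ _ e0) := x1.
  move=> [k _ /(_ k (leqnn k))/=]; rewrite ltr_norml => /andP[_ h].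
  by exists k%:R; lra.
have h3 e : 0 < e -> exists q, cdf_limit q x < e.
  move=> e0; have /fine_cvg/cvgrPdist_lt/(_ _ e0) := x0.
  move=> [k _ /(_ k (leqnn k))/=]; rewrite ltr_norml => /andP[h _].
  by exists (- k%:R); lra.
exact: (directs_exists h1 h2 h3).
Qed.

Lemma measurable_directable : measurable directable.
Proof.
have mc q : measurable_fun setT (fun x : seqspace R => (cdf_limit q x)%:E).
  by apply/measurable_EFinP; exact: measurable_cdf_limit.
rewrite (_ : directable =
  (\bigcap_(q : rat) [set x : seqspace R | (freq x (ray (ratr q)) n)%:E @[n --> \oo] -->
     (cdf_limit q x)%:E]) `&`
  ([set x : seqspace R | (cdf_limit k%:R x)%:E @[k --> \oo] --> 1%E] `&`
   [set x : seqspace R | (cdf_limit (- k%:R) x)%:E @[k --> \oo] --> 0%E])).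
  apply: measurableI; last by apply: measurableI;
    [exact: (measurable_cvg_to (fun k : nat => mc k%:R) (measurable_cst 1%E))|
     exact: (measurable_cvg_to (fun k : nat => mc (- k%:R)) (measurable_cst 0%E))].
  apply: bigcapT_measurable_rat => q; apply: measurable_cvg_to => // n.
  by apply/measurable_EFinP; exact: measurable_freq.
apply/seteqP; split => x.
  by move=> /directableP[h1 h2 h3]; split => // q _; exact: h1.
by move=> [h1 [h2 h3]]; apply/directableP; split => // q; exact: h1.
Qed.

Lemma directing_default x : ~ directable x ->
  directing x = (\d_(0 : R) : probability R R).
Proof. by move=> nx; apply: xgetPN => P xP; apply: nx; exists P. Qed.

(** Although [cdf_limit] may fall short of the distribution function of [P] at
    an atom, its limits from the right do not. *)
Lemma cvg_cdf_limit_right x P t (q : nat -> rat) : directs x P ->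
  (forall k, t < ratr (q k) < t + k.+1%:R^-1) ->
  (cdf_limit (q k) x)%:E @[k --> \oo] --> P (ray t).
Proof.
move=> xP tq.
apply: (@squeeze_cvge _ _ _ _ (fun=> P (ray t)) _
  (fun k => P (ray (t + k.+1%:R^-1)))).
- apply: nearW => k; have /andP[tqk qkt] := tq k.
  have [_ Pq qP'] := directs_cdf_limit (q k) xP; apply/andP; split.
    apply: (le_trans _ Pq); apply: le_measure; rewrite ?inE//.
    by move=> y /=; rewrite !in_itv/= => /le_lt_trans; exact.
  by rewrite (le_trans qP')// cdf_le// ltW.
- exact: cvg_cst.
- exact: cvg_cdf_right.
Qed.

Lemma measurable_directing S : measurable S ->
  measurable_fun setT (fun x => directing x S).
Proof.
suff mray t : measurable_fun setT (fun x => directing x (ray t)).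
  rewrite (@real_rays_generate R); move: S.
  apply: (@dynkin_induction _ _ _
    (fun S => measurable_fun setT (fun x : seqspace R => directing x S))
    (@real_rays_generate R) (@real_rays_setI R)).
  - rewrite (_ : (fun x => _) = cst 1%E); first exact: measurable_cst.
    by apply/funext => x; rewrite probability_setT.
  - by move=> _ [t _ <-]; exact: mray.
  - move=> A mA mdA.
    rewrite (_ : (fun x => _) = (fun x => 1 - directing x A)%E).
      exact: emeasurable_funB.
    by apply/funext => x; rewrite probability_setC.
  - move=> F mF tF mdF.
    rewrite (_ : (fun x => _) = (fun x => \sum_(0 <= k <oo) directing x (F k))%E).
      exact: ge0_emeasurable_sum.
    by apply/funext => x; rewrite measure_bigcup//; apply: eq_eseriesl => k; rewrite in_setT.
have qP (k : nat) : {q : rat | t < ratr q < t + k.+1%:R^-1}.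
  apply: cid; have [q] := @rat_in_itvoo R t (t + k.+1%:R^-1) ltac:(by rewrite ltrDl invr_gt0).
  by rewrite in_itv/= => qi; exists q.
rewrite -(setvU directable); apply/measurable_funU.
- by apply: measurableC; exact: measurable_directable.
- exact: measurable_directable.
split.
  apply: (@eq_measurable_fun _ _ _ _ _ (cst (\d_(0 : R) (ray t) : \bar R))).
    by move=> x; rewrite inE => /directing_default ->.
  exact: measurable_cst.
apply: (@emeasurable_fun_cvg _ _ _ _ (fun k x => (cdf_limit (sval (qP k)) x)%:E)).
  by move=> k; apply/measurable_EFinP/measurable_funTS; exact: measurable_cdf_limit.
move=> x /directing_directs xP.
by apply: (cvg_cdf_limit_right xP) => k; case: (qP k).
Qed.

Lemma measurable_directing_giry :
  measurable_fun setT (fun x : seqspace R => directing x : giry R R).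
Proof. by apply: measurable_giry_codensity => // B; exact: measurable_directing. Qed.

Lemma measurable_directing_integral (f : R -> \bar R) :
  measurable_fun setT f -> (forall y, 0 <= f y)%E ->
  measurable_fun setT (fun x => \int[directing x]_y f y)%E.
Proof.
move=> mf f0.
exact: (measurableT_comp (measurable_giry_int mf f0) measurable_directing_giry).
Qed.

End directing_kernel.

Section finite_permutations.

Lemma finite_permutation_bound s : finite_permutation s ->
  exists N, forall i, (N <= i)%N -> s i = i.
Proof.
move=> [_ /finite_seqP[l lE]]; exists (\max_(i <- l) i).+1 => i iN.
apply: contrapT => si; have : [set i | s i <> i] i by [].
rewrite lE /= => il; move: iN; rewrite ltnNge => /negP; apply.
by rewrite (big_rem i il)/= leq_maxl.
Qed.

(** An injection that fixes everything from [N] on permutes the first [n]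
    indices as soon as [N <= n]. *)
Lemma sum_finite_permutation (V : nmodType) s N : injective s ->
  (forall i, (N <= i)%N -> s i = i) ->
  forall n (F : nat -> V), (N <= n)%N -> \sum_(i < n) F (s i) = \sum_(i < n) F i.
Proof.
move=> sI sN n F Nn.
rewrite -(big_mkord xpredT (fun i => F (s i))) -(big_mkord xpredT F).
rewrite -(big_map s xpredT F) /index_iota subn0; apply: perm_big.
have us : uniq (map s (iota 0 n)) by rewrite map_inj_uniq// iota_uniq.
have sub : {subset map s (iota 0 n) <= iota 0 n}.
  move=> _ /mapP[i + ->]; rewrite !mem_iota !add0n/= => im.
  rewrite ltnNge; apply/negP => h.
  have : s (s i) = s i by rewrite sN// (leq_trans Nn).
  by move=> /sI si; move: im; rewrite ltnNge -{1}si h.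
have [_ h] := uniq_min_size us sub ltac:(by rewrite size_map).
by apply: uniq_perm => //; exact: iota_uniq.
Qed.

Lemma mean_finite_permutation (R : realType) s : finite_permutation s ->
  exists N, forall n (h : nat -> R), (N <= n)%N ->
    mean (fun i => h (s i)) n = mean h n.
Proof.
move=> sf; have [N sN] := finite_permutation_bound sf.
have [[s' sK _] _] := sf.
exists N => n h Nn; rewrite /mean; congr (_ / _).
exact: (sum_finite_permutation (can_inj sK) sN h Nn).
Qed.

Context (R : realType) (s : nat -> nat).
Hypothesis sf : finite_permutation s.
Implicit Type x : seqspace R.

Let permute x : seqspace R := fun i => x (s i).

Lemma freq_permute x A : \forall n \near \oo, freq (permute x) A n = freq x A n.
Proof.
have [N sN] := mean_finite_permutation R sf; exists N => // n /= Nn.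
by rewrite !freqE (sN n (fun i => \1_A (x i))).
Qed.

Lemma es_dom_permute x : es_dom (permute x) = es_dom x.
Proof.
rewrite /es_dom /=; apply: eq_exists => L; congr (cvg_to _ _); apply: near_eq_seq.
have [N sN] := mean_finite_permutation R sf; exists N => // n /= Nn.
by apply/funext => t; rewrite !freqE (sN n (fun i => \1_ _ (x i))).
Qed.

Lemma freqE_permute x A :
  (freq (permute x) A n)%:E @[n --> \oo] = (freq x A n)%:E @[n --> \oo].
Proof.
by apply: near_eq_seq; near do congr EFin; exact: freq_permute.
Unshelve. all: by end_near. Qed.

Lemma es_measure_permute x : es_measure (permute x) = es_measure x.
Proof.
congr xget; apply/seteqP; split => P xP I.
  by rewrite -(freqE_permute x).
by rewrite (freqE_permute x).
Qed.

Lemma directing_permute x : directing (permute x) = directing x.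
Proof.
congr xget; apply/seteqP; split => P xP q; have [l [xl Pl lP]] := xP q;
  exists l; split => //.
  by rewrite -(near_eq_seq (freq_permute x `]-oo, ratr q]%classic)).
by rewrite (near_eq_seq (freq_permute x `]-oo, ratr q]%classic)).
Qed.

Lemma mean_permute (h : R -> R) x :
  (fun n => mean (fun i => h (permute x i)) n) @ \oo =
  (fun n => mean (fun i => h (x i)) n) @ \oo.
Proof.
apply: near_eq_seq; have [N sN] := mean_finite_permutation R sf; exists N => // n /= Nn.
exact: (sN n (fun i => h (x i))).
Qed.

End finite_permutations.

(** * The restricted empirical kernel *)

Section es_real_bar_kernel.
Context (R : realType).
Implicit Type x : seqspace R.

Local Notation es_bar := (es_real_bar R).

Lemma es_integral_directing x (f : R -> \bar R) : es_dom x ->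
  (\int[pker (es_real R) x]_y f y = \int[directing x]_y f y)%E.
Proof.
move=> xdom; apply: eq_measure_integral => A mA _.
exact: es_measure_directing.
Qed.

Lemma mean_conditionE x : es_dom x -> mean_condition x =
  ((mean x n)%:E @[n --> \oo] --> (fine (\int[directing x]_y y%:E))%:E).
Proof.
move=> xdom; rewrite /mean_condition /Rintegral.
rewrite (es_integral_directing (fun y => y%:E) xdom).
apply/propext; split.
  by move=> h; apply: cvg_EFin => //; exact: nearW.
by move=> /fine_cvg.
Qed.

Lemma measurable_directing_mean :
  measurable_fun setT (fun x : seqspace R => fine (\int[directing x]_y y%:E)).
Proof.
apply: measurableT_comp; first exact: fine_measurable.
rewrite (_ : (fun x => _) = (fun x => \int[directing x]_y (EFin ^\+ y) -
                                      \int[directing x]_y (EFin ^\- y))%E); last first.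
  by apply/funext => x; rewrite integralE.
have mE : measurable_fun setT (@EFin R) by exact: EFin_measurable.
apply: emeasurable_funB; apply: measurable_directing_integral => //.
- exact: measurable_funepos.
- exact: measurable_funeneg.
Qed.

Lemma measurable_abs_mean :
  measurable_fun setT (fun x : seqspace R => \int[directing x]_y `|y|%:E)%E.
Proof.
apply: measurable_directing_integral => //.
by apply/measurable_EFinP; exact: normr_measurable.
Qed.

Lemma measurable_es_real_bar_dom : measurable (pdom es_bar).
Proof.
pose A x := (\int[directing x]_y `|y|%:E)%E.
pose M := [set x : seqspace R |
  (mean x n)%:E @[n --> \oo] --> (fine (\int[directing x]_y y%:E))%:E].
have -> : pdom es_bar = @es_dom R `&`
  ([set x : seqspace R | (mean (fun i => `|x i|) n)%:E @[n --> \oo] --> A x] `&`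
   (~` [set x : seqspace R | (A x < +oo)%E] `|` M)).
  apply/seteqP; split => x.
    move=> [xdom xabs xmean]; split => //; split.
      by move: xabs; rewrite /abs_mean_condition es_integral_directing.
    have [Ay|] := pselect (A x < +oo)%E; last by left.
    right; rewrite /M /= -mean_conditionE//; apply: xmean.
    by rewrite es_integral_directing.
  move=> [xdom [xabs xmean]]; split => //.
    by rewrite /abs_mean_condition es_integral_directing.
  rewrite es_integral_directing// mean_conditionE// => Ay.
  by case: xmean.
have mmean : forall n, measurable_fun setT (fun x : seqspace R => (mean x n)%:E).
  by move=> n; apply/measurable_EFinP; exact: (@measurable_mean _ id).
apply: measurableI; first exact: measurable_es_dom.
apply: measurableI.
  apply: measurable_cvg_to; last exact: measurable_abs_mean.
  by move=> n; apply/measurable_EFinP; apply: measurable_mean; exact: normr_measurable.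
apply: measurableU.
  apply: measurableC; rewrite -[X in measurable X]setTI.
  exact: (emeasurable_fun_infty_o measurableT measurable_abs_mean).
apply: measurable_cvg_to => //.
by apply/measurable_EFinP; exact: measurable_directing_mean.
Qed.

Lemma es_real_bar_domE x : pdom es_bar x =
  [/\ es_dom x, abs_mean_condition x
    & (\int[pker (es_real R) x]_y `|y|%:E < +oo)%E -> mean_condition x].
Proof. by []. Qed.

Lemma es_real_bar_sub_dom x : pdom es_bar x -> es_dom x.
Proof. by case. Qed.

Lemma es_real_bar_partial_markov : partial_markov es_bar.
Proof.
split.
- exact: measurable_es_real_bar_dom.
- by move=> x _; exists (es_measure x).
- move=> S mS.
  apply: (@eq_measurable_fun _ _ _ _ _ (fun x : seqspace R => directing x S)).
    by move=> x; rewrite inE => /es_real_bar_sub_dom xdom; rewrite -es_measure_directing.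
  by apply: measurable_funTS; exact: measurable_directing.
Qed.

Lemma es_real_bar_permutation_invariant : permutation_invariant es_bar.
Proof.
move=> s sf.
have domE x : pdom es_bar (fun i => x (s i)) = pdom es_bar x.
  have pkE y : pker (es_real R) y = es_measure y by [].
  rewrite 2!es_real_bar_domE (es_dom_permute sf x).
  rewrite /abs_mean_condition /mean_condition !pkE (es_measure_permute sf x).
  rewrite (mean_permute sf id x).
  have -> : (mean (fun i => `|x (s i)|) n)%:E @[n --> \oo] =
            (mean (fun i => `|x i|) n)%:E @[n --> \oo].
    apply: near_eq_seq; have [N sN] := mean_finite_permutation R sf.
    by exists N => // n /= Nn; rewrite (sN n (fun i => `|x i|)).
  by [].
have [mdom _ mes] := es_real_bar_partial_markov.
split.
  apply/seteqP; split => x.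
    move=> [_ h]; rewrite -domE; move: h; rewrite /= diracE.
    case: (boolP (_ \in _)) => [h _|_ /eqP]; first exact: set_mem h.
    by rewrite eqe (eq_sym _ 1) oner_eq0.
  move=> xdom; rewrite -domE in xdom; split; first exact: I.
  change ((\d_((fun i => x (s i)) : seqspace R) (pdom es_bar)) = 1%E :> \bar R).
  by rewrite diracE (mem_set xdom).
move=> x [_ h] S mS; move: h; rewrite /= diracE.
case: (boolP (_ \in _)) => [xdom _|_ /eqP]; last first.
  by rewrite eqe (eq_sym _ 1) oner_eq0.
rewrite integral_dirac//; last exact: mes.
by rewrite diracE xdom mul1e es_measure_permute.
Qed.

End es_real_bar_kernel.

(** * Independent samples *)

Section glivenko_cantelli.
Context (R : realType) (P : probability R R).
Implicit Type x : seqspace R.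

Local Notation ray t := (`]-oo, t]%classic : set R).
Local Notation oray t := (`]-oo, t[%classic : set R).

Lemma le_cdf_quantile (u : R) : 0 < u < 1 -> (u%:E <= P (ray (quantile P u)))%E.
Proof. by move=> u01; rewrite -quantile_le. Qed.

Lemma cdf_left_quantile_le (u : R) : 0 < u < 1 ->
  (P (oray (quantile P u)) <= u%:E)%E.
Proof.
move=> u01; apply: (cvge_le _ (@cvg_cdf_left _ P (quantile P u))).
apply: nearW => n; rewrite leNgt; apply/negP => /ltW; rewrite -quantile_le//.
by rewrite leNgt ltrBlDr ltrDl invr_gt0 ltr0n.
Qed.

(** Between two consecutive quantiles of order [i / k], both the distribution
    function and its empirical version are monotone, and the mass of the open
    interval is at most [1 / k]; controlling the two closed and open rays at
    these finitely many points therefore controls every ray. *)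
Lemma uniform_of_quantiles x (k n : nat) (t : R) : (1 < k)%N ->
  (forall i, (0 < i < k)%N ->
     `|freq x (ray (quantile P (i%:R / k%:R))) n -
       fine (P (ray (quantile P (i%:R / k%:R))))| <= k%:R^-1) ->
  (forall i, (0 < i < k)%N ->
     `|freq x (oray (quantile P (i%:R / k%:R))) n -
       fine (P (oray (quantile P (i%:R / k%:R))))| <= k%:R^-1) ->
  `|fine (P (ray t)) - freq x (ray t) n| <= k%:R^-1 + k%:R^-1.
Proof.
move=> k1 hray horay.
have k0 : 0 < k%:R :> R by rewrite ltr0n (ltn_trans _ k1).
have fP A : measurable A -> P A = (fine (P A))%:E.
  by move=> mA; rewrite fineK ?fin_num_measure.
set F := fine (P (ray t)).
have F0 : 0 <= F by rewrite -lee_fin -fP.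
have F1 : F <= 1 by rewrite -lee_fin -fP// probability_le1.
set e := k%:R^-1 in hray horay *.
have e0 : 0 < e by rewrite invr_gt0.
have ke : k%:R * e = 1 by rewrite divff// gt_eqF.
have u01 i : (0 < i < k)%N -> 0 < (i%:R / k%:R : R) < 1.
  move=> /andP[i0 ik]; rewrite divr_gt0 ?ltr0n//=; last exact: ltn_trans k1.
  by rewrite ltr_pdivrMr// mul1r ltr_nat.
have kn0 : (0 < k)%N by exact: ltn_trans k1.
have f0 := freq_ge0 x (ray t) n; have f1 := freq_le1 x (ray t) n.
have low : forall i, (0 < i < k)%N -> i%:R * e <= F ->
    i%:R * e - e <= freq x (ray t) n.
  move=> i ik iF; have qt : quantile P (i%:R / k%:R) <= t.
    by rewrite quantile_le ?u01// fP// lee_fin.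
  have := hray i ik; rewrite ler_norml => /andP[h _].
  have h1 : i%:R * e <= fine (P (ray (quantile P (i%:R / k%:R)))).
    by rewrite -lee_fin -fP//; apply: le_cdf_quantile; exact: u01.
  have h2 : freq x (ray (quantile P (i%:R / k%:R))) n <= freq x (ray t) n.
    by apply: freq_subset; apply: subset_itvl; rewrite bnd_simp.
  lra.
have upp : forall i, (0 < i < k)%N -> F < i%:R * e ->
    freq x (ray t) n <= i%:R * e + e.
  move=> i ik iF; have qt : t < quantile P (i%:R / k%:R).
    by rewrite ltNge quantile_le ?u01// fP// lee_fin -ltNge.
  have := horay i ik; rewrite ler_norml => /andP[_ h].
  have h1 : fine (P (oray (quantile P (i%:R / k%:R)))) <= i%:R * e.
    by rewrite -lee_fin -fP//; apply: cdf_left_quantile_le; exact: u01.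
  have h2 : freq x (ray t) n <= freq x (oray (quantile P (i%:R / k%:R))) n.
    by apply: freq_subset; apply: subset_itvl; rewrite bnd_simp.
  lra.
(* [i] is the integer part of [k * F]; for [F = 1] it has to be lowered to [k - 1] *)
have [i [ik iF Fi]] : exists i, [/\ (i < k)%N, i%:R * e <= F &
    F < i.+1%:R * e \/ i.+1 = k].
  have kF0 : 0 <= k%:R * F by rewrite mulr_ge0// ltW.
  have /andP[h1 h2] := truncn_itv kF0.
  have [hk|hk] := leqP (Num.truncn (k%:R * F)).+1 k.
    exists (Num.truncn (k%:R * F)); split => //.
      by rewrite /e ler_pdivrMr// [F * _]mulrC.
    by left; rewrite /e ltr_pdivlMr// [F * _]mulrC.
  exists k.-1; split; first by rewrite prednK.
    rewrite /e ler_pdivrMr// [F * _]mulrC (le_trans _ h1)// ler_nat.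
    by move: hk; rewrite -{1}(prednK kn0) !ltnS => /ltnW.
  by right; rewrite prednK.
have iS : i.+1%:R * e = i%:R * e + e by rewrite -natr1 mulrDl mul1r.
rewrite ler_norml; apply/andP; split.
  have [Si|Sk] := ltnP i.+1 k.
    have Fi' : F < i.+1%:R * e.
      by case: Fi => // Fi; rewrite Fi ltnn in Si.
    by have := upp i.+1 Si Fi'; rewrite iS; lra.
  have Sk' : i.+1 = k by apply/eqP; rewrite eqn_leq ik Sk.
  by rewrite Sk' ke in iS; lra.
have Fle : F <= i%:R * e + e.
  by case: Fi => [/ltW|Sk]; rewrite -iS// Sk ke.
case: i ik iF {Fi iS} Fle => [|i] ik iF Fle; first by lra.
by have := low i.+1 ik iF; lra.
Qed.

Variable m : probability (seqspace R) R.
Hypothesis mP : is_infinite_product P m.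

Lemma iid_freq A : measurable A ->
  {ae m, forall x : seqspace R, freq x A n @[n --> \oo] --> fine (P A)}.
Proof.
move=> mA; have h0 y : 0 <= \1_A y :> R by [].
have := strong_law mP (measurable_indic mA) h0.
apply: filterS => x; rewrite integral_indic// setIT.
rewrite -[X in _ --> X -> _]fineK ?fin_num_measure// => /fine_cvg.
have -> : freq x A = mean (fun i => \1_A (x i)).
  by apply/funext => n; rewrite freqE.
exact.
Qed.

Lemma iid_es_dom : {ae m, forall x : seqspace R, es_dom x /\ directs x P}.
Proof.
have ae_rat : {ae m, forall x : seqspace R, forall q : rat,
    freq x (ray (ratr q)) n @[n --> \oo] --> fine (P (ray (ratr q)))}.
  by apply: ae_forall_countable => q; exact: iid_freq.
have ae_ray : {ae m, forall x : seqspace R, forall k i : nat,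
    freq x (ray (quantile P (i%:R / k%:R))) n @[n --> \oo] -->
    fine (P (ray (quantile P (i%:R / k%:R))))}.
  by apply: ae_foralln => k; apply: ae_foralln => i; exact: iid_freq.
have ae_oray : {ae m, forall x : seqspace R, forall k i : nat,
    freq x (oray (quantile P (i%:R / k%:R))) n @[n --> \oo] -->
    fine (P (oray (quantile P (i%:R / k%:R))))}.
  by apply: ae_foralln => k; apply: ae_foralln => i; exact: iid_freq.
move: ae_rat ae_ray ae_oray; apply: filterS3 => x xrat xray xoray.
have dirx : directs x P.
  move=> q; exists (fine (P (ray (ratr q)))); split; first exact: xrat.
    rewrite fineK ?fin_num_measure//.
    by apply: le_measure; rewrite ?inE//; apply: subset_itvl; rewrite bnd_simp.
  by rewrite fineK ?fin_num_measure.
(* the bound of [uniform_of_quantiles] is twice [k^-1] *)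
split=> //; apply/es_domP => K; pose k := (K.+1 * 2)%N.
have k0 : 0 < k%:R^-1 :> R by rewrite invr_gt0 ltr0n.
have near_all (u : nat -> nat -> R) (l : nat -> R) :
    (forall i, u i n @[n --> \oo] --> l i) ->
    \forall n \near \oo, forall i, (i < k)%N -> `|u i n - l i| <= k%:R^-1.
  move=> ul; suff : forall j, \forall n \near \oo, forall i, (i < j)%N ->
      `|u i n - l i| <= k%:R^-1 by exact.
  elim=> [|j IH]; first exact: nearW.
  have /cvgrPdist_le/(_ _ k0) := ul j.
  move: IH; apply: filterS2 => n h hj i; rewrite ltnS leq_eqVlt.
  by move=> /orP[/eqP ->|/h]; [rewrite distrC; exact: hj|].
have [N _ hN] : \forall n \near \oo,
    (forall i, (i < k)%N -> `|freq x (ray (quantile P (i%:R / k%:R))) n -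
       fine (P (ray (quantile P (i%:R / k%:R))))| <= k%:R^-1) /\
    (forall i, (i < k)%N -> `|freq x (oray (quantile P (i%:R / k%:R))) n -
       fine (P (oray (quantile P (i%:R / k%:R))))| <= k%:R^-1).
  have n1 := near_all _ _ (xray k); have n2 := near_all _ _ (xoray k).
  by apply: filterS2 n1 n2 => n.
exists N => n Nn q; have [h1 h2] := hN n Nn.
rewrite (cdf_limitE (xrat q)).
have -> : K.+1%:R^-1 = k%:R^-1 + k%:R^-1 :> R.
  by rewrite /k natrM invfM -[RHS]mulr2n -[RHS]mulr_natr -mulrA mulVf ?mulr1.
apply: uniform_of_quantiles; first by rewrite /k; lia.
  by move=> i /andP[_ ik]; exact: h1.
by move=> i /andP[_ ik]; exact: h2.
Qed.

End glivenko_cantelli.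

Lemma probability_ae1 d (T : measurableType d) (R : realType)
    (P : probability T R) A : measurable A -> {ae P, forall x, A x} -> P A = 1%E.
Proof.
move=> mA [N [mN PN AN]].
have : P (~` A) = 0%E.
  apply/eqP; rewrite -measure_le0 -PN; apply: le_measure; rewrite ?inE//.
  exact: measurableC.
move=> PCA; rewrite -[A]setCK probability_setC; last exact: measurableC.
by rewrite PCA sube0.
Qed.

Section iid_means.
Context (R : realType) (P : probability R R) (m : probability (seqspace R) R).
Hypothesis mP : is_infinite_product P m.

(** The law of large numbers is applied to nonnegative functions only: to [|y|],
    whose integral may be infinite, and, when it is finite, to the positive and
    negative parts of [y]. *)
Lemma iid_es_real_bar :
  {ae m, forall x : seqspace R, pdom (es_real_bar R) x /\ directs x P}.
Proof.
have mabs : measurable_fun setT (fun y : R => `|y|) by exact: normr_measurable.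
have mpos : measurable_fun setT (fun y : R => Num.max y 0) by exact: measurable_maxr.
have mneg : measurable_fun setT (fun y : R => Num.max (- y) 0).
  by apply: measurable_maxr => //; exact: oppr_measurable.
have abs_ae := strong_law mP mabs (@normr_ge0 _ _).
have pos_ae := strong_law mP mpos (fun y => ltac:(by rewrite le_max lexx orbT)).
have neg_ae := strong_law mP mneg (fun y => ltac:(by rewrite le_max lexx orbT)).
have dom_ae := iid_es_dom mP.
have : {ae m, forall x : seqspace R, [/\ es_dom x /\ directs x P,
    (mean (fun i => `|x i|) n)%:E @[n --> \oo] --> (\int[P]_y `|y|%:E)%E,
    (mean (fun i => Num.max (x i) 0) n)%:E @[n --> \oo] -->
      (\int[P]_y (Num.max y 0)%:E)%E
  & (mean (fun i => Num.max (- x i) 0) n)%:E @[n --> \oo] -->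
      (\int[P]_y (Num.max (- y) 0)%:E)%E]}.
  move: dom_ae; apply: filterS2 (filterI abs_ae (filterI pos_ae neg_ae)) => x.
  by move=> [? [? ?]] ?; split.
apply: filterS => x [[xdom xP] xabs xpos xneg]; split => //.
have intE (f : R -> \bar R) : (\int[pker (es_real R) x]_y f y = \int[P]_y f y)%E.
  rewrite es_integral_directing//; apply: eq_measure_integral => A mA _.
  by apply: (directs_unique _ xP mA); apply: directing_directs; exists P.
rewrite es_real_bar_domE; split => //.
  by rewrite /abs_mean_condition intE.
rewrite intE => absy; rewrite /mean_condition /Rintegral intE.
have fin (h : R -> R) : measurable_fun setT h -> (forall y, 0 <= h y <= `|y|) ->
    (\int[P]_y (h y)%:E)%E \is a fin_num.
  move=> mh h0; rewrite ge0_fin_numE; last first.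
    by apply: integral_ge0 => y _; rewrite lee_fin; case/andP: (h0 y).
  apply: le_lt_trans absy; apply: ge0_le_integral => //.
  - by move=> y _; rewrite lee_fin; case/andP: (h0 y).
  - exact/measurable_EFinP.
  - exact/measurable_EFinP.
  - by move=> y _; rewrite lee_fin; case/andP: (h0 y).
have fpos : (\int[P]_y (Num.max y 0)%:E)%E \is a fin_num.
  by apply: fin => // y; rewrite le_max lexx orbT ge_max ler_norm normr_ge0.
have fneg : (\int[P]_y (Num.max (- y) 0)%:E)%E \is a fin_num.
  by apply: fin => // y; rewrite le_max lexx orbT ge_max ler_normr lexx orbT normr_ge0.
have -> : (\int[P]_y y%:E = \int[P]_y (Num.max y 0)%:E -
                            \int[P]_y (Num.max (- y) 0)%:E)%E.
  rewrite integralE; congr (_ - _)%E; apply: eq_integral => y _.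
    by rewrite funeposE -EFin_max.
  by rewrite funenegE -EFinN -EFin_max.
rewrite -(fineK fpos) in xpos; rewrite -(fineK fneg) in xneg.
rewrite -(fineK fpos) -(fineK fneg) -EFinB /=.
have -> : mean x = (fun n => mean (fun i => Num.max (x i) 0) n -
                            mean (fun i => Num.max (- x i) 0) n).
  apply/funext => n; rewrite /mean -mulrBl -sumrB; congr (_ / _).
  apply: eq_bigr => i _; case: (leP 0 (x i)) => xi.
    by rewrite [X in _ - X]max_r ?oppr_le0// subr0.
  by rewrite max_l ?oppr_ge0 ?ltW// sub0r opprK.
by apply: cvgB; [move/fine_cvg: xpos|move/fine_cvg: xneg].
Qed.

Lemma product_es_real_bar_dom : m (pdom (es_real_bar R)) = 1%E.
Proof.
apply: probability_ae1; first exact: measurable_es_real_bar_dom.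
by move: iid_es_real_bar; apply: filterS => x [].
Qed.

End iid_means.

Lemma standard_borel_real (R : realType) : standard_borel R R.
Proof.
exists (R^o : metricType R), idfun; split.
- by move=> F FF Fc; exists (lim F); exact: cauchy_cvg.
- exists (range (@ratr R)); last exact: dense_rat.
  by apply: (sub_countable (card_image_le _ _)); exact: countableP.
- by exists idfun.
- move=> B; rewrite preimage_id; split => [|mB].
    move: B; apply: smallest_sub; first exact: sigma_algebra_measurable.
    exact: open_measurable.
  move: B mB; rewrite [X in forall B, X B -> _]RGenOInfty.measurableE.
  apply: smallest_sub; first exact: smallest_sigma_algebra.
  by move=> _ [t ->]; apply: sub_sigma_algebra; exact: interval_open.
Qed.

(** * Exchangeable sequences *)

Lemma bounded_convergence d (T : measurableType d) (R : realType)
    (mu : probability T R) (g_ : nat -> T -> R) (g : T -> R) :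
  (forall n, measurable_fun setT (g_ n)) -> measurable_fun setT g ->
  (forall n x, 0 <= g_ n x <= 1) ->
  {ae mu, forall x, g_ n x @[n --> \oo] --> g x} ->
  (\int[mu]_x (g_ n x)%:E @[n --> \oo] --> \int[mu]_x (g x)%:E)%E.
Proof.
move=> mg_ mg g01 gcvg.
have [] // := @dominated_convergence _ _ _ mu _ measurableT
  (fun n => EFin \o g_ n) (EFin \o g) (cst 1%E).
- by move=> n; exact/measurable_EFinP.
- exact/measurable_EFinP.
- apply: filterS gcvg => x gx _; apply: cvg_EFin => //; exact: nearW.
- exact: finite_measure_integrable_cst.
- apply: aeW => x n _ /=; have /andP[g0 g1] := g01 n x.
  by rewrite ger0_norm// lee_fin.
Qed.

Definition swap (m j i : nat) : nat :=
  if i == m then j else if i == j then m else i.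

Lemma swap_finite m j : finite_permutation (swap m j).
Proof.
split.
  exists (swap m j) => i; rewrite /swap.
    case: (i =P m) => [->|im]; first by case: (j =P m) => [->//|_]; rewrite eqxx.
    by case: (i =P j) => [->|ij]; [rewrite eqxx|case: (i =P m) => //; case: (i =P j)].
  case: (i =P m) => [->|im]; first by case: (j =P m) => [->//|_]; rewrite eqxx.
  by case: (i =P j) => [->|ij]; [rewrite eqxx|case: (i =P m) => //; case: (i =P j)].
apply: (sub_finite_set (B := [set m; j])); last exact: finite_set2.
move=> i /=; rewrite /swap.
by case: (i =P m) => [->|_]; [left|case: (i =P j) => [->|//]; right].
Qed.

(** The cycle [0 -> 1 -> ... -> n -> 0]. *)
Definition rotate (n i : nat) : nat :=
  if (i < n)%N then i.+1 else if i == n then 0%N else i.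

Lemma rotate_finite n : finite_permutation (rotate n).
Proof.
split.
  exists (fun i => if i == 0%N then n else if (i <= n)%N then i.-1 else i) => i.
    rewrite /rotate; case: (ltnP i n) => [in'|ni]; first by rewrite /= in'.
    case: (i =P n) => [->//|/eqP iN].
    have ni' : (n < i)%N by rewrite ltn_neqAle eq_sym iN.
    by rewrite leqNgt ni' gtn_eqF// (leq_ltn_trans _ ni').
  rewrite /rotate; case: (i =P 0%N) => [->|/eqP i0]; first by rewrite ltnn eqxx.
  case: (leqP i n) => [in'|ni].
    by rewrite prednK ?lt0n// in'.
  by rewrite ltnNge (ltnW ni)/= gtn_eqF.
apply: (sub_finite_set (B := `I_n.+1)); last exact: finite_II.
move=> i /=; rewrite /rotate.
case: (ltnP i n) => [in' _|ni]; first exact: ltnW.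
by case: (i =P n) => [->|//].
Qed.

Section exchangeable.
Context (R : realType) d (Y : measurableType d).
Variable mu : probability (seqspace R * Y)%type R.

Definition permute_fst (s : nat -> nat) (p : seqspace R * Y) : seqspace R * Y :=
  ((fun i => p.1 (s i)) : seqspace R, p.2).

Definition shift_fst (p : seqspace R * Y) : seqspace R * Y := (shift p.1, p.2).

Lemma measurable_coord_fst i :
  measurable_fun setT (fun p : seqspace R * Y => p.1 i : R).
Proof. exact: (measurableT_comp (measurable_coord i) measurable_fst). Qed.

Lemma measurable_permute_fst s : measurable_fun setT (permute_fst s).
Proof.
apply: measurable_fun_pair => //.
by apply: measurable_seqspace => i; exact: measurable_coord_fst.
Qed.

Lemma measurable_shift_fst : measurable_fun setT shift_fst.
Proof.
apply: measurable_fun_pair => //.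
exact: (measurableT_comp (@measurable_shift _ R) measurable_fst).
Qed.

Hypothesis mu_exch : forall s, finite_permutation s ->
  forall S, measurable S -> mu (permute_fst s @^-1` S) = mu S.

(** On events depending on the first [n] coordinates the shift acts as the
    cycle [rotate n]. *)
Lemma exchangeable_shift S : measurable S -> mu (shift_fst @^-1` S) = mu S.
Proof.
rewrite -(image_probE mu measurable_shift_fst).
apply: seqspaceX_unique => n A C mA mC.
change (mu (shift_fst @^-1` (cylinder n A `*` C)) = mu (cylinder n A `*` C)).
have mAC : measurable (cylinder n A `*` C).
  by apply: measurableX; [exact: measurable_cylinder|exact: mC].
rewrite -(mu_exch (rotate_finite n) mAC).
congr (mu _); apply/seteqP; split => -[x y] /= [h Cy]; split => // i im.
  by have := h i im; rewrite /rotate im.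
by have := h i im; rewrite /= /rotate im.
Qed.

(** Frequencies are the ergodic averages of an indicator of the first
    coordinate. *)
Lemma exchangeable_freq_cvg A : measurable A ->
  {ae mu, forall p : seqspace R * Y, cvgn (freq p.1 A)}.
Proof.
move=> mA; pose f (p : seqspace R * Y) : R := \1_A (p.1 0%N).
have mf : measurable_fun setT f.
  apply: (measurableT_comp (measurable_indic mA)); exact: measurable_coord_fst.
have f01 p : 0 <= f p <= 1.
  by rewrite /f indicE; case: (_ \in _); rewrite lexx ler01.
have iterE n p i : (iter n shift_fst p).1 i = p.1 (n + i)%N.
  by elim: n i => //= n IH i; rewrite /shift IH addnS addSn.
have := birkhoff_cvg measurable_shift_fst exchangeable_shift mf f01.
apply: filterS => p; rewrite (_ : freq p.1 A = (fun n => birkhoff_sum shift_fst f n p / n%:R))//.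
apply/funext => n; rewrite freqE /mean /birkhoff_sum; congr (_ / _).
by apply: eq_bigr => i _; rewrite /f iterE addn0.
Qed.

Lemma exchangeable_integral (g : seqspace R * Y -> R) s : finite_permutation s ->
  measurable_fun setT g -> (forall p, 0 <= g p) ->
  (\int[mu]_p (g (permute_fst s p))%:E = \int[mu]_p (g p)%:E)%E.
Proof.
move=> sf mg g0.
apply: (ge0_integral_preserving (measurable_permute_fst s) (mu_exch sf)
  (g := EFin \o g)).
- exact/measurable_EFinP.
- by move=> p; rewrite lee_fin.
Qed.

(** An exchangeable coordinate is replaced by the limiting frequency: the
    integral of [Z * 1_A(x_j)] does not depend on [j >= m], so it equals the
    limit of its Cesaro means, the integral of [Z] times the frequency. *)
Lemma replace_coord (Z L : seqspace R * Y -> R) (m : nat) A : measurable A ->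
  measurable_fun setT Z -> (forall p, 0 <= Z p <= 1) ->
  (forall j p, (m <= j)%N -> Z (permute_fst (swap m j) p) = Z p) ->
  measurable_fun setT L ->
  {ae mu, forall p : seqspace R * Y, freq p.1 A n @[n --> \oo] --> L p} ->
  (\int[mu]_p (Z p * \1_A (p.1 m))%:E = \int[mu]_p (Z p * L p)%:E)%E.
Proof.
move=> mA mZ Z01 ZI mL Lae.
have Z0 p : 0 <= Z p by case/andP: (Z01 p).
have Z1 p : Z p <= 1 by case/andP: (Z01 p).
have m1A i : measurable_fun setT (fun p : seqspace R * Y => \1_A (p.1 i) : R).
  apply: (measurableT_comp (measurable_indic mA)); exact: measurable_coord_fst.
have mZA i : measurable_fun setT (fun p : seqspace R * Y => Z p * \1_A (p.1 i)).
  exact: measurable_funM.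
have ind1 y : \1_A y <= 1 :> R.
  by rewrite indicE; case: (_ \in _); rewrite ?lexx ?ler01.
have ZA0 i p : 0 <= Z p * \1_A (p.1 i) by rewrite mulr_ge0.
pose a i := (\int[mu]_p (Z p * \1_A (p.1 i))%:E)%E.
have aE j : (m <= j)%N -> a j = a m.
  move=> mj; rewrite /a -[LHS](exchangeable_integral (swap_finite m j))//.
  apply: eq_integral => p _; rewrite ZI//= /swap eqxx.
  by case: (j =P m) => [->|].
have afin i : a i \is a fin_num.
  rewrite ge0_fin_numE; last by apply: integral_ge0 => p _; rewrite lee_fin.
  apply: integral_le1_lty => // p; apply/andP; split; first exact: ZA0.
  exact: mulr_ile1.
have ces : arithmetic_mean (fun i => fine (a i)) @ \oo --> fine (a m).
  apply: cesaro; apply: cvg_near_cst; exists m => // j /= mj.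
  by rewrite aE.
have meanE n : (\int[mu]_p (Z p * freq p.1 A n.+1)%:E =
    (arithmetic_mean (fun i => fine (a i)) n)%:E)%E.
  rewrite /arithmetic_mean /= EFinM seriesEord -sumEFin.
  under [in RHS]eq_bigr do rewrite fineK//.
  rewrite -ge0_integral_sum//; last 2 first.
  - by move=> i; exact/measurable_EFinP.
  - by move=> i p _; rewrite lee_fin.
  rewrite -ge0_integralZl//; last 2 first.
  - by apply: emeasurable_sum => i; exact/measurable_EFinP.
  - by move=> p _; apply: sume_ge0 => i _; rewrite lee_fin.
  apply: eq_integral => p _.
  rewrite sumEFin -EFinM; congr EFin; rewrite freqE /mean -mulr_sumr.
  by rewrite [RHS]mulrCA [in RHS](mulrC n.+1%:R^-1).
have cvgL : (\int[mu]_p (Z p * freq p.1 A n.+1)%:E @[n --> \oo] -->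
    \int[mu]_p (Z p * L p)%:E)%E.
  apply: (@bounded_convergence _ _ _ mu (fun n p => Z p * freq p.1 A n.+1)).
  - move=> n; apply: measurable_funM => //.
    exact: (measurableT_comp (measurable_freq n.+1 mA) measurable_fst).
  - exact: measurable_funM.
  - by move=> n p; rewrite mulr_ge0 ?freq_ge0//= mulr_ile1 ?freq_ge0 ?freq_le1.
  - apply: filterS Lae => p Lp; apply: cvgM; first exact: cvg_cst.
    by rewrite (cvg_shiftS (freq p.1 A)).
have cvga : (\int[mu]_p (Z p * freq p.1 A n.+1)%:E @[n --> \oo] --> a m)%E.
  rewrite -(fineK (afin m)) (_ : (fun n => _) =
    EFin \o arithmetic_mean (fun i => fine (a i))); last exact/funext.
  by apply: cvg_EFin => //; exact: nearW.
exact: (cvg_unique _ cvga cvgL).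
Qed.

End exchangeable.

Lemma cdf_limit01 (R : realType) (x : seqspace R) q : 0 <= cdf_limit q x <= 1.
Proof.
rewrite /cdf_limit limn_esup_lim.
set u := fun n => (freq x _ n)%:E.
have u0 n : (0 <= u n)%E by rewrite lee_fin freq_ge0.
have u1 n : (u n <= 1)%E by rewrite lee_fin freq_le1.
have e0 : (0 <= limn (esups u))%E.
  apply: lime_ge; first exact: is_cvg_esups.
  by apply: nearW => n; apply: ereal_sup_ge; exists (u n) => //; exists n => /=.
have e1 : (limn (esups u) <= 1)%E.
  apply: lime_le; first exact: is_cvg_esups.
  by apply: nearW => n; apply: ge_ereal_sup => _ [k _ <-].
by move: e0 e1; case: (limn _) => //= r; rewrite !lee_fin => -> ->.
Qed.

(** On the set where every [g k] is at least [e], all the integrals are at least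
    [e] times its measure, so this set is null. *)
Lemma ae_exists_lt d (T : measurableType d) (R : realType)
    (mu : probability T R) (g : nat -> T -> R) (e : R) :
  (forall k, measurable_fun setT (g k)) -> (forall k x, 0 <= g k x) ->
  (\int[mu]_x (g k x)%:E @[k --> \oo] --> 0)%E -> 0 < e ->
  {ae mu, forall x, exists k, g k x < e}.
Proof.
move=> mg g0 gcvg e0.
pose B := \bigcap_(k : nat) [set x | e <= g k x].
have mBk k : measurable [set x | e <= g k x].
  by rewrite -[X in measurable X]setTI; exact: measurable_fun_ler.
have mB : measurable B by exact: bigcapT_measurable.
exists B; split=> //; last first.
  move=> x /= h k _ /=; rewrite leNgt; apply/negP => hk; apply: h.
  by exists k.
have eB : (e%:E * mu B <= 0)%E.
  apply: (cvge_ge _ gcvg); apply: nearW => k.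
  apply: (@le_trans _ _ (\int[mu]_(x in B) (g k x)%:E)%E).
    rewrite -integral_cst//; apply: ge0_le_integral => //.
    - by move=> x _; rewrite lee_fin ltW.
    - exact/measurable_EFinP/measurable_funTS.
    - by move=> x /(_ k I) /=; rewrite lee_fin.
  apply: ge0_subset_integral => //; first exact/measurable_EFinP.
  by move=> x _; rewrite lee_fin.
apply/eqP; rewrite -measure_le0.
by move: eB; rewrite pmule_rle0// lte_fin.
Qed.

Section de_finetti.
Context (R : realType) d (Y : measurableType d).
Variable mu : probability (seqspace R * Y)%type R.
Hypothesis mu_exch : forall s, finite_permutation s ->
  forall S, measurable S -> mu (permute_fst s @^-1` S) = mu S.

Local Notation ray t := (`]-oo, t]%classic : set R).

Let measurable_cdf q :
  measurable_fun setT (fun p : seqspace R * Y => cdf_limit q p.1).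
Proof. exact: (measurableT_comp (measurable_cdf_limit q) measurable_fst). Qed.

Lemma exchangeable_cdf_limit q : {ae mu, forall p : seqspace R * Y,
  freq p.1 (ray (ratr q)) n @[n --> \oo] --> cdf_limit q p.1}.
Proof.
have mray : measurable (ray (ratr q)) by [].
apply: filterS (exchangeable_freq_cvg mu_exch mray) => p /cvg_ex[l pl].
by rewrite (cdf_limitE pl).
Qed.

Lemma integral_cdf_limit q :
  (\int[mu]_p (cdf_limit q p.1)%:E =
   mu ((fun p : seqspace R * Y => p.1 0%N) @^-1` ray (ratr q)))%E.
Proof.
have mray : measurable (ray (ratr q)) by [].
have := @replace_coord _ _ _ mu mu_exch (cst 1) (fun p => cdf_limit q p.1) 0%N _ mray.
move=> /(_ (measurable_cst _)) /=.
move=> /(_ (fun=> ltac:(by rewrite ler01 lexx)) (fun _ _ _ => erefl)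
  (measurable_cdf q) (exchangeable_cdf_limit q)).
under eq_integral do rewrite mul1r.
under [in X in _ = X -> _]eq_integral do rewrite mul1r.
move=> <-; rewrite integral_indic ?setIT//.
by rewrite -[X in measurable X]setTI; exact: (measurable_coord_fst 0).
Qed.

Let law0 : probability R R := image_prob mu (@measurable_coord_fst R _ Y 0).

Let law0E q : (\int[mu]_p (cdf_limit q p.1)%:E = law0 (ray (ratr q)))%E.
Proof. exact: integral_cdf_limit. Qed.

(** The integral of [cdf_limit q] is the distribution function of the first
    coordinate, which tends to [1] and to [0] at infinity. *)
Lemma exchangeable_tight : {ae mu, forall p : seqspace R * Y,
  (forall e, 0 < e -> exists q, 1 - e < cdf_limit q p.1) /\
  (forall e, 0 < e -> exists q, cdf_limit q p.1 < e)}.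
Proof.
have c0 q (p : seqspace R * Y) : 0 <= cdf_limit q p.1.
  by case/andP: (cdf_limit01 p.1 q).
have c1 q (p : seqspace R * Y) : 0 <= 1 - cdf_limit q p.1.
  by rewrite subr_ge0; case/andP: (cdf_limit01 p.1 q).
have mc1 q : measurable_fun setT (fun p : seqspace R * Y => 1 - cdf_limit q p.1).
  exact: measurable_funB.
have int1 q : (\int[mu]_p (1 - cdf_limit q p.1)%:E = 1 - law0 (ray (ratr q)))%E.
  have tot : (\int[mu]_p (1 - cdf_limit q p.1)%:E + law0 (ray (ratr q)) = 1)%E.
    rewrite -law0E -ge0_integralD//; last 4 first.
    - by move=> p _; rewrite lee_fin.
    - exact/measurable_EFinP.
    - by move=> p _; rewrite lee_fin.
    - exact/measurable_EFinP.
    under eq_integral do rewrite -EFinD subrK.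
    by rewrite integral_cst//= probability_setT mule1.
  by rewrite -tot addeK// fin_num_measure.
have right : {ae mu, forall p : seqspace R * Y, forall j : nat, exists k : nat,
    1 - cdf_limit k%:R p.1 < j.+1%:R^-1}.
  apply: ae_foralln => j.
  apply: (@ae_exists_lt _ _ _ mu (fun k p => 1 - cdf_limit k%:R p.1)) => //.
  rewrite (_ : (fun k : nat => _) = (fun k : nat => 1 - law0 (ray k%:R))%E); last first.
    by apply/funext => k; rewrite int1 ratr_nat.
  rewrite -[X in _ --> X](@subee _ 1%E)//; apply: cvgeB => //.
  - exact: cvg_cst.
  - exact: cvg_cdf_pinfty.
have left : {ae mu, forall p : seqspace R * Y, forall j : nat, exists k : nat,
    cdf_limit (- k%:R) p.1 < j.+1%:R^-1}.
  apply: ae_foralln => j.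
  apply: (@ae_exists_lt _ _ _ mu (fun k p => cdf_limit (- k%:R) p.1)) => //.
  rewrite (_ : (fun k : nat => _) = (fun k : nat => law0 (ray (- k%:R)))); last first.
    by apply/funext => k; rewrite law0E rmorphN/= ratr_nat.
  exact: cvg_cdf_ninfty.
apply: filterS2 right left => p pr pl.
have small (e : R) : 0 < e -> exists j : nat, j.+1%:R^-1 < e.
  by move=> /ltr_add_invr[j]; rewrite add0r => je; exists j.
split=> e /small[j je].
  have [k hk] := pr j; exists k%:R; move: (lt_trans hk je); lra.
by have [k hk] := pl j; exists (- k%:R); exact: lt_trans je.
Qed.

Lemma exchangeable_directable :
  {ae mu, forall p : seqspace R * Y, directable p.1}.
Proof.
have cvg_all : {ae mu, forall p : seqspace R * Y, forall q : rat,
    freq p.1 (ray (ratr q)) n @[n --> \oo] --> cdf_limit q p.1}.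
  by apply: ae_forall_countable => q; exact: exchangeable_cdf_limit.
apply: filterS2 cvg_all exchangeable_tight => p pc [p1 p0].
exact: (directs_exists pc p1 p0).
Qed.

End de_finetti.

Section de_finetti_product.
Context (R : realType) d (Y : measurableType d).
Variable mu : probability (seqspace R * Y)%type R.
Hypothesis mu_exch : forall s, finite_permutation s ->
  forall S, measurable S -> mu (permute_fst s @^-1` S) = mu S.

Local Notation ray t := (`]-oo, t]%classic : set R).

Definition directing_mass (B : set R) (p : seqspace R * Y) : R :=
  fine (directing p.1 B).

Lemma directing_massE B p : measurable B ->
  directing p.1 B = (directing_mass B p)%:E.
Proof. by move=> mB; rewrite fineK ?fin_num_measure. Qed.

Lemma directing_mass01 B p : measurable B -> 0 <= directing_mass B p <= 1.
Proof.
move=> mB; rewrite -!lee_fin -directing_massE// measure_ge0/=.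
exact: probability_le1.
Qed.

Lemma measurable_directing_mass B : measurable B ->
  measurable_fun setT (directing_mass B).
Proof.
move=> mB; apply: measurableT_comp; first exact: fine_measurable.
exact: (measurableT_comp (measurable_directing mB) measurable_fst).
Qed.

Section replace.
Variables (Z : seqspace R * Y -> R) (m : nat).
Hypothesis mZ : measurable_fun setT Z.
Hypothesis Z01 : forall p, 0 <= Z p <= 1.
Hypothesis ZI : forall j p, (m <= j)%N -> Z (permute_fst (swap m j) p) = Z p.

Let Z0 p : 0 <= Z p. Proof. by case/andP: (Z01 p). Qed.
Let Z1 p : Z p <= 1. Proof. by case/andP: (Z01 p). Qed.

Let ind01 (B : set R) y : 0 <= (\1_B y : R) <= 1.
Proof. by rewrite indicE; case: (_ \in _); rewrite ?lexx ?ler01. Qed.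

Let measurable_ind_coord B : measurable B ->
  measurable_fun setT (fun p : seqspace R * Y => \1_B (p.1 m) : R).
Proof.
move=> mB; apply: (measurableT_comp (measurable_indic mB)).
exact: measurable_coord_fst.
Qed.

Let replace_ray t :
  (\int[mu]_p (Z p * \1_(ray t) (p.1 m))%:E =
   \int[mu]_p (Z p * directing_mass (ray t) p)%:E)%E.
Proof.
have qP (k : nat) : {q : rat | t < ratr q < t + k.+1%:R^-1}.
  apply: cid; have [q] := @rat_in_itvoo R t (t + k.+1%:R^-1) ltac:(by rewrite ltrDl invr_gt0).
  by rewrite in_itv/= => qi; exists q.
pose q k := sval (qP k).
have tq k : t < ratr (q k) < t + k.+1%:R^-1 by exact: (svalP (qP k)).
have mray s : measurable (ray s) by [].
have mcdf r : measurable_fun setT (fun p : seqspace R * Y => cdf_limit r p.1).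
  exact: (measurableT_comp (measurable_cdf_limit r) measurable_fst).
have E k : (\int[mu]_p (Z p * \1_(ray (ratr (q k))) (p.1 m))%:E =
    \int[mu]_p (Z p * cdf_limit (q k) p.1)%:E)%E.
  by apply: replace_coord => //; exact: exchangeable_cdf_limit.
have cvgl : (\int[mu]_p (Z p * \1_(ray (ratr (q k))) (p.1 m))%:E @[k --> \oo] -->
    \int[mu]_p (Z p * \1_(ray t) (p.1 m))%:E)%E.
  apply: (@bounded_convergence _ _ _ mu
    (fun k p => Z p * \1_(ray (ratr (q k))) (p.1 m))).
  - by move=> k; apply: measurable_funM => //; exact: measurable_ind_coord.
  - by apply: measurable_funM => //; exact: measurable_ind_coord.
  - move=> k p; have /andP[i0 i1] := ind01 (ray (ratr (q k))) (p.1 m).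
    by rewrite mulr_ge0//= mulr_ile1.
  - apply: aeW => p; apply: cvgM; first exact: cvg_cst.
    apply: cvg_near_cst; have [xt|tx] := leP (p.1 m) t.
      apply: nearW => k; have /andP[tqk _] := tq k.
      by rewrite !indicE !mem_set//= in_itv/= ?xt// (le_trans xt)// ltW.
    have [N hN] := ltr_add_invr tx.
    exists N => // k /= Nk; have /andP[_ qkt] := tq k.
    rewrite !indicE !memNset//= in_itv/=; apply/negP; rewrite -ltNge//.
    apply: (lt_trans qkt); apply: le_lt_trans hN.
    by rewrite lerD2l lef_pV2 ?posrE// ler_nat.
have cvgr : (\int[mu]_p (Z p * cdf_limit (q k) p.1)%:E @[k --> \oo] -->
    \int[mu]_p (Z p * directing_mass (ray t) p)%:E)%E.
  apply: (@bounded_convergence _ _ _ mu (fun k p => Z p * cdf_limit (q k) p.1)).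
  - by move=> k; exact: measurable_funM.
  - by apply: measurable_funM => //; exact: measurable_directing_mass.
  - move=> k p; have /andP[i0 i1] := cdf_limit01 p.1 (q k).
    by rewrite mulr_ge0//= mulr_ile1.
  - apply: filterS (exchangeable_directable mu_exch) => p pd.
    apply: cvgM; first exact: cvg_cst.
    have := cvg_cdf_limit_right (directing_directs pd) tq.
    by rewrite directing_massE// => /fine_cvg.
have EE : (fun k => \int[mu]_p (Z p * \1_(ray (ratr (q k))) (p.1 m))%:E)%E =
    (fun k => \int[mu]_p (Z p * cdf_limit (q k) p.1)%:E)%E.
  by apply/funext => k; exact: E.
rewrite EE in cvgl; exact: (cvg_unique _ cvgl cvgr).
Qed.

(** The passage from rational rays, where the frequencies converge to
    [cdf_limit], to real rays is by limits from the right; a monotone class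
    argument extends it to Borel sets. *)
Lemma replace_directing B : measurable B ->
  (\int[mu]_p (Z p * \1_B (p.1 m))%:E =
   \int[mu]_p (Z p * directing_mass B p)%:E)%E.
Proof.
have mI A : measurable A ->
    measurable_fun setT (fun p : seqspace R * Y => (Z p * \1_A (p.1 m))%:E).
  move=> mA; apply/measurable_EFinP; apply: measurable_funM => //.
  exact: measurable_ind_coord.
have mD A : measurable A ->
    measurable_fun setT (fun p : seqspace R * Y => (Z p * directing_mass A p)%:E).
  move=> mA; apply/measurable_EFinP; apply: measurable_funM => //.
  exact: measurable_directing_mass.
have I0 A p : (0 <= (Z p * \1_A (p.1 m))%:E)%E.
  by rewrite lee_fin mulr_ge0//; case/andP: (ind01 A (p.1 m)).
have D0 A p : measurable A -> (0 <= (Z p * directing_mass A p)%:E)%E.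
  by move=> mA; rewrite lee_fin mulr_ge0//; case/andP: (directing_mass01 p mA).
have Zfin : (\int[mu]_p (Z p)%:E)%E \is a fin_num.
  rewrite ge0_fin_numE; last by apply: integral_ge0 => p _; rewrite lee_fin.
  exact: integral_le1_lty.
rewrite [in X in X -> _](@real_rays_generate R); move: B.
apply: (@dynkin_induction _ _ _ (fun B => (\int[mu]_p (Z p * \1_B (p.1 m))%:E =
   \int[mu]_p (Z p * directing_mass B p)%:E)%E)
   (@real_rays_generate R) (@real_rays_setI R)).
- apply: eq_integral => p _; rewrite indicT /directing_mass probability_setT.
  by [].
- by move=> _ [t _ <-]; exact: replace_ray.
- move=> B mB h.
  have mCB := measurableC mB.
  have eqI : (\int[mu]_p (Z p * \1_B (p.1 m))%:E +
      \int[mu]_p (Z p * \1_(~` B) (p.1 m))%:E = \int[mu]_p (Z p)%:E)%E.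
    rewrite -ge0_integralD//; [|exact: mI..].
    apply: eq_integral => p _; rewrite -EFinD -mulrDr !indicE in_setC.
    by case: (_ \in _); rewrite ?addr0 ?add0r mulr1.
  have eqD : (\int[mu]_p (Z p * directing_mass B p)%:E +
      \int[mu]_p (Z p * directing_mass (~` B) p)%:E = \int[mu]_p (Z p)%:E)%E.
    rewrite -ge0_integralD//; [|by move=> p _; exact: D0|exact: mD|
      by move=> p _; exact: D0|exact: mD].
    apply: eq_integral => p _; rewrite -EFinD -mulrDr; congr EFin.
    rewrite (_ : directing_mass (~` B) p = 1 - directing_mass B p).
      by rewrite addrC subrK mulr1.
    by apply/EFin_inj; rewrite EFinB -!directing_massE// probability_setC.
  have Bfin : (\int[mu]_p (Z p * \1_B (p.1 m))%:E)%E \is a fin_num.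
    rewrite ge0_fin_numE; last by apply: integral_ge0 => p _; exact: I0.
    apply: integral_le1_lty; first by apply/measurable_EFinP; exact: mI.
    move=> p; have /andP[i0 i1] := ind01 B (p.1 m).
    by rewrite mulr_ge0//= mulr_ile1.
  move: eqD; rewrite -eqI -h addeC [in RHS]addeC => eqDI.
  by rewrite -[LHS](addeK _ Bfin) -eqDI addeK.
- move=> F mF tF h.
  have mU : measurable (\bigcup_k F k) by exact: bigcupT_measurable.
  transitivity (\sum_(k <oo) \int[mu]_p (Z p * \1_(F k) (p.1 m))%:E)%E.
    rewrite -integral_nneseries//; last by move=> k; exact: mI.
    apply: eq_integral => p _.
    under eq_eseriesr do rewrite EFinM.
    rewrite nneseriesZl// EFinM; congr (_ * _)%E.
    have := @measure_bigcup _ _ _ (\d_(p.1 m) : {measure set R -> \bar R}) setT F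
      (fun k _ => mF k) tF.
    rewrite -[LHS]/((\1_(\bigcup_k F k) (p.1 m))%:E) => ->.
    by apply: eq_eseriesl => k; rewrite in_setT.
  rewrite (eq_eseriesr (fun k _ => h k)) -integral_nneseries//; last 2 first.
  + by move=> k; exact: mD.
  + by move=> k p _; exact: D0.
  apply: eq_integral => p _.
  under eq_eseriesr do rewrite EFinM -directing_massE//.
  rewrite nneseriesZl// EFinM -directing_massE// measure_bigcup//.
  by congr (_ * _)%E; apply: eq_eseriesl => k; rewrite in_setT.
Qed.

End replace.

End de_finetti_product.

Section mixture.
Context (R : realType) d (Y : measurableType d).
Variable mu : probability (seqspace R * Y)%type R.
Hypothesis mu_exch : forall s, finite_permutation s ->
  forall S, measurable S -> mu (permute_fst s @^-1` S) = mu S.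

Let ind01 T (B : set T) y : 0 <= (\1_B y : R) <= 1.
Proof. by rewrite indicE; case: (_ \in _); rewrite ?lexx ?ler01. Qed.

Let prod01 (k : nat) (F : nat -> R) : (forall i, 0 <= F i <= 1) ->
  0 <= \prod_(i < k) F i <= 1.
Proof.
move=> F01; elim: k => [|k /andP[h0 h1]]; first by rewrite big_ord0 lexx ler01.
rewrite big_ord_recr /=; have /andP[f0 f1] := F01 k.
by rewrite mulr_ge0//= mulr_ile1.
Qed.

(** One coordinate is replaced at a time, starting from the last one; the
    factor it leaves behind is invariant and joins [W]. *)
Lemma exchangeable_product k (B : nat -> set R) (W : seqspace R * Y -> R) :
  (forall i, measurable (B i)) -> measurable_fun setT W ->
  (forall p, 0 <= W p <= 1) ->
  (forall s p, finite_permutation s -> W (permute_fst s p) = W p) ->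
  (\int[mu]_p (W p * \prod_(i < k) \1_(B i) (p.1 i))%:E =
   \int[mu]_p (W p * \prod_(i < k) directing_mass (B i) p)%:E)%E.
Proof.
move=> mB; elim: k W => [|k IH] W mW W01 WI.
  by apply: eq_integral => p _; rewrite !big_ord0.
pose Z p := W p * \prod_(i < k) \1_(B i) (p.1 i).
have mZ : measurable_fun setT Z.
  apply: measurable_funM => //; apply: measurable_prod => i _.
  apply: (measurableT_comp (measurable_indic (mB i))).
  exact: measurable_coord_fst.
have Z01 p : 0 <= Z p <= 1.
  have /andP[w0 w1] := W01 p.
  have /andP[p0 p1] := @prod01 k (fun i => \1_(B i) (p.1 i)) (fun i => ind01 _ _).
  by rewrite mulr_ge0//= mulr_ile1.
have ZI j p : (k <= j)%N -> Z (permute_fst (swap k j) p) = Z p.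
  move=> kj; rewrite /Z WI; last exact: swap_finite.
  congr (_ * _); apply: eq_bigr => i _ /=; rewrite /swap.
  by rewrite ltn_eqF// ltn_eqF// (leq_trans (ltn_ord i)).
transitivity (\int[mu]_p (Z p * \1_(B k) (p.1 k))%:E)%E.
  by apply: eq_integral => p _; rewrite big_ord_recr /= mulrA.
rewrite (replace_directing mu_exch mZ Z01 ZI (mB k)).
transitivity (\int[mu]_p ((W p * directing_mass (B k) p) *
    \prod_(i < k) \1_(B i) (p.1 i))%:E)%E.
  by apply: eq_integral => p _; rewrite /Z mulrAC.
rewrite IH.
- apply: eq_integral => p _; rewrite big_ord_recr /=; congr EFin.
  by rewrite -mulrA; congr (_ * _); exact: mulrC.
- by apply: measurable_funM => //; exact: measurable_directing_mass.
- move=> p; have /andP[w0 w1] := W01 p.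
  have /andP[d0 d1] := directing_mass01 p (mB k).
  by rewrite mulr_ge0//= mulr_ile1.
- move=> s p sf; rewrite WI//; congr (_ * _).
  by rewrite /directing_mass (directing_permute sf p.1).
Qed.

Lemma infinite_product_cylinder (P : probability R R) n (A : nat -> set R) :
  (forall i, measurable (A i)) ->
  infinite_product P (cylinder n A) = (\prod_(i < n) P (A i))%E.
Proof. exact: infinite_productP. Qed.

Lemma measurable_infinite_product_directing S : measurable S ->
  measurable_fun setT (fun x : seqspace R => infinite_product (directing x) S).
Proof.
rewrite [in X in X -> _](@cylindersE _ R); move: S.
apply: (@dynkin_induction _ _ _
  (fun S => measurable_fun setT (fun x : seqspace R => infinite_product (directing x) S))
  (@cylindersE _ R) (@cylinders_setI _ R)).
- rewrite (_ : (fun x => _) = cst 1%E); first exact: measurable_cst.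
  by apply/funext => x; rewrite probability_setT.
- move=> _ [n [A [mA ->]]].
  rewrite (_ : (fun x => _) = (fun x : seqspace R => \prod_(i < n) directing x (A i))%E).
    elim: n => [|n IH].
      rewrite (_ : (fun x => _) = cst 1%E); first exact: measurable_cst.
      by apply/funext => x; rewrite big_ord0.
    rewrite (_ : (fun x => _) = (fun x : seqspace R =>
        (\prod_(i < n) directing x (A i)) * directing x (A n))%E).
      by apply: emeasurable_funM => //; exact: measurable_directing.
    by apply/funext => x; rewrite big_ord_recr.
  by apply/funext => x; exact: infinite_product_cylinder.
- move=> A mA mdA.
  rewrite (_ : (fun x => _) = (fun x => 1 - infinite_product (directing x) A)%E).
    exact: emeasurable_funB.
  by apply/funext => x; rewrite probability_setC.
- move=> F mF tF mdF.
  rewrite (_ : (fun x => _) =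
      (fun x => \sum_(0 <= k <oo) infinite_product (directing x) (F k))%E).
    exact: ge0_emeasurable_sum.
  by apply/funext => x; rewrite measure_bigcup//; apply: eq_eseriesl => k; rewrite in_setT.
Qed.

(** The law of the pair obtained by drawing an independent sample from the
    directing measure of the first component. *)
Definition resample (p : seqspace R * Y) : giry (seqspace R * Y)%type R :=
  giry_prod ((infinite_product (directing p.1) : giry (seqspace R) R),
             (\d_(p.2) : giry Y R)).

Lemma measurable_resample : measurable_fun setT resample.
Proof.
apply: (measurableT_comp measurable_giry_prod).
apply: measurable_fun_pair.
  apply: measurable_giry_codensity => // S mS.
  exact: (measurableT_comp (measurable_infinite_product_directing mS) measurable_fst).
exact: (measurableT_comp (@measurable_giry_ret _ Y R) measurable_snd).
Qed.

Lemma resampleE p S :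
  resample p S = (infinite_product (directing p.1) \x \d_(p.2))%E S.
Proof. by []. Qed.

(** De Finetti's theorem with a parameter: on products of a cylinder and a
    measurable set both sides are computed by [exchangeable_product], where [W]
    is the indicator of the second factor. *)
Theorem de_finetti S : measurable S -> mu S = (\int[mu]_p resample p S)%E.
Proof.
move=> mS; pose nu := giry_bind (mu : giry _ R) measurable_resample.
have nuE U : measurable U -> nu U = (\int[mu]_p resample p U)%E.
  move=> mU; rewrite /nu /giry_bind /= /giry_join.
  rewrite -[LHS]/(giry_int (giry_map measurable_resample mu) (giry_ev ^~ U)).
  by rewrite giry_int_map//; exact: measurable_giry_ev.
rewrite -nuE//; move: S mS; apply: seqspaceX_unique => n A C mA mC.
have mAC : measurable (cylinder n A `*` C).
  by apply: measurableX; [exact: measurable_cylinder|exact: mC].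
rewrite [RHS]nuE//.
have mW : measurable_fun setT (fun p : seqspace R * Y => \1_C p.2 : R).
  exact: (measurableT_comp (measurable_indic mC) measurable_snd).
have indE (x : seqspace R) : \prod_(i < n) \1_(A i) (x i) = \1_(cylinder n A) x :> R.
  have [xA|xA] := boolP (x \in cylinder n A).
    rewrite indicE xA big1// => i _; rewrite indicE mem_set//.
    exact: (set_mem xA).
  rewrite indicE (negbTE xA).
  have [i [im xi]] : exists i, (i < n)%N /\ ~ A i (x i).
    apply: contrapT => h; move/negP: xA; apply; apply/mem_set => i im.
    by apply: contrapT => xi; apply: h; exists i.
  by rewrite (bigD1 (Ordinal im))//= indicE memNset// mul0r.
have resE p : resample p (cylinder n A `*` C) =
    (\1_C p.2 * \prod_(i < n) directing_mass (A i) p)%:E.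
  transitivity (infinite_product (directing p.1) (cylinder n A) * \d_(p.2) C)%E.
    by apply: product_measure1E => //; exact: measurable_cylinder.
  rewrite (infinite_product_cylinder (directing p.1) n mA) EFinM muleC.
  congr (_ * _)%E.
  rewrite (eq_bigr (fun i : 'I_n => (directing_mass (A i) p)%:E)); last first.
    by move=> i _; exact: directing_massE.
  by elim/big_ind2 : _ => // ? ? ? ? -> ->; rewrite EFinM.
rewrite (eq_integral _ _ (fun p _ => resE p)).
rewrite -(@exchangeable_product n A (fun p => \1_C p.2) mA mW
  (fun p => ind01 C p.2) (fun _ _ _ => erefl)).
transitivity (\int[mu]_p (\1_(cylinder n A `*` C) p)%:E)%E.
  by rewrite integral_indic// setIT.
apply: eq_integral => p _; congr EFin; rewrite indE !indicE in_setX.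
by case: (_ \in _); case: (_ \in _); rewrite ?mulr0 ?mulr1.
Qed.

End mixture.

(** * Empirical adequacy *)

Lemma product_dirac (R : realType) d1 d2 (X : measurableType d1)
    (Y : measurableType d2) (u : X) (v : Y) (S : set (X * Y)) : measurable S ->
  ((\d_u \x \d_v) S = \d_((u, v)) S :> \bar R)%E.
Proof.
move=> mS; rewrite /product_measure1 integral_dirac//; last first.
  exact: (measurable_fun_xsection (\d_v : {measure set Y -> \bar R})).
by rewrite diracT mul1e /= !diracE mem_xsection.
Qed.

Section adequacy.
Context (R : realType) dA dY (A : measurableType dA) (Y : measurableType dY).
Variable f : pkernel R A (seqspace R * Y)%type.
Hypothesis f_exch : exchangeable_fst f.

(** The tensor product of the permutation with the identity is deterministic, so
    the composite with it is an image measure. *)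
Lemma exchangeable_kernel a (P : probability (seqspace R * Y)%type R) :
  pdom f a -> pker f a = P :> (set _ -> \bar R) ->
  forall s, finite_permutation s -> forall S, measurable S ->
    P (permute_fst s @^-1` S) = P S.
Proof.
move=> fa faP s sf S mS; have [domE kerE] := f_exch sf.
have da : pdom (pkcomp (pktensor (pkperm R R s) (pkid R Y)) f) a.
  by rewrite domE.
have := kerE a da S mS.
rewrite -[X in X = _ -> _]/(\int[pker f a]_(p in setT `*` setT)
  ((\d_((fun i => p.1 (s i)) : seqspace R) \x \d_(p.2)) S))%E.
rewrite faP => <-; rewrite setXTT.
transitivity (\int[P]_p (\1_(permute_fst s @^-1` S) p)%:E)%E.
  rewrite integral_indic// ?setIT// -[X in measurable X]setTI.
  exact: (measurable_permute_fst s).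
by apply: eq_integral => p _; rewrite product_dirac.
Qed.

End adequacy.

(** Almost surely the resampled sequence is an independent sample. *)
Lemma de_finetti_product_dom (R : realType) d (Y : measurableType d)
    (P : probability (seqspace R * Y)%type R) :
  (forall s, finite_permutation s -> forall S, measurable S ->
     P (permute_fst s @^-1` S) = P S) ->
  P (pdom (es_real_bar R) `*` setT) = 1%E.
Proof.
move=> Pexch; have [mD _ _] := es_real_bar_partial_markov R.
have mDT : measurable (pdom (es_real_bar R) `*` [set: Y]) by exact: measurableX.
rewrite (de_finetti Pexch mDT).
rewrite (eq_integral (cst 1%E)); last first.
  move=> p _; transitivity (infinite_product (directing p.1) (pdom (es_real_bar R))
      * \d_(p.2) [set: Y])%E; first exact: product_measure1E.
  rewrite diracT mule1.
  exact: (product_es_real_bar_dom (infinite_productP (directing p.1))).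
by rewrite integral_cst// mul1e; exact: probability_setT.
Qed.

(** The two factors agree on measurable sets, so they have the same infinite
    products, and the same one is selected. *)
Lemma infinite_product_es_measure (R : realType) (x : seqspace R) : es_dom x ->
  infinite_product (es_measure x) = infinite_product (directing x).
Proof.
move=> xD; rewrite /infinite_product; congr xget.
apply/seteqP; split => m /= mP n B mB; rewrite mP//; apply: eq_bigr => i _.
  exact: es_measure_directing.
by apply: esym; exact: es_measure_directing.
Qed.

(** On the domain, which has full measure, the composite integrates the kernel
    [resample]. *)
Lemma es_real_bar_empirically_adequate (R : realType) :
  empirically_adequate (es_real_bar R).
Proof.
move=> dA dY A Y _ _ f [_ fP _] fexch.
have [mD _ _] := es_real_bar_partial_markov R.
set D := pdom (es_real_bar R) in mD *.
have mDT : measurable (D `*` [set: Y]) by exact: measurableX.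
have domE : pdom (pkcomp (pktensor (pkpower (es_real_bar R)) (pkid R Y)) f) =
    pdom f.
  apply/seteqP; split => [a [] //|a fa]; split => //.
  have [P faP] := fP a fa.
  rewrite -[X in pker f a X]/(D `*` [set: Y]) faP.
  exact: de_finetti_product_dom (exchangeable_kernel fexch fa faP).
split=> // a; rewrite domE => fa S mS.
have [P faP] := fP a fa.
have Pexch := exchangeable_kernel fexch fa faP.
rewrite -[LHS]/(\int[pker f a]_(p in D `*` [set: Y])
  ((infinite_product (es_measure p.1) \x \d_(p.2)) S))%E.
rewrite faP (de_finetti Pexch mS).
have P0 : P (~` (D `*` [set: Y])) = 0%E.
  by rewrite probability_setC// (de_finetti_product_dom Pexch) subee.
transitivity (\int[P]_(p in D `*` [set: Y]) resample p S)%E.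
  apply: eq_integral => p /set_mem [/es_real_bar_sub_dom pD _].
  by rewrite resampleE infinite_product_es_measure.
rewrite [RHS](ge0_negligible_integral (N := ~` (D `*` [set: Y])))//.
- by rewrite setTD setCK.
- exact: measurableC.
- exact: (measurableT_comp (measurable_giry_ev mS) (@measurable_resample R _ Y)).
Qed.

Theorem theorem3p19 (R : realType) :
  empirical_sampling_morphism (es_real_bar R).
Proof.
split.
- exact: standard_borel_real.
- exact: es_real_bar_partial_markov.
- exact: es_real_bar_permutation_invariant.
- exact: es_real_bar_empirically_adequate.
Qed.
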